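(* Let $\psi\in L^2(\mathbb{R}^2)$ and suppose that for almost every $y\in\mathbb{R}$, $\operatorname{ess\text{-}supp}\,\psi(\hat{\cdot},y)\subset[-1/2,1/2]$. For $k,m\in\mathbb{Z}$ put $$\psi_{k,m}(x_1,x_2)=2^{-k/2}\psi\left(\frac{x_1-2^k m}{2^k},x_2\right).$$ The system $\{\psi_{k,m}\}_{k,m\in\mathbb{Z}}$, with the counting measure on $\mathbb{Z}\times\mathbb{Z}$ as parameter measure, is reproducing in $L^2(\mathbb{R}^2)$ (i.e. $\sum_{k,m}\langle f,\psi_{k,m}\rangle\langle\psi_{k,m},g\rangle=\langle f,g\rangle$ for all $f,g\in L^2(\mathbb{R}^2)$) if and only if for every pair $f,g\in L^2(\mathbb{R})$ the equality $$\langle f,g\rangle=\sum_{k\in\mathbb{Z}}\int_{\mathbb{R}}\overline{\psi\left(\widehat{2^k\xi},y\right)}\,f(y)\,dy\int_{\mathbb{R}}\psi\left(\widehat{2^k\xi},y\right)\overline{g(y)}\,dy$$ holds for almost every $\xi\in\mathbb{R}$.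
   Context: The Fourier transform is $\hat f(\xi)=\int f(x)e^{-2\pi i x\xi}\,dx$. For $\psi(x_1,x_2)$, $\psi(\hat{s},y)$ denotes the Fourier transform of $\psi$ in the first variable only, evaluated at frequency $s$, with second variable $y$; $\psi(\hat{\cdot},y)$ is this function of the frequency variable for fixed $y$. For a measurable function $h$ on a topological space with a Borel measure $\mu$, $\operatorname{ess\text{-}supp}\,h$ is the intersection of all closed sets $F$ such that $h=0$ $\mu$-a.e. on the complement of $F$. *)

(* Defs.v *)
From HB Require Import structures.
From mathcomp Require Import all_boot all_order all_algebra.
From mathcomp Require Import all_classical all_reals all_analysis.
From mathcomp Require Import complex.
Set Implicit Arguments. Unset Strict Implicit. Unset Printing Implicit Defensive.
Import Order.TTheory GRing.Theory Num.Theory.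
Import numFieldNormedType.Exports.
Local Open Scope classical_set_scope.
Local Open Scope ring_scope.
Local Open Scope complex_scope.

Definition leb (R : realType) : {measure set (measurableTypeR R) -> \bar R} :=
  @lebesgue_measure R.
Definition leb2 (R : realType)
  : {measure set (measurableTypeR R * measurableTypeR R)%type -> \bar R} := ((@lebesgue_measure R) \x (@lebesgue_measure R))%E.
Arguments leb : clear implicits.
Arguments leb2 : clear implicits.

Definition sqmod (R : realType) (z : R[i]) : R := complex.Re z ^+ 2 + complex.Im z ^+ 2.
Definition cabs (R : realType) (z : R[i]) : R := Num.sqrt (sqmod z).

Definition cmeasurable d (T : measurableType d) (R : realType) (f : T -> R[i]) :=
  measurable_fun setT (fun x => complex.Re (f x)) /\ measurable_fun setT (fun x => complex.Im (f x)).

Definition L2 d (T : measurableType d) (R : realType)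
  (mu : {measure set T -> \bar R}) (f : T -> R[i]) :=
  cmeasurable f /\ (\int[mu]_x (sqmod (f x))%:E < +oo)%E.

Definition cint d (T : measurableType d) (R : realType)
  (mu : {measure set T -> \bar R}) (D : set T) (f : T -> R[i]) : R[i] :=
  (Rintegral mu D (fun x => complex.Re (f x)))%:C
  + 'i * (Rintegral mu D (fun x => complex.Im (f x)))%:C.

Definition inner d (T : measurableType d) (R : realType)
  (mu : {measure set T -> \bar R}) (f g : T -> R[i]) : R[i] :=
  cint mu setT (fun x => f x * conjc (g x)).

Definition expi (R : realType) (t : R) : R[i] := Complex (cos t) (sin t).

Definition fourier_trunc (R : realType) (h : R -> R[i]) (N : R) (xi : R) : R[i] :=
  cint (leb R) `[- N, N] (fun x => h x * expi (- (2 * pi * x * xi))).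

Definition is_fourier_L2 (R : realType) (h F : R -> R[i]) :=
  L2 (leb R) h /\ L2 (leb R) F /\
  ((fun N : nat =>
      \int[leb R]_xi (sqmod (F xi - fourier_trunc h N%:R xi))%:E)
     @ \oo --> (0 : \bar R))%E.

Definition ess_supp (R : realType) (mu : {measure set (measurableTypeR R) -> \bar R})
  (h : R -> R[i])
  : set R :=
  \bigcap_(F in [set F : set R | closed F /\ {ae mu, forall x, ~ F x -> h x = 0}]) F.

(* the sum over Z of a : int -> C exists in the sense of the counting measure:
   a is absolutely summable and its sum is L (computed via symmetric
   exhaustion, which for absolutely summable families is the sum) *)
Definition zsum_is (R : realType) (a : int -> R[i]) (L : R[i]) :=
  (\esum_(k in [set: int]) (cabs (a k))%:E < +oo)%E /\
  let S := fun N : nat => \sum_(i < (N + N).+1) a (i%:Z - N%:Z) in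
  (fun N => complex.Re (S N)) @ \oo --> complex.Re L /\ (fun N => complex.Im (S N)) @ \oo --> complex.Im L.

Definition zsum2_is (R : realType) (a : int * int -> R[i]) (L : R[i]) :=
  (\esum_(km in [set: int * int]) (cabs (a km))%:E < +oo)%E /\
  let S := fun N : nat =>
    \sum_(i < (N + N).+1) \sum_(j < (N + N).+1) a (i%:Z - N%:Z, j%:Z - N%:Z) in
  (fun N => complex.Re (S N)) @ \oo --> complex.Re L /\ (fun N => complex.Im (S N)) @ \oo --> complex.Im L.

Definition psi_km (R : realType) (psi : R * R -> R[i]) (k m : int) : R * R -> R[i] :=
  fun x => ((2 : R) `^ (- (k%:~R) / 2))%:C
           * psi ((x.1 - (2 : R) `^ (k%:~R) * m%:~R) / (2 : R) `^ (k%:~R), x.2).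

Definition reproducing (R : realType) (psi : R * R -> R[i]) :=
  forall f g : R * R -> R[i], L2 (leb2 R) f -> L2 (leb2 R) g ->
    zsum2_is (fun km => inner (leb2 R) f (psi_km psi km.1 km.2)
                        * inner (leb2 R) (psi_km psi km.1 km.2) g)
             (inner (leb2 R) f g).

(* Main.v *)
Require Import Defs.
From HB Require Import structures.
From mathcomp Require Import all_boot all_order all_algebra.
From mathcomp Require Import all_classical all_reals all_analysis.
From mathcomp Require Import finmap measurable_realfun complex ring lra zify.
Import Order.TTheory GRing.Theory Num.Theory.
Import numFieldNormedType.Exports.
Local Open Scope classical_set_scope.
Local Open Scope ring_scope.
Local Open Scope complex_scope.
Set Implicit Arguments.
Unset Strict Implicit.
Unset Printing Implicit Defensive.

(* Write F for the Fourier transform of f in the first variable and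
   <F(xi), Psi_k(xi)> for the pairing, in the second variable, of F(xi, .) with
   Psi(2^k xi, .).  For fixed k, rescaling the frequency by 2^k makes the numbers
   <f, psi_(k, m)>, m in Z, the Fourier coefficients of a function carried by an
   interval of length one, so Parseval's identity for Fourier series gives
     sum_(k, m) |<f, psi_(k, m)>|^2 = int sum_k |<F(xi), Psi_k(xi)>|^2 dxi.
   If the system is reproducing, taking F = 1_A (x) h for all bounded measurable A
   yields sum_k |<h, Psi_k(xi)>|^2 = |h|^2 for almost every xi, and polarization
   gives the fibre equations.  Conversely the fibre equations give, by Fubini and
   Plancherel, sum |<f, psi_(k, m)>|^2 = |f|^2 for f in the span of the tensors
   a^ (x) h with a bounded and compactly supported; this span is dense, a Parseval
   identity on a dense set extends to the whole space, and polarization concludes.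
   Staying with such tensors keeps every fibre function square integrable.

   Fourier series are complete because indicators of intervals are limits of
   bounded trigonometric polynomials, and Plancherel's theorem follows from
   Parseval's by integrating over translates of the lattice of frequencies. *)

(** Two obstacles shape the proof. The null set in a fibre equation depends on the pair f, g, so the
    equations may be combined only finitely often. This is why they are applied to the algebraic
    span of tensors and reach the whole space through density in norm. Likewise no boundedness of
    the coefficient map is known beforehand: Bessel's inequality has to come out of Parseval on the
    dense set. The second obstacle is that the partial transform of psi is given only as an L^2
    limit of truncated integrals, for almost every y. It is therefore used weakly, through pairings
    with inverse transforms of bounded, compactly supported functions, for which all integrals
    converge absolutely; after that the transform may be altered on a null set. The constant 1/2 is
    tied to the translation step 2^k: after rescaling by 2^k the step is 1, the exponentials have
    integer frequencies, and they form an orthonormal basis on an interval of length exactly 1.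
    Estimates are made with squared moduli and squared norms, with a free parameter in place of
    square roots. *)

Local Notation Re := complex.Re.
Local Notation Im := complex.Im.

(** * Complex-valued square-integrable functions *)

Section complex_numbers.
Context {R : realType}.
Implicit Types z w : R[i].

Lemma complex_ext z w : Re z = Re w -> Im z = Im w -> z = w.
Proof. by case: z w => [a b] [c d] /= -> ->. Qed.

Lemma ReD z w : Re (z + w) = Re z + Re w. Proof. by case: z w => [a b] [c d]. Qed.
Lemma ImD z w : Im (z + w) = Im z + Im w. Proof. by case: z w => [a b] [c d]. Qed.
Lemma ReN z : Re (- z) = - Re z. Proof. by case: z. Qed.
Lemma ImN z : Im (- z) = - Im z. Proof. by case: z. Qed.
Lemma ReM z w : Re (z * w) = Re z * Re w - Im z * Im w.
Proof. by case: z w => [a b] [c d]. Qed.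
Lemma ImM z w : Im (z * w) = Re z * Im w + Im z * Re w.
Proof. by case: z w => [a b] [c d]. Qed.
Lemma ReC z : Re (conjc z) = Re z. Proof. by case: z. Qed.
Lemma ImC z : Im (conjc z) = - Im z. Proof. by case: z. Qed.
Lemma Re0 : Re (0 : R[i]) = 0. Proof. by []. Qed.
Lemma Im0 : Im (0 : R[i]) = 0. Proof. by []. Qed.
Lemma Re1 : Re (1 : R[i]) = 1. Proof. by []. Qed.
Lemma Im1 : Im (1 : R[i]) = 0. Proof. by []. Qed.
Definition ReImE := (ReD, ImD, ReN, ImN, ReM, ImM, ReC, ImC, Re0, Im0, Re1, Im1).

Lemma conjcM z w : conjc (z * w) = conjc z * conjc w.
Proof. by apply: complex_ext; rewrite !ReImE; ring. Qed.

Lemma conjcD z w : conjc (z + w) = conjc z + conjc w.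
Proof. by apply: complex_ext; rewrite !ReImE; ring. Qed.

Lemma conjcN z : conjc (- z) = - conjc z.
Proof. by apply: complex_ext; rewrite !ReImE. Qed.

Lemma conjcB z w : conjc (z - w) = conjc z - conjc w.
Proof. by rewrite conjcD conjcN. Qed.

Lemma sqmod_ge0 z : 0 <= sqmod z.
Proof. by rewrite addr_ge0// sqr_ge0. Qed.

Lemma sqmod0 : sqmod (0 : R[i]) = 0.
Proof. by rewrite /sqmod/= expr0n/= addr0. Qed.

Lemma sqmodM z w : sqmod (z * w) = sqmod z * sqmod w.
Proof. by rewrite /sqmod !ReImE; ring. Qed.

Lemma sqmodC z : sqmod (conjc z) = sqmod z.
Proof. by rewrite /sqmod !ReImE sqrrN. Qed.

Lemma sqmodN z : sqmod (- z) = sqmod z.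
Proof. by rewrite /sqmod !ReImE !sqrrN. Qed.

Lemma sqmodB z w : sqmod (z - w) = sqmod (w - z).
Proof. by rewrite -sqmodN opprB. Qed.

Lemma sqmod_real (r : R) : sqmod r%:C = r ^+ 2.
Proof. by rewrite /sqmod /= expr0n/= addr0. Qed.

Lemma mulc_conj z : z * conjc z = (sqmod z)%:C.
Proof. by apply: complex_ext; rewrite /sqmod !ReImE /=; ring. Qed.

Lemma sqmod_eq0 z : sqmod z = 0 -> z = 0.
Proof.
move/eqP; rewrite paddr_eq0 ?sqr_ge0// !sqrf_eq0 => /andP[/eqP a0 /eqP b0].
exact: complex_ext.
Qed.

Lemma sqmodD_le z w : sqmod (z + w) <= 2 * (sqmod z + sqmod w).
Proof.
rewrite /sqmod !ReImE; have := sqr_ge0 (Re z - Re w).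
by have := sqr_ge0 (Im z - Im w); lra.
Qed.

Lemma normRe_le z w : `|Re (z * w)| <= sqmod z + sqmod w.
Proof.
rewrite /sqmod !ReImE ler_norml; case: z w => [a b] [c d] /=.
have := (sqr_ge0 (a - c), sqr_ge0 (a + c), sqr_ge0 (b - d), sqr_ge0 (b + d)).
have := (sqr_ge0 a, sqr_ge0 b, sqr_ge0 c, sqr_ge0 d).
by move=> [[[? ?] ?] ?] [[[? ?] ?] ?]; apply/andP; split; lra.
Qed.

Lemma normIm_le z w : `|Im (z * w)| <= sqmod z + sqmod w.
Proof.
rewrite /sqmod !ReImE ler_norml; case: z w => [a b] [c d] /=.
have := (sqr_ge0 (a - d), sqr_ge0 (a + d), sqr_ge0 (b - c), sqr_ge0 (b + c)).
have := (sqr_ge0 a, sqr_ge0 b, sqr_ge0 c, sqr_ge0 d).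
by move=> [[[? ?] ?] ?] [[[? ?] ?] ?]; apply/andP; split; lra.
Qed.

Lemma expiD (s t : R) : expi (s + t) = expi s * expi t.
Proof. by apply: complex_ext; rewrite !ReImE /= ?cosD ?sinD; ring. Qed.

Lemma expiN (t : R) : expi (- t) = conjc (expi t).
Proof. by apply: complex_ext; rewrite !ReImE /= ?cosN ?sinN. Qed.

Lemma expi0 : expi 0 = 1 :> R[i].
Proof. by rewrite /expi cos0 sin0. Qed.

Lemma sqmod_expi (t : R) : sqmod (expi t) = 1.
Proof. exact: cos2Dsin2. Qed.

End complex_numbers.

Section measurability.
Context d (T : measurableType d) (R : realType).
Implicit Types (f g : T -> R[i]).

Lemma cmeasurable_cst (c : R[i]) : cmeasurable (fun _ : T => c).
Proof. by split; exact: measurable_cst. Qed.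

Lemma cmeasurable_real (f : T -> R) :
  measurable_fun setT f -> cmeasurable (fun x => (f x)%:C).
Proof. by move=> mf; split => //=; exact: measurable_cst. Qed.

Lemma cmeasurableD f g :
  cmeasurable f -> cmeasurable g -> cmeasurable (fun x => f x + g x).
Proof.
move=> [rf jf] [rg jg]; split.
  by under eq_fun do rewrite ReD; exact: measurable_funD.
by under eq_fun do rewrite ImD; exact: measurable_funD.
Qed.

Lemma cmeasurableM f g :
  cmeasurable f -> cmeasurable g -> cmeasurable (fun x => f x * g x).
Proof.
move=> [rf jf] [rg jg]; split.
  by under eq_fun do rewrite ReM; apply: measurable_funB; exact: measurable_funM.
by under eq_fun do rewrite ImM; apply: measurable_funD; exact: measurable_funM.
Qed.

Lemma cmeasurable_conj f : cmeasurable f -> cmeasurable (fun x => conjc (f x)).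
Proof.
move=> [rf jf]; split; first by under eq_fun do rewrite ReC.
by under eq_fun do rewrite ImC; exact: measurableT_comp.
Qed.

Lemma cmeasurableN f : cmeasurable f -> cmeasurable (fun x => - f x).
Proof.
move=> [rf jf]; split.
  by under eq_fun do rewrite ReN; exact: measurableT_comp.
by under eq_fun do rewrite ImN; exact: measurableT_comp.
Qed.

Lemma cmeasurableB f g :
  cmeasurable f -> cmeasurable g -> cmeasurable (fun x => f x - g x).
Proof. by move=> mf mg; apply: cmeasurableD => //; exact: cmeasurableN. Qed.

Lemma measurable_sqmod f : cmeasurable f -> measurable_fun setT (fun x => sqmod (f x)).
Proof. by move=> [rf jf]; apply: measurable_funD; exact: measurable_funX. Qed.

Lemma emeasurable_sqmod f :
  cmeasurable f -> measurable_fun setT (fun x => (sqmod (f x))%:E).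
Proof. by move=> mf; apply/measurable_EFinP; exact: measurable_sqmod. Qed.

Lemma cmeasurable_indic f A : measurable A -> cmeasurable f ->
  cmeasurable (fun x => (\1_A x)%:C * f x).
Proof.
move=> mA mf; apply: cmeasurableM => //; apply: cmeasurable_real.
exact: measurable_indic.
Qed.

End measurability.

Lemma cmeasurable_comp d1 d2 (T1 : measurableType d1) (T2 : measurableType d2)
  (R : realType) (f : T2 -> R[i]) (g : T1 -> T2) :
  cmeasurable f -> measurable_fun setT g -> cmeasurable (fun x => f (g x)).
Proof.
move=> [rf jf] mg; split.
  exact: (measurableT_comp rf mg).
exact: (measurableT_comp jf mg).
Qed.

Section almost_everywhere.
Context d (T : measurableType d) (R : realType) (mu : {measure set T -> \bar R}).
Implicit Types P Q : T -> Prop.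

Lemma aeS P Q : {ae mu, forall x, P x} -> (forall x, P x -> Q x) -> {ae mu, forall x, Q x}.
Proof. by move=> hP PQ; apply: filterS hP. Qed.

Lemma aeI P Q : {ae mu, forall x, P x} -> {ae mu, forall x, Q x} ->
  {ae mu, forall x, P x /\ Q x}.
Proof. by move=> hP hQ; apply: filterS2 hP hQ. Qed.

Lemma ae_all_int (P : int -> T -> Prop) :
  (forall k, {ae mu, forall x, P k x}) -> {ae mu, forall x, forall k, P k x}.
Proof.
move=> hP; have h1 := ae_foralln (fun n : nat => hP n%:Z).
have h2 := ae_foralln (fun n : nat => hP (Negz n)).
by apply: filterS2 h1 h2 => x p1 p2 [n|n].
Qed.

End almost_everywhere.

(** * Integration of complex-valued functions *)

Section complex_integral.
Context d (T : measurableType d) (R : realType) (mu : {measure set T -> \bar R}).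
Implicit Types (f g : T -> R[i]).

Lemma integrable_ext (f g : T -> \bar R) :
  mu.-integrable setT f -> f =1 g -> mu.-integrable setT g.
Proof. by move=> + /funext <-. Qed.

Definition cintble f :=
  mu.-integrable setT (EFin \o (fun x => Re (f x))) /\
  mu.-integrable setT (EFin \o (fun x => Im (f x))).

Lemma cintE D f : cint mu D f =
  Complex (\int[mu]_(x in D) Re (f x)) (\int[mu]_(x in D) Im (f x)).
Proof. by apply: complex_ext; rewrite !ReImE /=; ring. Qed.

Lemma cintD f g : cintble f -> cintble g ->
  cint mu setT (fun x => f x + g x) = cint mu setT f + cint mu setT g.
Proof.
move=> [rf jf] [rg jg]; rewrite !cintE.
by apply: complex_ext; rewrite !ReImE /= -RintegralD//; apply: eq_Rintegral => x _;
   rewrite ReImE.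
Qed.

Lemma cintbleZ (c : R[i]) f : cintble f -> cintble (fun x => c * f x).
Proof.
move=> [rf jf]; split.
  apply: (integrable_ext (integrableB measurableT
    (integrableZl measurableT (Re c) rf) (integrableZl measurableT (Im c) jf))).
  by move=> x; rewrite /= ReM -!EFinM -EFinB.
apply: (integrable_ext (integrableD measurableT
    (integrableZl measurableT (Re c) jf) (integrableZl measurableT (Im c) rf))).
by move=> x; rewrite /= ImM -!EFinM -EFinD.
Qed.

Lemma cintZ (c : R[i]) f : cintble f ->
  cint mu setT (fun x => c * f x) = c * cint mu setT f.
Proof.
move=> [rf jf]; rewrite !cintE.
have iZ (r : R) h : mu.-integrable setT (EFin \o h) ->
    mu.-integrable setT (EFin \o (fun x => r * h x)).
  by move=> ih; apply: (integrable_ext (integrableZl measurableT r ih)).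
apply: complex_ext; rewrite !ReImE /= -!RintegralZl//.
  by rewrite -RintegralB; [apply: eq_Rintegral => x _; rewrite ReM| |exact: iZ..].
by rewrite -RintegralD; [apply: eq_Rintegral => x _; rewrite ImM| |exact: iZ..].
Qed.

Lemma cintble_conj f : cintble f -> cintble (fun x => conjc (f x)).
Proof.
move=> [rf jf]; split.
  by apply: (integrable_ext rf) => x; rewrite /= ReC.
by apply: (integrable_ext (integrableN jf)) => x; rewrite /= ImC.
Qed.

Lemma cint_conj f : cintble f ->
  cint mu setT (fun x => conjc (f x)) = conjc (cint mu setT f).
Proof.
move=> [rf jf]; rewrite !cintE; apply: complex_ext; rewrite !ReImE /=.
  by apply: eq_Rintegral => x _; rewrite ReC.
rewrite -mulN1r -RintegralZl//; apply: eq_Rintegral => x _.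
by rewrite ImC mulN1r.
Qed.

Lemma eq_cint D f g : {in D, f =1 g} -> cint mu D f = cint mu D g.
Proof.
by move=> fg; rewrite !cintE; congr Complex; apply: eq_Rintegral => x xD; rewrite fg.
Qed.

Lemma ae_eq_cint f g : cmeasurable f -> cmeasurable g ->
  {ae mu, forall x, f x = g x} -> cint mu setT f = cint mu setT g.
Proof.
move=> [rf jf] [rg jg] fg; rewrite !cintE /Rintegral.
congr (Complex (fine _) (fine _)); apply: ae_eq_integral => //;
  try exact/measurable_EFinP; by apply: filterS fg => x /= -> _.
Qed.

Lemma cintble_le f (h : T -> R) : cmeasurable f ->
  mu.-integrable setT (EFin \o h) ->
  (forall x, `|Re (f x)| <= h x) -> (forall x, `|Im (f x)| <= h x) -> cintble f.
Proof.
move=> [rf jf] ih rh jh; split.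
  apply: (le_integrable measurableT _ _ ih); first exact/measurable_EFinP.
  by move=> x _ /=; rewrite lee_fin; apply: le_trans (rh x) _; exact: ler_norm.
apply: (le_integrable measurableT _ _ ih); first exact/measurable_EFinP.
by move=> x _ /=; rewrite lee_fin; apply: le_trans (jh x) _; exact: ler_norm.
Qed.

Lemma cint_mkcond D f :
  cint mu D f = cint mu setT (fun x => (\1_D x)%:C * f x).
Proof.
rewrite !cintE; congr Complex; rewrite Rintegral_mkcond; apply: eq_Rintegral => x _;
  rewrite /patch ReImE /= indicE; 
  (case: ifP => xD /=; [ring|transitivity (0 : R) => //; ring]).
Qed.

End complex_integral.

(** * Inner product and squared norm on square-integrable functions *)

Section L2_theory.
Context d (T : measurableType d) (R : realType) (mu : {measure set T -> \bar R}).
Implicit Types (f g h : T -> R[i]).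

Definition nsq f : R := \int[mu]_x sqmod (f x).

Lemma nsq_ge0 f : 0 <= nsq f.
Proof. by apply: Rintegral_ge0 => x _; exact: sqmod_ge0. Qed.

Lemma L2_meas f : L2 mu f -> cmeasurable f. Proof. by case. Qed.

Lemma L2_integrable f : L2 mu f -> mu.-integrable setT (EFin \o (fun x => sqmod (f x))).
Proof.
move=> [mf fi]; apply/integrableP; split; first exact: emeasurable_sqmod.
apply: le_lt_trans fi; rewrite le_eqVlt; apply/orP; left; apply/eqP.
by apply: eq_integral => x _; rewrite /= ger0_norm// sqmod_ge0.
Qed.

Lemma nsqE f : L2 mu f -> (nsq f)%:E = (\int[mu]_x (sqmod (f x))%:E)%E.
Proof.
move=> lf; rewrite fineK//; apply: integrable_fin_num => //.
exact: L2_integrable.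
Qed.

Lemma L2_le f g (c : R) : L2 mu f -> cmeasurable g ->
  (forall x, sqmod (g x) <= c * sqmod (f x)) -> L2 mu g.
Proof.
move=> lf mg fg; split=> //.
apply: (@le_lt_trans _ _ (\int[mu]_x (c * sqmod (f x))%:E)%E).
  apply: ge0_le_integral => //.
  - by move=> x _; rewrite lee_fin sqmod_ge0.
  - exact: emeasurable_sqmod.
  - by apply/measurable_EFinP/measurable_funM => //; apply: measurable_sqmod; case: lf.
  - by move=> x _; rewrite lee_fin.
under eq_integral do rewrite EFinM.
rewrite integralZl//; last exact: L2_integrable.
by rewrite -nsqE// -EFinM ltry.
Qed.

Lemma L2D f g : L2 mu f -> L2 mu g -> L2 mu (fun x => f x + g x).
Proof.
move=> lf lg; split; first by apply: cmeasurableD; [case: lf|case: lg].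
apply: (@le_lt_trans _ _ (\int[mu]_x (2%:E * ((sqmod (f x))%:E + (sqmod (g x))%:E)))%E).
  apply: ge0_le_integral => //.
  - by move=> x _; rewrite lee_fin sqmod_ge0.
  - exact: emeasurable_sqmod (cmeasurableD (L2_meas lf) (L2_meas lg)).
  - apply/measurable_EFinP/measurable_funM => //; apply: measurable_funD.
      exact: measurable_sqmod (L2_meas lf).
    exact: measurable_sqmod (L2_meas lg).
  - by move=> x _; rewrite -EFinD -EFinM lee_fin sqmodD_le.
rewrite integralZl//; last first.
  exact: integrableD (L2_integrable lf) (L2_integrable lg).
rewrite integralD//; [|exact: (L2_integrable lf)|exact: (L2_integrable lg)].
by rewrite -!nsqE// -EFinD -EFinM ltry.
Qed.

Lemma L2Z (c : R[i]) f : L2 mu f -> L2 mu (fun x => c * f x).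
Proof.
move=> lf; apply: (L2_le (c := sqmod c) lf).
  by apply: cmeasurableM; [exact: cmeasurable_cst|case: lf].
by move=> x; rewrite sqmodM.
Qed.

Lemma L2_conj f : L2 mu f -> L2 mu (fun x => conjc (f x)).
Proof.
move=> lf; apply: (L2_le (c := 1) lf); first by apply: cmeasurable_conj; case: lf.
by move=> x; rewrite sqmodC mul1r.
Qed.

Lemma L2N f : L2 mu f -> L2 mu (fun x => - f x).
Proof.
move=> lf; apply: (L2_le (c := 1) lf); first by apply: cmeasurableN; case: lf.
by move=> x; rewrite sqmodN mul1r.
Qed.

Lemma L2B f g : L2 mu f -> L2 mu g -> L2 mu (fun x => f x - g x).
Proof. by move=> lf lg; apply: L2D => //; exact: L2N. Qed.

Lemma L2_0 : L2 mu (fun _ => 0).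
Proof.
split; first exact: cmeasurable_cst.
by rewrite integral0_eq// => x _; rewrite sqmod0.
Qed.

Lemma L2_indic f A : measurable A -> L2 mu f -> L2 mu (fun x => (\1_A x)%:C * f x).
Proof.
move=> mA lf; apply: (L2_le (c := 1) lf).
  by apply: cmeasurable_indic => //; case: lf.
move=> x; rewrite mul1r sqmodM sqmod_real indicE; case: (_ \in _).
  by rewrite expr1n mul1r.
by rewrite expr0n mul0r sqmod_ge0.
Qed.

Lemma cintble_L2 f g : L2 mu f -> L2 mu g -> cintble mu (fun x => f x * conjc (g x)).
Proof.
move=> lf lg.
apply: (@cintble_le _ _ _ _ _ (fun x => sqmod (f x) + sqmod (g x))).
- by apply: cmeasurableM; [case: lf|apply: cmeasurable_conj; case: lg].
- exact: integrable_ext (integrableD measurableT (L2_integrable lf) (L2_integrable lg)) _.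
- by move=> x; rewrite -(sqmodC (g x)); exact: normRe_le.
- by move=> x; rewrite -(sqmodC (g x)); exact: normIm_le.
Qed.

Lemma innerDl f g h : L2 mu f -> L2 mu g -> L2 mu h ->
  inner mu (fun x => f x + g x) h = inner mu f h + inner mu g h.
Proof.
move=> lf lg lh; rewrite /inner -cintD; [|exact: cintble_L2..].
by apply: eq_cint => x _; rewrite mulrDl.
Qed.

Lemma innerZl c f h : L2 mu f -> L2 mu h ->
  inner mu (fun x => c * f x) h = c * inner mu f h.
Proof.
move=> lf lh; rewrite /inner -cintZ; [|exact: cintble_L2..].
by apply: eq_cint => x _; rewrite mulrA.
Qed.

Lemma innerC f g : L2 mu f -> L2 mu g -> inner mu g f = conjc (inner mu f g).
Proof.
move=> lf lg; rewrite /inner -cint_conj; [|exact: cintble_L2..].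
by apply: eq_cint => x _; rewrite conjcM conjcK mulrC.
Qed.

Lemma innerDr f g h : L2 mu f -> L2 mu g -> L2 mu h ->
  inner mu h (fun x => f x + g x) = inner mu h f + inner mu h g.
Proof.
move=> lf lg lh; rewrite innerC; [|exact: L2D|by []].
by rewrite innerDl// conjcD -!innerC.
Qed.

Lemma innerZr c f h : L2 mu f -> L2 mu h ->
  inner mu h (fun x => c * f x) = conjc c * inner mu h f.
Proof.
move=> lf lh; rewrite innerC; [|exact: L2Z|by []].
by rewrite innerZl// conjcM -!innerC.
Qed.

Lemma innerNl f h : L2 mu f -> L2 mu h ->
  inner mu (fun x => - f x) h = - inner mu f h.
Proof.
move=> lf lh; rewrite -mulN1r -(innerZl _ lf lh).
by apply: eq_cint => x _; rewrite mulN1r.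
Qed.

Lemma innerBl f g h : L2 mu f -> L2 mu g -> L2 mu h ->
  inner mu (fun x => f x - g x) h = inner mu f h - inner mu g h.
Proof. by move=> lf lg lh; rewrite innerDl ?innerNl//; exact: L2N. Qed.

Lemma innerBr f g h : L2 mu f -> L2 mu g -> L2 mu h ->
  inner mu h (fun x => f x - g x) = inner mu h f - inner mu h g.
Proof.
move=> lf lg lh; rewrite innerC; [|exact: L2B|by []].
by rewrite innerBl// conjcB -!innerC.
Qed.

Lemma inner0l h : inner mu (fun _ => 0) h = 0.
Proof.
rewrite /inner cintE; apply: complex_ext => /=; rewrite /Rintegral integral0_eq//;
  by move=> x _; rewrite mul0r.
Qed.

Lemma inner_nsq f : inner mu f f = (nsq f)%:C.
Proof.
rewrite /inner cintE; apply: complex_ext => /=.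
  by apply: eq_Rintegral => x _; rewrite mulc_conj.
by rewrite /Rintegral integral0_eq// => x _; rewrite mulc_conj.
Qed.

Lemma nsqZ c f : L2 mu f -> nsq (fun x => c * f x) = sqmod c * nsq f.
Proof.
move=> lf; rewrite -RintegralZl//; last exact: L2_integrable.
by apply: eq_Rintegral => x _; rewrite sqmodM.
Qed.

Lemma nsqD f g : L2 mu f -> L2 mu g ->
  nsq (fun x => f x + g x) = nsq f + nsq g + 2 * Re (inner mu f g).
Proof.
move=> lf lg; have : inner mu (fun x => f x + g x) (fun x => f x + g x) =
    inner mu f f + inner mu g g + (inner mu f g + conjc (inner mu f g)).
  by rewrite innerDl ?innerDr -?innerC//; [ring|exact: L2D].
rewrite !inner_nsq => /(congr1 (@complex.Re R)); rewrite !ReImE /= => ->; ring.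
Qed.

Lemma nsqN f : nsq (fun x => - f x) = nsq f.
Proof. by apply: eq_Rintegral => x _; rewrite sqmodN. Qed.

Lemma nsqBC f g : nsq (fun x => f x - g x) = nsq (fun x => g x - f x).
Proof. by apply: eq_Rintegral => x _; rewrite sqmodB. Qed.

Lemma nsqB f g : L2 mu f -> L2 mu g ->
  nsq (fun x => f x - g x) = nsq f + nsq g - 2 * Re (inner mu f g).
Proof.
move=> lf lg; rewrite nsqD//; last exact: L2N.
have -> : inner mu f (fun x => - g x) = - inner mu f g.
  by rewrite innerC; [rewrite innerNl// conjcN -innerC|exact: L2N|].
by rewrite nsqN ReN; ring.
Qed.

Lemma nsqD_le f g : L2 mu f -> L2 mu g ->
  nsq (fun x => f x + g x) <= 2 * (nsq f + nsq g).
Proof.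
move=> lf lg; have := nsq_ge0 (fun x => f x - g x).
by rewrite nsqB// nsqD//; lra.
Qed.

(* The parameter t = s <f,g> with s real makes the discriminant argument work
   without taking moduli. *)
Lemma cauchy_schwarz f g : L2 mu f -> L2 mu g ->
  sqmod (inner mu f g) <= nsq f * nsq g.
Proof.
move=> lf lg; set z := inner mu f g.
have key (s : R) : 0 <= nsq f - 2 * s * sqmod z + s ^+ 2 * sqmod z * nsq g.
  have := nsq_ge0 (fun x => f x - (s%:C * z) * g x).
  rewrite nsqB//; last exact: L2Z.
  rewrite nsqZ// innerZr// -/z sqmodM sqmod_real => h; apply: le_trans h _.
  rewrite le_eqVlt; apply/orP; left; apply/eqP; move: z => [p q].
  by rewrite /sqmod !ReImE /=; ring.
have z0 := sqmod_ge0 z; have f0 := nsq_ge0 f; have g0 := nsq_ge0 g.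
have [gz|gz] := eqVneq (nsq g) 0.
  rewrite gz mulr0; have [-> //|zp] := eqVneq (sqmod z) 0.
  (* When g has norm 0 the expression is affine in s; this value of s makes it equal to -1, which is
     absurd. *)
  have := key ((nsq f + 1) / (2 * sqmod z)).
  have -> : 2 * ((nsq f + 1) / (2 * sqmod z)) * sqmod z = nsq f + 1.
    by field; rewrite zp.
  by rewrite gz mulr0; lra.
have gp : 0 < nsq g by rewrite lt0r gz.
(* The minimiser of the quadratic in s. *)
have := key (nsq g)^-1.
have -> : nsq f - 2 * (nsq g)^-1 * sqmod z + (nsq g)^-1 ^+ 2 * sqmod z * nsq g =
  (nsq f * nsq g - sqmod z) / nsq g by field; rewrite gz.
by rewrite pmulr_lge0 ?invr_gt0// subr_ge0.
Qed.

(* Minkowski's inequality squared, with a free parameter instead of square roots *)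
Lemma nsqD_le_eps f g (e : R) : L2 mu f -> L2 mu g -> 0 < e ->
  nsq (fun x => f x + g x) <= (1 + e) * nsq f + (1 + e^-1) * nsq g.
Proof.
move=> lf lg e0.
have lg' := L2Z (e^-1%:C) lg.
have := nsq_ge0 (fun x => f x - e^-1%:C * g x).
rewrite nsqB// nsqZ// innerZr// conjc_real ReM (_ : Im _%:C = 0)// mul0r subr0 sqmod_real /= => h.
(* The cross term is absorbed by e times the squared norm of f - g/e, which is nonnegative. *)
rewrite nsqD//; have : 0 <= e * (nsq f + e^-1 ^+ 2 * nsq g - 2 * (e^-1 * Re (inner mu f g))).
  by rewrite mulr_ge0// ltW.
have -> : e * (nsq f + e^-1 ^+ 2 * nsq g - 2 * (e^-1 * Re (inner mu f g))) =
  e * nsq f + e^-1 * nsq g - 2 * Re (inner mu f g) by field; rewrite gt_eqF.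
lra.
Qed.

End L2_theory.

(** * Parseval families *)

Section real_esum.
Context {R : realType} {I : choiceType}.
Implicit Types (a b : I -> R) (s : seq I).

Lemma esum_le_real a (M : R) :
  (forall s, uniq s -> \sum_(i <- s) a i <= M) ->
  (\esum_(i in [set: I]) (a i)%:E <= M%:E)%E.
Proof.
move=> h; apply: ge_ereal_sup => _ [X [finX _] <-].
by rewrite fsbig_finite//= sumEFin lee_fin; exact: h.
Qed.

Lemma sum_le_esum a s : uniq s ->
  ((\sum_(i <- s) a i)%:E <= \esum_(i in [set: I]) (a i)%:E)%E.
Proof.
move=> us; apply: ereal_sup_ubound; exists [set` s]; first by split.
rewrite fsbig_finite//= -sumEFin; apply: perm_big.
by apply: uniq_perm => // i; rewrite in_fset_set// mem_setE.
Qed.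

Lemma sum_le_esum_real a (M : R) s : uniq s ->
  \esum_(i in [set: I]) (a i)%:E = M%:E -> \sum_(i <- s) a i <= M.
Proof. by move=> us aM; rewrite -lee_fin -aM; exact: sum_le_esum. Qed.

Lemma le_sum_uniq a s t : (forall i, 0 <= a i) -> uniq s -> uniq t ->
  {subset s <= t} -> \sum_(i <- s) a i <= \sum_(i <- t) a i.
Proof.
move=> a0 us ut st; rewrite [leRHS](bigID (mem s))/=.
have -> : \sum_(i <- t | i \in s) a i = \sum_(i <- s) a i.
  rewrite -big_filter; apply: perm_big; apply: uniq_perm => //.
    exact: filter_uniq.
  by move=> i; rewrite mem_filter; case: (boolP (i \in s)) => //= /st ->.
by rewrite lerDl; exact: sumr_ge0.
Qed.

End real_esum.

(* Summation along an exhaustion of the index set by finite boxes, covering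
   both [zsum_is] and [zsum2_is]. *)
Section exhaustion_sums.
Context {R : realType} {I : choiceType} (box : nat -> seq I).
Implicit Types (a b : I -> R) (u v : I -> R[i]).

Definition exhausting := (forall N, uniq (box N)) /\
  forall s : seq I, exists N0, forall N, (N0 <= N)%N -> {subset s <= box N}.

Definition gsum_is u (L : R[i]) :=
  (\esum_(i in [set: I]) (cabs (u i))%:E < +oo)%E /\
  (fun N => Re (\sum_(i <- box N) u i)) @ \oo --> Re L /\
  (fun N => Im (\sum_(i <- box N) u i)) @ \oo --> Im L.

Hypothesis exh : exhausting.

(** A finite set whose sum exceeds M - e lies inside every late box, so by nonnegativity the box
    sums are squeezed between M - e and M. *)
Lemma esum_cvg_box a (M : R) : (forall i, 0 <= a i) ->
  \esum_(i in [set: I]) (a i)%:E = M%:E ->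
  (fun N => \sum_(i <- box N) a i) @ \oo --> M.
Proof.
move=> a0 aM; have [ub sb] := exh.
apply/cvgrPdist_lt => e e0.
have [s us sM] : exists2 s, uniq s & M - e < \sum_(i <- s) a i.
  apply: contrapT => h; suff : (M%:E <= (M - e)%:E)%E by rewrite lee_fin; lra.
  rewrite -aM; apply: esum_le_real => s us; rewrite leNgt; apply/negP => sM.
  by apply: h; exists s.
have [N0 hN] := sb s; exists N0 => // N /= /hN sN.
rewrite ger0_norm; last by rewrite subr_ge0; exact: sum_le_esum_real.
by rewrite ltrBlDl -ltrBlDr (lt_le_trans sM)//; exact: le_sum_uniq.
Qed.

(** Each finite sum is dominated by the late box sums, hence by their limit, so the unordered sum is
    finite; [esum_cvg_box] and uniqueness of limits then identify it. *)
Lemma cvg_box_esum a (M : R) : (forall i, 0 <= a i) ->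
  (fun N => \sum_(i <- box N) a i) @ \oo --> M ->
  \esum_(i in [set: I]) (a i)%:E = M%:E.
Proof.
move=> a0 aM; have [ub sb] := exh.
have fin : (\esum_(i in [set: I]) (a i)%:E <= M%:E)%E.
  apply: esum_le_real => s us; have [N0 hN] := sb s.
  rewrite -(cvg_lim _ aM)//; apply: limr_ge; first by apply/cvg_ex; exists M.
  by exists N0 => // N /= /hN sN; exact: le_sum_uniq.
have ge0 : (0 <= \esum_(i in [set: I]) (a i)%:E)%E.
  by apply: esum_ge0 => i _; rewrite lee_fin.
move: fin ge0 (@esum_cvg_box a); case: (\esum_(i in _) _)%E => // M' _ _.
move=> /(_ M' a0 erefl) h; congr EFin; rewrite -(cvg_lim _ aM)//.
by rewrite -(cvg_lim _ h).
Qed.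

Lemma cabs_real (r : R) : 0 <= r -> cabs r%:C = r.
Proof. by move=> r0; rewrite /cabs sqmod_real sqrtr_sqr ger0_norm. Qed.

Lemma Re_sum (J : Type) (s : seq J) (u : J -> R[i]) :
  Re (\sum_(i <- s) u i) = \sum_(i <- s) Re (u i).
Proof. by elim: s => [|x s ih]; rewrite ?big_nil// !big_cons ReD ih. Qed.

Lemma Im_sum (J : Type) (s : seq J) (u : J -> R[i]) :
  Im (\sum_(i <- s) u i) = \sum_(i <- s) Im (u i).
Proof. by elim: s => [|x s ih]; rewrite ?big_nil// !big_cons ImD ih. Qed.

Lemma gsum_ext u v (L M : R[i]) : gsum_is u L -> u =1 v -> L = M -> gsum_is v M.
Proof. by move=> h /funext <- <-. Qed.

Lemma gsum0 : gsum_is (fun=> 0) 0.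
Proof.
split; last by split => /=; under eq_fun do rewrite big1//; exact: cvg_cst.
by rewrite esum1// => i _; rewrite /cabs sqmod0 sqrtr0.
Qed.

Lemma gsum_esum u (M : R) : gsum_is (fun i => (sqmod (u i))%:C) M%:C ->
  \esum_(i in [set: I]) (sqmod (u i))%:E = M%:E.
Proof.
move=> [_ [h _]]; apply: cvg_box_esum; first by move=> i; exact: sqmod_ge0.
by move: h; under eq_fun do rewrite Re_sum.
Qed.

Lemma cabsD (z w : R[i]) : cabs (z + w) <= cabs z + cabs w.
Proof.
have cabsE (x : R[i]) : cabs x = Normc.normc x by case: x => [p q].
by rewrite !cabsE; exact: le_normcD.
Qed.

Lemma cabsM (z w : R[i]) : cabs (z * w) = cabs z * cabs w.
Proof. by rewrite /cabs sqmodM sqrtrM// sqmod_ge0. Qed.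

Lemma cabs_ge0 (z : R[i]) : 0 <= cabs z. Proof. exact: sqrtr_ge0. Qed.

Lemma gsum_lin (c : R[i]) u v (L M : R[i]) : gsum_is u L -> gsum_is v M ->
  gsum_is (fun i => c * u i + v i) (c * L + M).
Proof.
move=> [uf [uR uI]] [vf [vR vI]]; split.
  have ge0 (w : I -> R[i]) : (0 <= \esum_(i in [set: I]) (cabs (w i))%:E)%E.
    by apply: esum_ge0 => i _; rewrite lee_fin cabs_ge0.
  have [x ux] : exists x : R, \esum_(i in [set: I]) (cabs (u i))%:E = x%:E.
    by move: uf (ge0 u); case: (\esum_(i in _) _)%E => // x _ _; exists x.
  have [y vy] : exists y : R, \esum_(i in [set: I]) (cabs (v i))%:E = y%:E.
    by move: vf (ge0 v); case: (\esum_(i in _) _)%E => // y _ _; exists y.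
  apply: (@le_lt_trans _ _ (cabs c * x + y)%:E); last by rewrite ltry.
  apply: esum_le_real => s us.
  apply: (@le_trans _ _ (\sum_(i <- s) (cabs c * cabs (u i) + cabs (v i)))).
    by apply: ler_sum => i _; rewrite -cabsM; exact: cabsD.
  rewrite big_split -mulr_sumr lerD//=; last exact: sum_le_esum_real.
  by rewrite ler_wpM2l ?cabs_ge0//; exact: sum_le_esum_real.
split.
  rewrite ReD ReM.
  under eq_fun do rewrite big_split/= -mulr_sumr ReD ReM.
  by apply: cvgD vR; apply: cvgB; exact: cvgMr.
rewrite ImD ImM.
under eq_fun do rewrite big_split/= -mulr_sumr ImD ImM.
by apply: cvgD vI; apply: cvgD; exact: cvgMr.
Qed.

Lemma polarization (z w : R[i]) : z * conjc w =
  4^-1%:C * ((sqmod (z + w))%:C - (sqmod (z - w))%:C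
    + 'i * ((sqmod (z + 'i * w))%:C - (sqmod (z - 'i * w))%:C)).
Proof.
by move: z w => [a b] [c d]; apply: complex_ext; rewrite /sqmod !ReImE /=; field.
Qed.

(** The polarization formula over the fourth roots of unity, meant for N c = |f + c g|^2. The
    nesting and the final 0 reproduce the shape c * u + v, so that four uses of [gsum_lin] ending in
    [gsum0] sum it term by term. *)
Definition polar (N : R[i] -> R) : R[i] :=
  4^-1%:C * (N 1)%:C + (- 4^-1%:C * (N (-1))%:C +
  (4^-1%:C * 'i * (N 'i)%:C + (- 4^-1%:C * 'i * (N (- 'i))%:C + 0))).

Lemma polar_scale (c : R) (N : R[i] -> R) :
  polar (fun w => c * N w) = c%:C * polar N.
Proof.
rewrite /polar !rmorphM/= !mulrDr mulr0.
by rewrite ![c%:C * (_ * _)]mulrCA.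
Qed.

Lemma gsum_real a (M : R) : (forall i, 0 <= a i) ->
  \esum_(i in [set: I]) (a i)%:E = M%:E -> gsum_is (fun i => (a i)%:C) M%:C.
Proof.
move=> a0 aM; split.
  by under eq_esum do rewrite cabs_real//; rewrite aM ltry.
split.
  by under eq_fun do rewrite Re_sum/=; exact: esum_cvg_box.
under eq_fun do rewrite Im_sum/= big1//; exact: cvg_cst.
Qed.

End exhaustion_sums.

(** * Parseval's identity for a family in L^2: polarization and passage to the closure *)

Section parseval_families.
Context d (T : measurableType d) (R : realType) (mu : {measure set T -> \bar R}).
Context {I : choiceType} (e : I -> T -> R[i]).
Hypothesis le2 : forall i, L2 mu (e i).

Definition parseval f :=
  \esum_(i in [set: I]) (sqmod (inner mu f (e i)))%:E = (nsq mu f)%:E.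

Lemma inner_polarization f g : L2 mu f -> L2 mu g ->
  inner mu f g = polar (fun c => nsq mu (fun x => f x + c * g x)).
Proof.
move=> lf lg; have -> : (fun c => nsq mu (fun x => f x + c * g x)) =
    (fun c => nsq mu f + sqmod c * nsq mu g + 2 * Re (conjc c * inner mu f g)).
  apply/funext => c; have lcg := L2Z c lg.
  by rewrite (nsqD lf lcg) (nsqZ c lg) (innerZr c lg lf).
move: (nsq mu f) (nsq mu g) (inner mu f g) => A B [p q].
by apply: complex_ext; rewrite /polar /sqmod !ReImE /=; field.
Qed.

(** Polarizing every term turns the sesquilinear sum into four sums of squares. Parseval is required
    at four combinations of f and g only, because in the fibres each use of it costs a null set. *)
Lemma parseval_gsum (box : nat -> seq I) f g : exhausting box ->
  (forall c, c \in [:: 1; -1; 'i; - 'i] -> parseval (fun x => f x + c * g x)) ->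
  L2 mu f -> L2 mu g ->
  gsum_is box (fun i => inner mu f (e i) * inner mu (e i) g) (inner mu f g).
Proof.
move=> exh pe lf lg.
have sums c : c \in [:: 1; -1; 'i; - 'i] -> gsum_is box (fun i => (sqmod (inner mu f (e i) + c * inner mu g (e i)))%:C)
    (nsq mu (fun x => f x + c * g x))%:C.
  move=> c4; apply: gsum_real => //; first by move=> i; exact: sqmod_ge0.
  have lcg := L2Z c lg; rewrite -pe//.
  by apply: eq_esum => i _; rewrite innerDl// innerZl.
have z0 := @gsum0 R I box.
have -> : (fun i => inner mu f (e i) * inner mu (e i) g) = (fun i =>
   4^-1%:C * (sqmod (inner mu f (e i) + 1 * inner mu g (e i)))%:C +
   (- 4^-1%:C * (sqmod (inner mu f (e i) + (-1) * inner mu g (e i)))%:C +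
   (4^-1%:C * 'i * (sqmod (inner mu f (e i) + 'i * inner mu g (e i)))%:C +
   (- 4^-1%:C * 'i * (sqmod (inner mu f (e i) + (- 'i) * inner mu g (e i)))%:C
    + 0)))).
  apply/funext => i; rewrite [inner mu (e i) g]innerC// polarization.
  by rewrite !mulNr !mul1r; ring.
rewrite (inner_polarization lf lg) /polar.
have [s1 s2 s3 s4] : [/\ 1 \in [:: 1; -1; 'i; - 'i : R[i]], -1 \in [:: 1; -1; 'i; - 'i : R[i]],
    'i \in [:: 1; -1; 'i; - 'i : R[i]] & - 'i \in [:: 1; -1; 'i; - 'i : R[i]]].
  by rewrite !inE !eqxx !orbT.
exact: (gsum_lin _ (sums 1 s1) (gsum_lin _ (sums (-1) s2)
  (gsum_lin _ (sums 'i s3) (gsum_lin _ (sums (- 'i) s4) z0)))).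
Qed.

Lemma sqmodD_le_eps (z w : R[i]) (t : R) : 0 < t ->
  sqmod (z + w) <= (1 + t) * sqmod z + (1 + t^-1) * sqmod w.
Proof.
move=> t0; have h : 0 <= t * sqmod (z - t^-1%:C * w).
  by rewrite mulr_ge0 ?sqmod_ge0// ltW.
rewrite -subr_ge0; apply: le_trans h _; rewrite le_eqVlt; apply/orP; left; apply/eqP.
by rewrite /sqmod !ReImE /=; field; rewrite gt_eqF.
Qed.

(** The bound has the form left by splitting a square twice, each time at the cost of a factor 1 +
    t, plus an error t. *)
Lemma le_of_le_eps (x y : R) : 0 <= y ->
  (forall t, 0 < t -> x <= (1 + t) * ((1 + t) * y) + t) -> x <= y.
Proof.
(* For t at most 1 the right-hand side is at most y + t (3 y + 1); hence the constant k, and a t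
   with t k < x - y. *)
move=> y0 h; rewrite leNgt; apply/negP => xy.
pose k := 3 * y + 1.
have k0 : 0 < k by rewrite /k; lra.
have xk : 0 < (x - y) / k by rewrite divr_gt0//; lra.
pose t := Num.min 1 ((x - y) / k / 2).
have t0 : 0 < t by rewrite /t lt_min ltr01/= divr_gt0.
have t1 : t <= 1 by rewrite /t ge_min lexx.
have tk : t * k < x - y.
  rewrite -ltr_pdivlMr// (@le_lt_trans _ _ ((x - y) / k / 2))//; first by rewrite ge_min lexx orbT.
  by rewrite ltr_pdivrMr//; lra.
have := h t t0; have : t * t * y <= t * y.
  by rewrite -mulrA ler_piMl// mulr_ge0// ltW.
rewrite /k in tk; lra.
Qed.

(* [V] dense in [X] and Parseval on [V] gives first Bessel, then Parseval on [X]. *)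
Lemma parseval_dense (X V : (T -> R[i]) -> Prop) :
  (forall f, X f -> L2 mu f) -> (forall v, V v -> X v) ->
  (forall f g, X f -> X g -> X (fun x => f x - g x)) ->
  (forall v, V v -> parseval v) ->
  (forall f t, X f -> 0 < t -> exists2 v, V v & nsq mu (fun x => f x - v x) < t) ->
  forall f, X f -> parseval f.
Proof.
move=> XL VX XB pV dense.
have split_sum f v (s : seq I) (t : R) : X f -> X v -> 0 < t ->
    \sum_(i <- s) sqmod (inner mu f (e i)) <=
    (1 + t) * \sum_(i <- s) sqmod (inner mu v (e i)) +
    (1 + t^-1) * \sum_(i <- s) sqmod (inner mu (fun x => f x - v x) (e i)).
  move=> Xf Xv t0; rewrite !mulr_sumr -big_split/=; apply: ler_sum => i _.
  have -> : inner mu f (e i) = inner mu v (e i) + inner mu (fun x => f x - v x) (e i).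
    by rewrite innerBl; [ring|exact: XL|exact: XL|].
  exact: sqmodD_le_eps.
have split_nsq f v (t : R) : X f -> X v -> 0 < t ->
    nsq mu f <= (1 + t) * nsq mu v + (1 + t^-1) * nsq mu (fun x => f x - v x).
  move=> Xf Xv t0; have /XL Xfv := XB _ _ Xf Xv.
  apply: le_trans (nsqD_le_eps (XL _ Xv) Xfv t0).
  rewrite le_eqVlt; apply/orP; left; apply/eqP; congr nsq.
  by apply/funext => x; rewrite addrC subrK.
have bessel f s : X f -> uniq s -> \sum_(i <- s) sqmod (inner mu f (e i)) <= nsq mu f.
  move=> Xf us; apply: le_of_le_eps; first exact: nsq_ge0.
  (* With s fixed, Cauchy-Schwarz bounds the coefficients of f - v by K times its squared norm. The
     approximant v is chosen after s, so the dependence of K on s is harmless; c gathers all factors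
     of |f - v|^2 in the final estimate. *)
  move=> t t0; pose K := \sum_(i <- s) nsq mu (e i).
  have K0 : 0 <= K by apply: sumr_ge0 => i _; exact: nsq_ge0.
  have it0 : 0 < t^-1 by rewrite invr_gt0.
  pose c := (1 + t^-1) * ((1 + t) + K).
  have c0 : 0 < c by rewrite /c mulr_gt0//; lra.
  have [v Vv fv] := dense f (t / c) Xf (divr_gt0 t0 c0).
  have Xv := VX _ Vv; have Xfv := XB _ _ Xf Xv.
  apply: le_trans (split_sum f v s t Xf Xv t0) _.
  have h1 : \sum_(i <- s) sqmod (inner mu v (e i)) <= nsq mu v.
    exact: sum_le_esum_real (pV _ Vv).
  have h2 : \sum_(i <- s) sqmod (inner mu (fun x => f x - v x) (e i)) <=
      nsq mu (fun x => f x - v x) * K.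
    by rewrite mulr_sumr; apply: ler_sum => i _; apply: cauchy_schwarz => //; exact: XL.
  have h3 := split_nsq v f t Xv Xf t0; rewrite nsqBC in h3.
  set w := nsq mu (fun x => f x - v x) in h2 h3 fv *.
  have h4 : w * c < t by rewrite -ltr_pdivlMr.
  have h5 : (1 + t) * \sum_(i <- s) sqmod (inner mu v (e i)) <=
      (1 + t) * ((1 + t) * nsq mu f + (1 + t^-1) * w).
    by rewrite ler_pM2l; [exact: le_trans h1 h3|lra].
  have h6 : (1 + t^-1) * \sum_(i <- s) sqmod (inner mu (fun x => f x - v x) (e i)) <=
    (1 + t^-1) * (w * K) by rewrite ler_pM2l//; lra.
  apply: le_trans (lerD h5 h6) _.
  have -> : (1 + t) * ((1 + t) * nsq mu f + (1 + t^-1) * w) + (1 + t^-1) * (w * K) =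
    (1 + t) * ((1 + t) * nsq mu f) + w * c by rewrite /c; ring.
  by rewrite lerD2l ltW.
move=> f Xf; rewrite /parseval.
have le1 : (\esum_(i in [set: I]) (sqmod (inner mu f (e i)))%:E <= (nsq mu f)%:E)%E.
  by apply: esum_le_real => s us; exact: bessel.
have ge0 : (0 <= \esum_(i in [set: I]) (sqmod (inner mu f (e i)))%:E)%E.
  by apply: esum_ge0 => i _; rewrite lee_fin sqmod_ge0.
have [n nE] : exists n : R, \esum_(i in [set: I]) (sqmod (inner mu f (e i)))%:E = n%:E.
  by move: le1 ge0; case: (\esum_(i in _) _)%E => // n _ _; exists n.
apply/eqP; rewrite eq_le le1/= nE lee_fin.
have n0 : 0 <= n by rewrite -lee_fin -nE.
apply: le_of_le_eps => // t t0.
have it0 : 0 < t^-1 by rewrite invr_gt0.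
(* Bessel's inequality now bounds the coefficients of v - f with constant 1 for every finite set, so
   1 takes the place of K. *)
pose c := (1 + t^-1) * ((1 + t) + 1).
have c0 : 0 < c by rewrite /c mulr_gt0//; lra.
have [v Vv fv] := dense f (t / c) Xf (divr_gt0 t0 c0).
have Xv := VX _ Vv; have Xvf := XB _ _ Xv Xf.
apply: le_trans (split_nsq f v t Xf Xv t0) _.
set w := nsq mu (fun x => f x - v x) in fv *.
have h : nsq mu v <= (1 + t) * n + (1 + t^-1) * w.
  rewrite -lee_fin -(pV _ Vv); apply: esum_le_real => s us.
  apply: le_trans (split_sum v f s t Xv Xf t0) _.
  apply: lerD; (rewrite ler_pM2l; last lra).
    exact: sum_le_esum_real nE.
  by rewrite /w nsqBC; exact: bessel.
have h5 : (1 + t) * nsq mu v <= (1 + t) * ((1 + t) * n + (1 + t^-1) * w).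
  by rewrite ler_pM2l//; lra.
apply: le_trans (lerD h5 (lexx _)) _.
have -> : (1 + t) * ((1 + t) * n + (1 + t^-1) * w) + (1 + t^-1) * w =
    (1 + t) * ((1 + t) * n) + w * c by rewrite /c; ring.
by rewrite lerD2l ltW// -ltr_pdivlMr.
Qed.

End parseval_families.

(** * Closed subspaces and density *)

Section closed_subspaces.
Import HBNNSimple.
Context d (T : measurableType d) (R : realType) (mu : {measure set T -> \bar R}).
Implicit Types (f g : T -> R[i]).

Lemma nsq_dominated (f_ : nat -> T -> R[i]) (h : T -> R) :
  (forall n, cmeasurable (f_ n)) -> mu.-integrable setT (EFin \o h) ->
  {ae mu, forall x, (fun n => sqmod (f_ n x)) @ \oo --> (0 : R)} ->
  (forall n x, sqmod (f_ n x) <= h x) ->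
  (fun n => nsq mu (f_ n)) @ \oo --> (0 : R).
Proof.
move=> mf ih f0 fh.
have ae0 : {ae mu, forall x, setT x -> (fun n => (sqmod (f_ n x))%:E) @ \oo --> (0 : R)%:E}.
  apply: filterS f0 => x h0 _.
  by apply/fine_cvgP; split; [exact: nearW|exact: h0].
have aeh : {ae mu, forall x n, setT x -> (`|(sqmod (f_ n x))%:E| <= (EFin \o h) x)%E}.
  by apply: aeW => x n _ /=; rewrite lee_fin ger0_norm ?sqmod_ge0.
have [_ _] := dominated_convergence measurableT
  (fun n => emeasurable_sqmod (mf n)) (measurable_cst _) ae0 ih aeh.
by rewrite integral0 => /fine_cvgP[].
Qed.

Lemma cvg0_small (u : nat -> R) (t : R) : u @ \oo --> (0 : R) -> 0 < t ->
  exists n, u n < t.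
Proof.
move=> u0 t0; have /cvgrPdist_lt/(_ t t0)[n _ /(_ n (leqnn n))] := u0.
by rewrite sub0r normrN => h; exists n; exact: le_lt_trans (ler_norm _) h.
Qed.

(** A predicate on functions rather than on classes: closedness under approximation in norm also
    makes it invariant under changes on null sets. *)
Record closed_subspace (C : (T -> R[i]) -> Prop) : Prop := ClosedSubspace {
  cs_L2 : forall f, C f -> L2 mu f ;
  cs_0 : C (fun=> 0) ;
  cs_lin : forall c f g, C f -> C g -> C (fun x => c * f x + g x) ;
  cs_closed : forall f, L2 mu f ->
    (forall t, 0 < t -> exists2 g, C g & nsq mu (fun x => f x - g x) < t) -> C f }.

Definition closure_L2 (V : (T -> R[i]) -> Prop) f := L2 mu f /\
  forall t, 0 < t -> exists2 v, V v & nsq mu (fun x => f x - v x) < t.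

Lemma closure_L2_sub (V : (T -> R[i]) -> Prop) v : L2 mu v -> V v -> closure_L2 V v.
Proof.
move=> lv Vv; split => // t t0; exists v => //.
rewrite /nsq /Rintegral integral0_eq// => x _.
by rewrite subrr sqmod0.
Qed.

Lemma closure_L2_closed (V : (T -> R[i]) -> Prop) :
  (forall v, V v -> L2 mu v) -> V (fun=> 0) ->
  (forall c v w, V v -> V w -> V (fun x => c * v x + w x)) ->
  closed_subspace (closure_L2 V).
Proof.
move=> VL V0 Vlin; split.
- by move=> f [].
- by apply: closure_L2_sub => //; exact: L2_0.
- move=> c f g [lf hf] [lg hg]; split; first by apply: L2D => //; exact: L2Z.
  (* The squared norm of a sum is at most twice the sum of the squared norms, so each summand may
     use t/4; the added 1 covers c = 0. *)
  move=> t t0; have c0 : 0 < 4 * (sqmod c + 1) by have := sqmod_ge0 c; lra.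
  have [v Vv fv] := hf (t / (4 * (sqmod c + 1))) (divr_gt0 t0 c0).
  have t4 : 0 < t / 4 by rewrite divr_gt0.
  have [w Vw gw] := hg (t / 4) t4.
  exists (fun x => c * v x + w x); first exact: Vlin.
  have lv := VL _ Vv; have lw := VL _ Vw.
  have -> : (fun x => c * f x + g x - (c * v x + w x)) =
    (fun x => c * (f x - v x) + (g x - w x)) by apply/funext => x; ring.
  apply: le_lt_trans (nsqD_le (L2Z c (L2B lf lv)) (L2B lg lw)) _.
  rewrite nsqZ; last exact: L2B.
  have n0 := nsq_ge0 mu (fun x => f x - v x).
  rewrite ltr_pdivlMr// in fv.
  set p := nsq mu (fun x => f x - v x) in n0 fv *.
  set q := nsq mu (fun x => g x - w x) in gw *.
  by have := sqmod_ge0 c; lra.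
- move=> f lf hf; split => // t t0.
  have t4 : 0 < t / 4 by rewrite divr_gt0.
  have [g [lg hg] fg] := hf (t / 4) t4.
  have [v Vv gv] := hg (t / 4) t4.
  exists v => //; have lv := VL _ Vv.
  have -> : (fun x => f x - v x) = (fun x => (f x - g x) + (g x - v x)).
    by apply/funext => x; ring.
  apply: le_lt_trans (nsqD_le (L2B lf lg) (L2B lg lv)) _; lra.
Qed.

Section density.
Context (C : (T -> R[i]) -> Prop) (csC : closed_subspace C).

Lemma cs_add f g : C f -> C g -> C (fun x => f x + g x).
Proof.
move=> Cf Cg; have := cs_lin csC 1 Cf Cg.
by under eq_fun do rewrite mul1r.
Qed.

Lemma cs_scale c f : C f -> C (fun x => c * f x).
Proof.
move=> Cf; have := cs_lin csC c Cf (cs_0 csC).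
by under eq_fun do rewrite addr0.
Qed.

Lemma cs_sub f g : C f -> C g -> C (fun x => f x - g x).
Proof.
move=> Cf Cg; have := cs_lin csC (-1) Cg Cf.
by under eq_fun do rewrite mulN1r addrC.
Qed.

Lemma cs_sum (J : Type) (s : seq J) (F : J -> T -> R[i]) : (forall j, C (F j)) ->
  C (fun x => \sum_(j <- s) F j x).
Proof.
move=> CF; elim: s => [|j s ih].
  by under eq_fun do rewrite big_nil; exact: cs_0.
by under eq_fun do rewrite big_cons; exact: cs_add.
Qed.

Lemma cs_dominated (f_ : nat -> T -> R[i]) f (h : T -> R) : L2 mu f ->
  (forall n, C (f_ n)) -> mu.-integrable setT (EFin \o h) ->
  {ae mu, forall x, (fun n => sqmod (f x - f_ n x)) @ \oo --> (0 : R)} ->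
  (forall n x, sqmod (f x - f_ n x) <= h x) -> C f.
Proof.
move=> lf Cf ih f0 fh; apply: (cs_closed csC) => // t t0.
have mf n : cmeasurable (fun x => f x - f_ n x).
  by apply: cmeasurableB; [case: lf|case: (cs_L2 csC (Cf n))].
by have /cvg0_small/(_ t0)[n hn] := nsq_dominated mf ih f0 fh; exists (f_ n).
Qed.

Context (G : set (set T)) (D : set T).
Hypotheses (mD : measurable D) (Dfin : (mu D < +oo)%E).

Lemma L2_indicator A : measurable A -> (mu A < +oo)%E -> L2 mu (fun x => (\1_A x)%:C).
Proof.
move=> mA Afin; split; first exact/cmeasurable_real/measurable_indic.
rewrite (eq_integral (fun x => (\1_A x)%:E)); first by rewrite integral_indic// setIT.
by move=> x _; rewrite sqmod_real indicE; case: (_ \in _); rewrite ?expr1n ?expr0n.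
Qed.

Lemma integrable_indicator A : measurable A -> (mu A < +oo)%E ->
  mu.-integrable setT (EFin \o (\1_A : T -> R)).
Proof.
move=> mA Afin; apply/integrableP; split.
  exact/measurable_EFinP/measurable_indic.
rewrite (eq_integral (fun x => (\1_A x)%:E)); first by rewrite integral_indic// setIT.
by move=> x _; rewrite /= ger0_norm// indicE.
Qed.

(** The sets A whose trace on D has its indicator in C form a Dynkin system: complements come from
    subtracting from the indicator of D, disjoint unions from dominated convergence, the indicator
    of D being an integrable majorant since D has finite measure. *)
Lemma cs_indicator : @measurable d T = <<s G >> -> setI_closed G ->
  C (fun x => (\1_D x)%:C) ->
  (forall A, G A -> C (fun x => (\1_(A `&` D) x)%:C)) ->
  forall A, measurable A -> C (fun x => (\1_(A `&` D) x)%:C).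
Proof.
move=> GE GI CD CG A mA; rewrite GE in mA; move: A mA.
apply: (dynkin_induction GE GI).
- by rewrite setTI.
- exact: CG.
- move=> S mS CS; have := cs_sub CD CS; congr C; apply/funext => x.
  rewrite -raddfB/= !indicE !in_setI in_setC.
  by case: (x \in S); case: (x \in D); rewrite /= ?subrr ?subr0.
- move=> F mF tF CF.
  have CU n : C (fun x => (\1_((\big[setU/set0]_(k < n) F k) `&` D) x)%:C).
    elim: n => [|n ih].
      rewrite big_ord0 set0I; have := cs_0 csC; congr C; apply/funext => x.
      by rewrite indicE in_set0.
    have := cs_add ih (CF n); congr C; apply/funext => x.
    rewrite big_ord_recr/= -raddfD/= !indicE !in_setI in_setU.
    have [xF|xF] := boolP (x \in F n); last by rewrite andFb addr0 orbF.
    rewrite (_ : (x \in \big[setU/set0]_(k < n) F k) = false)/= ?add0r//.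
    apply/negP => /set_mem xU.
    have := @trivIset_bigsetUI _ xpredT F _ n n isT (leqnn n).
    rewrite [X in trivIset X F](_ : _ = setT); last exact/seteqP.
    move=> /(_ tF).
    by move/seteqP => [/(_ x) + _]; apply; split => //; exact: set_mem.
  have mU : measurable (\bigcup_k F k `&` D).
    by apply: measurableI => //; exact: bigcupT_measurable.
  apply: (cs_dominated _ CU (integrable_indicator mD Dfin)).
  + apply: L2_indicator => //; apply: le_lt_trans Dfin.
    by apply: le_measure; [exact: mem_set|exact: mem_set|move=> x []].
  + apply: aeW => x; have [[k _ Fx]|nF] := pselect ((\bigcup_k F k) x).
      apply: cvg_near_cst; exists k.+1 => // n /= kn.
      have h1 : x \in \bigcup_k F k by apply: mem_set; exists k.
      have h2 : x \in \big[setU/set0]_(k < n) F k.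
        by apply: mem_set; rewrite -bigcup_mkord; exists k.
      by rewrite -raddfB/= !indicE !in_setI h1 h2 subrr sqmod0.
    rewrite (_ : (fun n => _) = (fun=> 0)); first exact: cvg_cst.
    apply/funext => n.
    have h1 : (x \in \bigcup_k F k) = false by exact: memNset.
    have h2 : (x \in \big[setU/set0]_(k < n) F k) = false.
      by apply: memNset; rewrite -bigcup_mkord => -[i _ Fi]; apply: nF; exists i.
    by rewrite -raddfB/= !indicE !in_setI h1 h2 subrr sqmod0.
  + move=> n x; rewrite -raddfB/= sqmod_real !indicE !in_setI.
    by case: (x \in D); case: (x \in _); case: (x \in _);
      rewrite /= ?subrr ?subr0 ?sub0r ?sqrrN ?expr1n ?expr0n.
Qed.

(** The approximating simple functions are finite combinations of indicators and increase to g, so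
    the squared errors are dominated by g^2. *)
Lemma cs_restrict_ge0 (g : T -> R) :
  (forall A, measurable A -> C (fun x => (\1_(A `&` D) x)%:C)) ->
  L2 mu (fun x => (g x)%:C) -> (forall x, 0 <= g x) ->
  C (fun x => (\1_D x)%:C * (g x)%:C).
Proof.
move=> CA lg g0; have mg : measurable_fun setT (EFin \o g).
  by apply/measurable_EFinP; case: lg => -[].
pose g_ n : T -> R := nnsfun_approx measurableT mg n.
apply: (cs_dominated (f_ := fun n x => (\1_D x)%:C * (g_ n x)%:C)
    (h := fun x => sqmod (g x)%:C)).
- exact: L2_indic.
- move=> n.
  have -> : (fun x => (\1_D x)%:C * (g_ n x)%:C) = (fun x =>
     \sum_(y <- fset_set (range (g_ n)))
       y%:C * (\1_((g_ n @^-1` [set y]) `&` D) x)%:C).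
    apply/funext => x; apply: complex_ext; rewrite ?Re_sum ?Im_sum ?ReImE /=; last first.
      by rewrite !(mul0r, mulr0) addr0 big1// => y _; rewrite /= mul0r mulr0 addr0.
    rewrite mul0r subr0 /g_ (fimfunE (nnsfun_approx measurableT mg n)) fsbig_finite//= mulr_sumr; apply: eq_bigr => y _.
    by rewrite subr0 indicI /=; ring.
  apply: cs_sum => y; apply: cs_scale; apply: CA.
  exact: measurable_sfunP.
- exact: L2_integrable.
- apply: aeW => x.
  have gx : (fun n => g_ n x) @ \oo --> g x.
    have := @cvg_nnsfun_approx _ _ _ _ measurableT _ mg (fun x _ => g0 x) x I.
    by move=> /fine_cvgP[].
  have -> : (fun n => sqmod ((\1_D x)%:C * (g x)%:C - (\1_D x)%:C * (g_ n x)%:C)) =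
     (fun n => (\1_D x * (g x - g_ n x)) ^+ 2).
    by apply/funext => n; rewrite -mulrBr -rmorphB/= -rmorphM/= sqmod_real.
  have : (fun n => (\1_D x * (g x - g_ n x)) ^+ 2) @ \oo --> ((\1_D x : R) * (g x - g x)) ^+ 2.
    rewrite expr2; under eq_fun do rewrite expr2.
    have h : (fun n => \1_D x * (g x - g_ n x)) @ \oo --> (\1_D x : R) * (g x - g x).
      by apply: cvgMr; apply: cvgB => //; exact: cvg_cst.
    exact: cvgM.
  by rewrite subrr mulr0 expr0n.
- move=> n x; rewrite -mulrBr -rmorphB/= -rmorphM/= !sqmod_real.
  have gx : 0 <= g_ n x by [].
  have gg : g_ n x <= g x.
    rewrite /g_ nnsfun_approxE -lee_fin.
    by apply: (@le_approx _ _ _ setT (EFin \o g)) => // y _; rewrite lee_fin.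
  rewrite indicE; case: (x \in D) => /=; rewrite ?mul1r ?mul0r.
    rewrite ler_sqr ?nnegrE ?subr_ge0//; lra.
  by rewrite expr0n sqr_ge0.
Qed.

(** Positive and negative parts of the real and imaginary parts reduce this to the nonnegative
    case. *)
Lemma cs_restrict f :
  (forall A, measurable A -> C (fun x => (\1_(A `&` D) x)%:C)) ->
  L2 mu f -> C (fun x => (\1_D x)%:C * f x).
Proof.
move=> CA lf.
have part (g : T -> R) : measurable_fun setT g -> (forall x, g x ^+ 2 <= sqmod (f x)) ->
    C (fun x => (\1_D x)%:C * (g x)%:C).
  move=> mg gf.
  have L (h : T -> R) : measurable_fun setT h -> (forall x, h x ^+ 2 <= g x ^+ 2) ->
      L2 mu (fun x => (h x)%:C).
    move=> mh hg; apply: (L2_le (c := 1) lf); first exact: cmeasurable_real.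
    by move=> x; rewrite sqmod_real mul1r (le_trans (hg x)).
  have Cp : C (fun x => (\1_D x)%:C * (Num.max (g x) 0)%:C).
    apply: (cs_restrict_ge0 CA).
      apply: L => [|x]; first exact: measurable_maxr.
      by rewrite /Num.max; case: ifP => _; rewrite ?lexx ?expr0n/= ?sqr_ge0.
    by move=> x; rewrite le_max lexx orbT.
  have Cn : C (fun x => (\1_D x)%:C * (Num.max (- g x) 0)%:C).
    apply: (cs_restrict_ge0 CA).
      apply: L => [|x]; first by apply: measurable_maxr => //; exact: measurableT_comp.
      by rewrite /Num.max; case: ifP => _; rewrite ?sqrrN ?lexx ?expr0n /= ?sqr_ge0.
    by move=> x; rewrite le_max lexx orbT.
  have := cs_sub Cp Cn; congr C; apply/funext => x.
  rewrite -mulrBr -rmorphB/=; congr (_ * _%:C).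
  by rewrite /Num.max; case: ifP => ?; case: ifP => ?; lra.
have [mR mI] := L2_meas lf.
have CR : C (fun x => (\1_D x)%:C * (Re (f x))%:C).
  by apply: part => // x; rewrite lerDl sqr_ge0.
have CI : C (fun x => (\1_D x)%:C * (Im (f x))%:C).
  by apply: part => // x; rewrite lerDr sqr_ge0.
have := cs_add CR (cs_scale 'i CI); congr C; apply/funext => x.
by apply: complex_ext; rewrite !ReImE /=; ring.
Qed.

End density.
End closed_subspaces.

(** * Completeness of the trigonometric system *)

Section fourier_series.
Context {R : realType}.
Implicit Types (x : R) (k m n : int) (c : R[i]) (p q : R -> R[i]).

Definition unit_itv : set (measurableTypeR R) := `[- (1/2), 1/2].

Definition Efun m x : R[i] := expi (2 * pi * m%:~R * x).

(** The span is an inductive predicate, so that a linear statement is proved by induction with the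
    exponentials as the essential case. *)
Inductive trig : (R -> R[i]) -> Prop :=
| trig_0 : trig (fun=> 0)
| trig_exp m : trig (Efun m)
| trig_lin c p q : trig p -> trig q -> trig (fun x => c * p x + q x).

Lemma sin_pi_int k : sin (pi * k%:~R) = 0 :> R.
Proof.
have nat_case (n : nat) : sin (pi * n%:R) = 0 :> R.
  elim: n => [|n ih]; first by rewrite mulr0 sin0.
  by rewrite -natr1 mulrDr mulr1 sinDpi ih oppr0.
case: k => n; first exact: nat_case.
by rewrite NegzE mulrNz mulrN sinN nat_case oppr0.
Qed.

Lemma EfunD m n x : Efun (m + n) x = Efun m x * Efun n x.
Proof. by rewrite /Efun -expiD intrD; congr expi; ring. Qed.

Lemma Efun0 x : Efun 0 x = 1.
Proof. by rewrite /Efun mulr0 mul0r expi0. Qed.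

Lemma EfunN m x : Efun (- m) x = conjc (Efun m x).
Proof. by rewrite /Efun -expiN mulrNz; congr expi; ring. Qed.

Lemma trig_scale c p : trig p -> trig (fun x => c * p x).
Proof. by move=> tp; have := trig_lin c tp trig_0; under eq_fun do rewrite addr0. Qed.

Lemma trig_add p q : trig p -> trig q -> trig (fun x => p x + q x).
Proof. by move=> tp tq; have := trig_lin 1 tp tq; under eq_fun do rewrite mul1r. Qed.

Lemma trig_cst c : trig (fun=> c).
Proof.
have := trig_scale c (trig_exp 0).
by under eq_fun do rewrite Efun0 mulr1.
Qed.

Lemma trig_mul p q : trig p -> trig q -> trig (fun x => p x * q x).
Proof.
move=> tp; elim: q / => [|m|c q r _ ih1 _ ih2].
- by under eq_fun do rewrite mulr0; exact: trig_0.
- elim: p / tp => [|n|c p r _ ih1 _ ih2].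
  + by under eq_fun do rewrite mul0r; exact: trig_0.
  + by under eq_fun do rewrite -EfunD; exact: trig_exp.
  + have := trig_lin c ih1 ih2; congr trig; apply/funext => x; ring.
- have := trig_lin c ih1 ih2; congr trig; apply/funext => x; ring.
Qed.

Lemma trig_pow p (n : nat) : trig p -> trig (fun x => p x ^+ n).
Proof.
move=> tp; elim: n => [|n ih]; first exact: trig_cst.
by under eq_fun do rewrite exprS; exact: trig_mul.
Qed.

Lemma continuous_expi_lin (c : R) : continuous (fun x => cos (c * x)) /\
  continuous (fun x => sin (c * x)).
Proof.
split => x; apply: continuous_comp.
- exact: mulrl_continuous.
- exact: continuous_cos.
- exact: mulrl_continuous.
- exact: continuous_sin.
Qed.

Lemma measurable_cos_lin (c : R) : measurable_fun setT (fun x : measurableTypeR R => cos (c * x)).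
Proof. exact: continuous_measurable_fun (continuous_expi_lin c).1. Qed.

Lemma measurable_sin_lin (c : R) : measurable_fun setT (fun x : measurableTypeR R => sin (c * x)).
Proof. exact: continuous_measurable_fun (continuous_expi_lin c).2. Qed.

Lemma cmeasurable_expi_lin (c : R) : cmeasurable (fun x : measurableTypeR R => expi (c * x)).
Proof. by split; [exact: measurable_cos_lin|exact: measurable_sin_lin]. Qed.

Lemma Rintegral_FTC (f F : R -> R) : continuous f -> (forall x, is_derive x 1 F (f x)) ->
  \int[leb R]_(x in unit_itv) f x = F (1/2) - F (- (1/2)).
Proof.
move=> cf dF; rewrite /Rintegral (@continuous_FTC2 _ f F)//.
- lra.
- by apply: continuous_subspaceT.
- have cF : continuous F.
    by move=> x; apply: differentiable_continuous; apply/derivable1_diffP; apply: ex_derive.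
  split.
  + by move=> x _; apply: ex_derive.
  + by apply: cvg_at_right_filter; exact: cF.
  + by apply: cvg_at_left_filter; exact: cF.
- by move=> x _; rewrite derive1E; apply: derive_val.
Qed.

Lemma Rintegral_cos (c : R) : c != 0 ->
  \int[leb R]_(x in unit_itv) cos (c * x) = 2 * sin (c / 2) / c.
Proof.
move=> c0; have dF x : is_derive x 1 (fun x => c^-1 * sin (c * x)) (cos (c * x)).
  apply: is_derive_eq; rewrite /GRing.scale/=; field; exact: c0.
by rewrite (Rintegral_FTC (continuous_expi_lin c).1 dF) mulrN sinN div1r; field.
Qed.

Lemma Rintegral_sin (c : R) : c != 0 ->
  \int[leb R]_(x in unit_itv) sin (c * x) = 0.
Proof.
move=> c0; have dF x : is_derive x 1 (fun x => - c^-1 * cos (c * x)) (sin (c * x)).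
  apply: is_derive_eq; rewrite /GRing.scale/=; field; exact: c0.
by rewrite (Rintegral_FTC (continuous_expi_lin c).2 dF) !mulrN cosN; ring.
Qed.

Lemma unit_itv_measurable : measurable (unit_itv : set (measurableTypeR R)).
Proof. exact: measurable_itv. Qed.

Lemma leb_unit_itv : leb R unit_itv = 1%E.
Proof.
change (lebesgue_measure (`[- (1/2), 1/2]%classic : set R) = 1%E :> \bar R).
rewrite lebesgue_measure_itv/= lte_fin ifT; last by lra.
by rewrite -EFinD; congr EFin; field.
Qed.

Lemma cint_Efun k : cint (leb R) unit_itv (Efun k) = if k == 0 then 1 else 0.
Proof.
rewrite cintE /Efun /=; case: ifPn => [/eqP ->|k0].
  rewrite mulr0; under eq_Rintegral do rewrite mul0r cos0.
  under [X in Complex _ X]eq_Rintegral do rewrite mul0r sin0.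
  rewrite !Rintegral_cst//; try exact: unit_itv_measurable.
  by apply: complex_ext; rewrite /= ?mul0r// mul1r leb_unit_itv.
have c0 : 2 * pi * k%:~R != 0 :> R.
  by rewrite !mulf_neq0 ?intr_eq0// gt_eqF// pi_gt0.
rewrite Rintegral_sin// Rintegral_cos//.
rewrite (_ : 2 * pi * k%:~R / 2 = pi * k%:~R); last by field.
by rewrite sin_pi_int mulr0 mul0r.
Qed.

(** The exponentials are cut off to the interval instead of changing the measure space, so every
    inner product is taken on the whole line. *)
Definition fexp k x : R[i] := (\1_unit_itv x)%:C * Efun k x.

Lemma L2_unit_trig p : trig p -> L2 (leb R) (fun x => (\1_unit_itv x)%:C * p x).
Proof.
have Efun_case m : L2 (leb R) (fun x => (\1_unit_itv x)%:C * Efun m x).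
  have l1 : L2 (leb R) (fun x => (\1_unit_itv x)%:C).
    by apply: L2_indicator; [exact: unit_itv_measurable|rewrite [X in (X < _)%E]leb_unit_itv ltry].
  apply: (L2_le (c := 1) l1).
    apply: cmeasurable_indic; first exact: unit_itv_measurable.
    exact: cmeasurable_expi_lin.
  by move=> x; rewrite sqmodM sqmod_expi mulr1 mul1r.
elim=> [|m|c {}p q _ ih1 _ ih2] //.
  by under eq_fun do rewrite mulr0; exact: L2_0.
have := L2D (L2Z c ih1) ih2; congr L2; apply/funext => x; ring.
Qed.

Lemma L2_fexp k : L2 (leb R) (fexp k).
Proof. exact: L2_unit_trig (trig_exp k). Qed.

Lemma inner_unit (f g : R -> R[i]) :
  inner (leb R) (fun x => (\1_unit_itv x)%:C * f x) (fun x => (\1_unit_itv x)%:C * g x) =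
  cint (leb R) unit_itv (fun x => f x * conjc (g x)).
Proof.
rewrite cint_mkcond; apply: eq_cint => x _; rewrite conjcM conjc_real indicE.
by case: (x \in _) => /=; ring.
Qed.

Lemma inner_fexp m n : inner (leb R) (fexp m) (fexp n) = if m == n then 1 else 0.
Proof.
rewrite inner_unit -[m == n]subr_eq0 -cint_Efun; apply: eq_cint => x _.
by rewrite EfunD EfunN.
Qed.

End fourier_series.

Section integer_box.
Context {R : realType}.

Definition ibox (N : nat) : seq int := [seq i%:Z - N%:Z | i <- iota 0 (N + N).+1].

Lemma mem_ibox N (k : int) : (k \in ibox N) = (absz k <= N)%N.
Proof.
apply/mapP/idP => [H|kN]; first by case: H => i; rewrite mem_iota; lia.
by exists (absz (k + N%:Z)); rewrite ?mem_iota; lia.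
Qed.

Lemma exhausting_ibox : exhausting ibox.
Proof.
split=> [N|s].
  by rewrite map_inj_uniq ?iota_uniq// => i j; lia.
exists (\max_(k <- s) absz k)%N => N sN k ks; rewrite mem_ibox.
by apply: leq_trans sN; exact: leq_bigmax_seq.
Qed.

Lemma sum_ibox (N : nat) (a : int -> R[i]) :
  \sum_(k <- ibox N) a k = \sum_(i < (N + N).+1) a (i%:Z - N%:Z).
Proof. by rewrite big_map -(big_mkord xpredT (fun i => a (i%:Z - N%:Z))). Qed.

Lemma zsum_gsum (a : int -> R[i]) L : zsum_is a L <-> gsum_is ibox a L.
Proof.
have E (N : nat) := esym (sum_ibox N a).
rewrite /zsum_is /gsum_is; split=> -[h1 [h2 h3]]; (split=> //; split).
- by move: h2; under eq_fun do rewrite E.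
- by move: h3; under eq_fun do rewrite E.
- by under eq_fun do rewrite E.
- by under eq_fun do rewrite E.
Qed.

Definition ibox2 (N : nat) : seq (int * int) := [seq (k, m) | k <- ibox N, m <- ibox N].

Lemma exhausting_ibox2 : exhausting ibox2.
Proof.
have [ui bi] := exhausting_ibox; split=> [N|s].
  by apply: allpairs_uniq => // -[a b] [c d].
have [N1 h1] := bi (map fst s); have [N2 h2] := bi (map snd s).
exists (maxn N1 N2) => N; rewrite geq_max => /andP[n1 n2] [k m] kms.
apply/allpairsP; exists (k, m); split => //=.
  by apply: h1 => //; apply/mapP; exists (k, m).
by apply: h2 => //; apply/mapP; exists (k, m).
Qed.

Lemma zsum2_gsum (a : int * int -> R[i]) L : zsum2_is a L <-> gsum_is ibox2 a L.
Proof.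
have E (N : nat) : \sum_(i < (N + N).+1) \sum_(j < (N + N).+1)
    a (i%:Z - N%:Z, j%:Z - N%:Z) = \sum_(km <- ibox2 N) a km.
  rewrite /ibox2 big_allpairs/= sum_ibox; apply: eq_bigr => i _.
  by rewrite sum_ibox.
rewrite /zsum2_is /gsum_is; split=> -[h1 [h2 h3]]; (split=> //; split).
- by move: h2; under eq_fun do rewrite E.
- by move: h3; under eq_fun do rewrite E.
- by under eq_fun do rewrite E.
- by under eq_fun do rewrite E.
Qed.

End integer_box.

(** * Parseval's identity for Fourier series *)

Section fourier_parseval.
Context {R : realType}.
Implicit Types (x : R) (k m : int) (c : R[i]) (p q : R -> R[i]).

Lemma gsum_delta {I : choiceType} (box : nat -> seq I) (i0 : I) c : exhausting box ->
  gsum_is box (fun i => if i == i0 then c else 0) c.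
Proof.
move=> exh; have : gsum_is box (fun i => (if i == i0 then 1 else 0 : R)%:C) 1%:C.
  apply: (gsum_real exh); first by move=> i; case: ifP.
  transitivity (\esum_(i in [set i0]) (1 : R)%:E)%E; last by rewrite esum_set1.
  rewrite [RHS]esum_mkcond; apply: eq_esum => i _.
  by rewrite in_set1; case: ifP.
move=> h; have := gsum_lin c h (gsum0 _).
by congr gsum_is; [apply/funext => i; case: ifP => _|]; rewrite /=; ring.
Qed.

Definition unit_trig v := exists2 p, trig p & v = (fun x : R => (\1_unit_itv x)%:C * p x).

(** Both sides are sesquilinear in p and q, so two inductions leave a pair of exponentials; by
    orthonormality their sum has at most the one term at k = m. *)
Lemma trig_gsum p q : trig p -> trig q ->
  let v := fun x => (\1_unit_itv x)%:C * p x in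
  let w := fun x => (\1_unit_itv x)%:C * q x in
  gsum_is ibox (fun k => inner (leb R) v (fexp k) * inner (leb R) (fexp k) w)
    (inner (leb R) v w).
Proof.
have exh := exhausting_ibox.
move=> /= + tq; elim=> [|m|c {}p r tp ih1 tr ih2].
- under eq_fun do under [X in inner _ X _]eq_fun do rewrite mulr0.
  under [X in inner _ X _]eq_fun do rewrite mulr0.
  rewrite inner0l; under eq_fun do rewrite inner0l mul0r; exact: gsum0.
- elim: tq => [|n|c {}q r tq ih1 tr ih2].
  + have z : (fun x => (\1_unit_itv x)%:C * 0) = (fun=> 0 : R[i]).
      by apply/funext => x; rewrite mulr0.
    rewrite z innerC; [|exact: L2_0|exact: L2_fexp].
    rewrite inner0l conjc0; under eq_fun => k.
      rewrite [X in _ * X]innerC; [|exact: L2_0|exact: L2_fexp].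
      rewrite inner0l conjc0 mulr0; over.
    exact: gsum0.
  + rewrite -/(fexp m) -/(fexp n) inner_fexp; under eq_fun do rewrite !inner_fexp.
    have := gsum_delta m (if m == n then 1 else 0) exh.
    congr gsum_is; apply/funext => k; rewrite [m == k]eq_sym.
    by case: ifP => [/eqP ->|_]; rewrite ?mul1r ?mul0r.
  + have E (h : R -> R[i]) : L2 (leb R) h ->
        inner (leb R) h (fun x => (\1_unit_itv x)%:C * (c * q x + r x)) =
        conjc c * inner (leb R) h (fun x => (\1_unit_itv x)%:C * q x) +
        inner (leb R) h (fun x => (\1_unit_itv x)%:C * r x).
      move=> lh; rewrite -innerZr; [|exact: L2_unit_trig|by []].
      rewrite -innerDr//; [|exact: L2Z (L2_unit_trig tq)|exact: L2_unit_trig].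
      by apply: eq_cint => x _; congr (_ * conjc _); ring.
    rewrite E; last exact: L2_fexp.
    have := gsum_lin (conjc c) ih1 ih2; congr gsum_is; apply/funext => k.
    by rewrite [X in _ = _ * X]E; [ring|exact: L2_fexp].
- have E (h : R -> R[i]) : L2 (leb R) h ->
      inner (leb R) (fun x => (\1_unit_itv x)%:C * (c * p x + r x)) h =
      c * inner (leb R) (fun x => (\1_unit_itv x)%:C * p x) h +
      inner (leb R) (fun x => (\1_unit_itv x)%:C * r x) h.
    move=> lh; rewrite -innerZl; [|exact: L2_unit_trig|by []].
    rewrite -innerDl//; [|exact: L2Z (L2_unit_trig tp)|exact: L2_unit_trig].
    by apply: eq_cint => x _; congr (_ * _); ring.
  rewrite E; last exact: L2_unit_trig.
  have := gsum_lin c ih1 ih2; congr gsum_is; apply/funext => k.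
  by rewrite [X in _ = X * _]E; [ring|exact: L2_fexp].
Qed.

Lemma parseval_unit_trig v : unit_trig v -> parseval (leb R) fexp v.
Proof.
move=> [p tp vE]; apply: (gsum_esum exhausting_ibox).
have := trig_gsum tp tp; rewrite /= -vE inner_nsq; congr gsum_is.
apply/funext => k; rewrite [X in _ * X]innerC ?mulc_conj//.
  by rewrite vE; exact: L2_unit_trig.
exact: L2_fexp.
Qed.

Lemma bernoulli_ge (y : R) (n : nat) : -1 <= y -> 1 + n%:R * y <= (1 + y) ^+ n.
Proof.
move=> y1; elim: n => [|n ih]; first by rewrite mul0r addr0 expr0.
have h : (1 + y) * (1 + n%:R * y) <= (1 + y) * (1 + y) ^+ n.
  by rewrite ler_wpM2l//; lra.
rewrite exprS; apply: le_trans h.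
have -> : (1 + y) * (1 + n%:R * y) = 1 + n.+1%:R * y + n%:R * y ^+ 2.
  by rewrite -natr1; ring.
by rewrite lerDl mulr_ge0// sqr_ge0.
Qed.

(* The polynomials of Brosowski and Deutsch's proof of the Stone-Weierstrass
   theorem: on [0, 1] they tend to the indicator of v < 1/2. *)
Definition bump_poly (n : nat) (v : R) : R := (1 - v ^+ n) ^+ (2 ^ n).

Lemma bump_poly_itv n v : 0 <= v <= 1 -> 0 <= bump_poly n v <= 1.
Proof.
move=> /andP[v0 v1]; have [h0 h1] : 0 <= v ^+ n /\ v ^+ n <= 1.
  by split; [exact: exprn_ge0|exact: exprn_ile1].
by rewrite exprn_ge0 ?exprn_ile1//; lra.
Qed.

(** Bernoulli's inequality gives the lower bound 1 - 2^n v^n = 1 - (2v)^n. *)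
Lemma bump_poly_lt v : 0 <= v < 1 / 2 -> (fun n => bump_poly n v) @ \oo --> (1 : R).
Proof.
move=> /andP[v0 v1].
have h : (fun n => 1 - (2 * v) ^+ n) @ \oo --> (1 : R).
  rewrite -[X in _ --> X]subr0; apply: cvgB; first exact: cvg_cst.
  by apply: cvg_expr; rewrite ger0_norm; lra.
apply: (@squeeze_cvgr _ \oo _ _ (fun n => 1 - (2 * v) ^+ n) (fun=> 1));
  [near=> n|exact: h|exact: cvg_cst].
have /andP[_ ->] := @bump_poly_itv n v ltac:(lra).
rewrite andbT; have := @bernoulli_ge (- v ^+ n) (2 ^ n) _.
rewrite mulrN natrX -exprMn; apply.
by rewrite lerN2 exprn_ile1//; lra.
Unshelve. all: by end_near. Qed.

(** Multiplied by (1 + v^n)^(2^n) the polynomial becomes (1 - v^(2n))^(2^n), which is at most 1,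
    while Bernoulli bounds that factor below by (2v)^n. Hence the upper bound (2v)^(-n). *)
Lemma bump_poly_gt v : 1 / 2 < v <= 1 -> (fun n => bump_poly n v) @ \oo --> (0 : R).
Proof.
move=> /andP[v0 v1]; have v2 : 0 < 2 * v by lra.
have h : (fun n => ((2 * v)^-1) ^+ n) @ \oo --> (0 : R).
  apply: cvg_expr; rewrite ger0_norm ?invr_ge0; last lra.
  by rewrite invf_lt1//; lra.
apply: (@squeeze_cvgr _ \oo _ _ (fun=> 0) (fun n => ((2 * v)^-1) ^+ n));
  [near=> n|exact: cvg_cst|exact: h].
have /andP[-> _] := @bump_poly_itv n v ltac:(lra).
rewrite /= exprVn -[leRHS]mul1r ler_pdivlMr ?exprn_gt0//.
have vn0 : 0 <= v ^+ n by rewrite exprn_ge0//; lra.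
have vn1 : v ^+ n <= 1 by rewrite exprn_ile1//; lra.
have b := @bernoulli_ge (v ^+ n) (2 ^ n) ltac:(lra).
apply: (@le_trans _ _ (bump_poly n v * (1 + v ^+ n) ^+ (2 ^ n))).
  rewrite ler_wpM2l//; first by have /andP[] := @bump_poly_itv n v ltac:(lra).
  by apply: le_trans b; rewrite natrX -exprMn; lra.
rewrite /bump_poly -exprMn exprn_ile1//; nra.
Unshelve. all: by end_near. Qed.

(* cos(pi x) sin(pi (q - x)) has the sign of q - x inside the unit interval. *)
Definition sign_trig (q x : R) : R := 1 / 2 - cos (pi * x) * sin (pi * (q - x)) / 2.

(** Each of the two factors has only period 2 up to sign, but their product is half of sin(pi q) +
    sin(pi q - 2 pi x), which involves the frequencies 0, 1 and -1 alone. *)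
Lemma trig_sign_trig (q : R) : trig (fun x => (sign_trig q x)%:C).
Proof.
pose a : R[i] := expi (pi * q).
have -> : (fun x => (sign_trig q x)%:C) = (fun x => (1 / 2 - sin (pi * q) / 4)%:C +
    ('i * (8^-1)%:C * a * Efun (-1) x + - 'i * (8^-1)%:C * conjc a * Efun 1 x)).
  apply/funext => x; rewrite EfunN.
  have -> : Efun 1 x = expi (pi * x) * expi (pi * x).
    by rewrite -expiD /Efun; congr expi; ring.
  apply: complex_ext; rewrite !ReImE /sign_trig /a /=; last by ring.
  rewrite mulrBr sinB.
  have := cos2Dsin2 (pi * x).
  set C := cos (pi * x); set S := sin (pi * x).
  set c := cos (pi * q); set s := sin (pi * q) => e.
  have -> : S * S = 1 - C * C by rewrite -!expr2 -e; ring.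
  by field.
apply: trig_add; first exact: trig_cst.
by apply: trig_add; apply: trig_scale; exact: trig_exp.
Qed.

Lemma sign_trig_itv (q x : R) : 0 <= sign_trig q x <= 1.
Proof.
have : `|cos (pi * x) * sin (pi * (q - x))| <= 1.
  by rewrite normrM mulr_ile1// ?normr_ge0// ?cos_max ?sin_max.
by rewrite ler_norml /sign_trig => /andP[? ?]; apply/andP; split; lra.
Qed.

Lemma sign_trigP (q x : R) : - (1/2) <= q <= 1/2 -> - (1/2) < x < 1/2 ->
  (x < q -> sign_trig q x < 1/2) /\ (q < x -> 1/2 < sign_trig q x).
Proof.
move=> /andP[q1 q2] /andP[x1 x2]; have p0 := pi_gt0 R.
have c0 : 0 < cos (pi * x) by apply: cos_gt0_pihalf; apply/andP; split; nra.
have sp (t : R) : 0 < t < 1 -> 0 < sin (pi * t).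
  by move=> /andP[t0 t1]; apply: sin_gt0_pi; apply/andP; split; nra.
rewrite /sign_trig; split => xq.
  have h : 0 < q - x < 1 by apply/andP; split; lra.
  have := mulr_gt0 c0 (sp _ h); lra.
have h : 0 < x - q < 1 by apply/andP; split; lra.
have := mulr_gt0 c0 (sp _ h); rewrite -[x - q]opprB mulrN sinN mulrN; lra.
Qed.

Lemma ae_neq (a : R) : {ae leb R, forall x, x != a}.
Proof.
exists [set a]; split; first exact: measurable_set1.
  exact: lebesgue_measure_set1.
by move=> x /= /negP; rewrite negbK => /eqP.
Qed.

Lemma closed_subspace_unit_trig : closed_subspace (leb R) (closure_L2 (leb R) unit_trig).
Proof.
apply: closure_L2_closed.
- by move=> v [p tp ->]; exact: L2_unit_trig.
- by exists (fun=> 0); [exact: trig_0|apply/funext => x; rewrite mulr0].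
- move=> c v w [p tp ->] [r tr ->]; exists (fun x => c * p x + r x).
    exact: trig_lin.
  by apply/funext => x; ring.
Qed.

(** Inserting [sign_trig] into the bump polynomials yields trigonometric polynomials with values in
    [0, 1] that converge to the indicator of x < q, except perhaps at the jump and at the two
    endpoints; dominated convergence concludes. *)
Lemma unit_trig_half_line (q : R) :
  closure_L2 (leb R) unit_trig (fun x => (\1_(`]-oo, q[ `&` unit_itv) x)%:C).
Proof.
have cs := closed_subspace_unit_trig.
(* Clamping q to the unit interval changes the truncated half-line at most at an endpoint, and keeps
   |q' - x| < 1, where the sine has the right sign. *)
pose q' := Num.max (- (1/2)) (Num.min q (1/2)).
have q'_itv : - (1/2) <= q' <= 1/2.
  by rewrite /q' le_max lexx/= ge_max ge_min lexx orbT andbT; lra.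
have mU := unit_itv_measurable (R := R).
have U1 : (leb R unit_itv < +oo)%E by rewrite [X in (X < _)%E]leb_unit_itv ltry.
have mq : measurable (`]-oo, q[ `&` unit_itv : set (measurableTypeR R)).
  by apply: measurableI => //; exact: measurable_itv.
pose f_ n x : R[i] := (\1_unit_itv x)%:C * (bump_poly n (sign_trig q' x))%:C.
apply: (cs_dominated (f_ := f_) (h := \1_unit_itv) cs).
- apply: L2_indicator => //; apply: le_lt_trans U1; apply: le_measure.
  + exact: mem_set.
  + exact: mem_set.
  + by move=> x [].
- move=> n; have tb : trig (fun x => (bump_poly n (sign_trig q' x))%:C).
    rewrite (_ : (fun x => _) = fun x =>
      (1 + - 1 * (sign_trig q' x)%:C ^+ n) ^+ (2 ^ n)).
      apply: trig_pow; apply: trig_add; first exact: trig_cst.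
      by apply: trig_scale; apply: trig_pow; exact: trig_sign_trig.
    by apply/funext => x; rewrite /bump_poly rmorphXn/= rmorphB/= rmorphXn/= mulN1r.
  by apply: closure_L2_sub; [exact: L2_unit_trig|exists (fun x => (bump_poly n (sign_trig q' x))%:C)].
- exact: integrable_indicator.
- apply: (aeS (aeI (ae_neq (- (1/2))) (aeI (ae_neq (1/2)) (ae_neq q')))) => x [x1 [x2 xq]].
  have [xD|xD] := boolP (x \in unit_itv); last first.
    rewrite (_ : (fun n => _) = fun=> 0); first exact: cvg_cst.
    apply/funext => n; rewrite /f_ !indicE in_setI (negPf xD) andbF/= mul0r subrr.
    by rewrite sqmod0.
  have x12 : - (1/2) < x < 1/2.
    move: (set_mem xD); rewrite /unit_itv/= in_itv/= => /andP[xl xr].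
    by rewrite !lt_neqAle xl xr eq_sym x1 x2.
  have [hl hr] := sign_trigP q'_itv x12.
  have lims (l : R) : (fun n => bump_poly n (sign_trig q' x)) @ \oo --> l ->
      l = (x < q)%R%:R ->
      (fun n => sqmod ((\1_(`]-oo, q[ `&` unit_itv) x)%:C - f_ n x)) @ \oo --> (0 : R).
    move=> hb lq.
    have -> : (fun n => sqmod ((\1_(`]-oo, q[ `&` unit_itv) x)%:C - f_ n x)) =
        (fun n => (l - bump_poly n (sign_trig q' x)) * (l - bump_poly n (sign_trig q' x))).
      apply/funext => n; rewrite /f_ !indicE in_setI xD andbT/= mul1r -rmorphB/=.
      by rewrite sqmod_real expr2 lq mem_setE in_itv.
    have h : (fun n => l - bump_poly n (sign_trig q' x)) @ \oo --> l - l.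
      by apply: cvgB => //; exact: cvg_cst.
    have : (fun n => (l - bump_poly n (sign_trig q' x)) * (l - bump_poly n (sign_trig q' x)))
        @ \oo --> (l - l) * (l - l) by exact: cvgM.
    by rewrite subrr mulr0.
  move: xq; rewrite neq_lt => /orP[xq|qx].
    have xltq : x < q.
      by move: xq x12; rewrite /q' lt_max lt_min; lra.
    apply: (lims 1); last by rewrite xltq.
    by apply: bump_poly_lt; rewrite hl// andbT; have /andP[] := sign_trig_itv q' x.
  have xgeq : (x < q) = false.
    by apply/negbTE; move: qx x12; rewrite -leNgt /q' gt_max gt_min; lra.
  apply: (lims 0); last by rewrite xgeq.
  by apply: bump_poly_gt; rewrite hr//=; have /andP[] := sign_trig_itv q' x.
- move=> n x; rewrite /f_ !indicE in_setI.
  have /andP[b0 b1] := bump_poly_itv n (sign_trig_itv q' x).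
  case: (x \in unit_itv); last by rewrite andbF/= mul0r subrr sqmod0.
  rewrite andbT/= mul1r -rmorphB/= sqmod_real -[leRHS](expr1n _ 2) -[leLHS]real_normK ?num_real//.
  rewrite ler_sqr ?nnegrE ?normr_ge0//.
  by case: (x \in _) => /=; rewrite ler_norml; apply/andP; split; lra.
Qed.

(** Open half-lines are stable under intersection and generate the Borel sets, so approximating
    their indicators is enough for trigonometric polynomials to be dense; Parseval then passes from
    them to f. *)
Lemma fourier_parseval (f : R -> R[i]) : L2 (leb R) f ->
  (forall x, ~ unit_itv x -> f x = 0) -> parseval (leb R) fexp f.
Proof.
move=> lf f0.
pose X (f : R -> R[i]) := L2 (leb R) f /\ forall x, ~ unit_itv x -> f x = 0.
have cs := closed_subspace_unit_trig.
have mU := unit_itv_measurable (R := R).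
have U1 : (leb R unit_itv < +oo)%E by rewrite [X in (X < _)%E]leb_unit_itv ltry.
apply: (@parseval_dense _ _ _ (leb R) _ fexp _ X unit_trig) => //.
- exact: L2_fexp.
- by move=> g [].
- move=> v [p tp ->]; split; first exact: L2_unit_trig.
  by move=> x xU; rewrite indicE memNset//= mul0r.
- move=> g h [lg g0] [lh h0]; split; first exact: L2B.
  by move=> x xU; rewrite g0// h0// subrr.
- exact: parseval_unit_trig.
- move=> g t [lg g0] t0.
  have gE : g = fun x => (\1_unit_itv x)%:C * g x.
    apply/funext => x; have [xU|xU] := pselect (unit_itv x).
      by rewrite indicE mem_set//= mul1r.
    by rewrite g0// mulr0.
  suff [_ /(_ t t0)] : closure_L2 (leb R) unit_trig g by [].
  rewrite gE; apply: (cs_restrict cs) => //.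
  apply: (cs_indicator cs mU U1 (G := @RGenInftyO.G R)).
  - exact: RGenInftyO.measurableE.
  - move=> _ _ [x ->] [y ->]; exists (Num.min x y); apply/seteqP; split => z /=;
    by rewrite !in_itv/= lt_min => /andP.
  - have -> : (fun x => (\1_unit_itv x)%:C) = fun x => (\1_unit_itv x)%:C * 1 : R[i].
      by apply/funext => x; rewrite mulr1.
    apply: closure_L2_sub; first exact: L2_unit_trig (trig_cst 1).
    by exists (fun=> 1); first exact: trig_cst.
  - by move=> _ [q ->]; exact: unit_trig_half_line.
Qed.

End fourier_parseval.

(** * Change of variables and integer sums *)

Section affine_change_of_variable.
Context {R : realType}.
Local Notation T := (measurableTypeR R).

Definition affine (c t : R) : T -> T := fun x => c * x + t.

Lemma measurable_affine (c t : R) : measurable_fun setT (affine c t).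
Proof. by apply: measurable_funD => //; exact: measurable_funM. Qed.

(** Built as a measure so that its values on half-open intervals identify it with Lebesgue
    measure. *)
Definition affine_measure (c t : R) (c0 : 0 < c) : {measure set T -> \bar R}.
Proof.
unshelve refine (mscale (NngNum (ltW c0)) (pushforward (leb R) (affine c t)) :
  {measure set T -> \bar R}).
exact: measurable_affine.
Defined.

Lemma lebesgue_affine (c t : R) (A : set T) : 0 < c -> measurable A ->
  leb R A = (c%:E * leb R (affine c t @^-1` A))%E.
Proof.
move=> c0 mA.
change (lebesgue_measure A = affine_measure t c0 A).
apply: lebesgue_measure_unique => // _ [[a b]] _ <-.
change (lebesgue_measure [set` `]a, b]] =
  (c%:E * lebesgue_measure (affine c t @^-1` [set` `]a, b]]))%E).
have -> : affine c t @^-1` [set` `]a, b]] = `](a - t) / c, (b - t) / c]%classic.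
  apply/seteqP; split => x /=; rewrite !in_itv/= /affine.
    by move=> /andP[h1 h2]; rewrite ltr_pdivrMr// ler_pdivlMr// mulrC; apply/andP; split; lra.
  by rewrite ltr_pdivrMr// ler_pdivlMr// mulrC => /andP[h1 h2]; apply/andP; split; lra.
rewrite !lebesgue_measure_itv/= !lte_fin ltr_pM2r ?invr_gt0// ltrD2r.
case: ifP => _; last by rewrite mule0.
rewrite -!EFinB -EFinM; congr EFin; field; exact: lt0r_neq0.
Qed.

Lemma ge0_integral_affine (c t : R) (f : T -> \bar R) : 0 < c ->
  measurable_fun setT f -> (forall x, 0 <= f x)%E ->
  (\int[leb R]_x f x = c%:E * \int[leb R]_x f (c * x + t)%R)%E.
Proof.
move=> c0 mf f0.
rewrite (eq_measure_integral (affine_measure t c0)); last first.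
  by move=> A mA _; rewrite (lebesgue_affine t c0 mA).
rewrite (ge0_integral_mscale _ measurableT (NngNum (ltW c0)) mf)//.
by rewrite (ge0_integral_pushforward (measurable_affine c t))//= preimage_setT.
Qed.

Lemma lty_scale (c : R) (x : \bar R) : 0 < c -> (c%:E * x < +oo)%E -> (x < +oo)%E.
Proof.
move=> c0; case: x => [r _||//]; first by rewrite ltry.
by rewrite gt0_muley// lte_fin.
Qed.

Lemma integrable_affine (c t : R) (f : T -> R) : 0 < c ->
  (leb R).-integrable setT (EFin \o f) ->
  (leb R).-integrable setT (EFin \o (fun x => f (c * x + t)%R)).
Proof.
move=> c0 /integrableP[mf fi]; apply/integrableP; split.
  exact: (measurableT_comp mf (measurable_affine c t)).
have mg : measurable_fun setT (fun x => `|(f x)%:E|)%E by exact: measurableT_comp.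
by apply: (lty_scale c0); rewrite -(ge0_integral_affine t c0 mg).
Qed.

Lemma Rintegral_affine (c t : R) (f : T -> R) : 0 < c ->
  (leb R).-integrable setT (EFin \o f) ->
  \int[leb R]_x f x = c * \int[leb R]_x f (c * x + t).
Proof.
move=> c0 fi; have gi := integrable_affine t c0 fi.
have mf := measurable_int _ fi.
rewrite /Rintegral integralE [in RHS]integralE.
rewrite (@ge0_integral_affine c t (EFin \o f)^\+%E)//; last exact: measurable_funepos.
rewrite (@ge0_integral_affine c t (EFin \o f)^\-%E)//; last exact: measurable_funeneg.
have := integral_funepos_lt_pinfty measurableT gi; have := integral_funeneg_lt_pinfty measurableT gi.
have -> : (\int[leb R]_x (EFin \o f)^\+ (c * x + t)%R =
  \int[leb R]_x ((EFin \o (fun x => f (c * x + t)%R))^\+ x))%E.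
  by apply: eq_integral => x _; rewrite !funeposE.
have -> : (\int[leb R]_x (EFin \o f)^\- (c * x + t)%R =
  \int[leb R]_x ((EFin \o (fun x => f (c * x + t)%R))^\- x))%E.
  by apply: eq_integral => x _; rewrite !funenegE.
set p := (\int[leb R]_x ((EFin \o (fun x => f (c * x + t)%R))^\+ x))%E.
set q := (\int[leb R]_x ((EFin \o (fun x => f (c * x + t)%R))^\- x))%E.
have : (0 <= p)%E by apply: integral_ge0 => x _; exact: funepos_ge0.
have : (0 <= q)%E by apply: integral_ge0 => x _; exact: funeneg_ge0.
case: p => // p; case: q => // q _ _ _ _ /=.
by rewrite mulrBr.
Qed.

Lemma cint_affine (c t : R) (f : T -> R[i]) : 0 < c -> cintble (leb R) f ->
  cint (leb R) setT f = c%:C * cint (leb R) setT (fun x => f (c * x + t)%R).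
Proof.
move=> c0 [rf jf]; rewrite !cintE.
apply: complex_ext; rewrite !ReImE /= ?mul0r ?subr0 ?addr0.
  exact: (Rintegral_affine t c0 rf).
exact: (Rintegral_affine t c0 jf).
Qed.

Lemma cmeasurable_affine (c t : R) (f : T -> R[i]) : cmeasurable f ->
  cmeasurable (fun x => f (c * x + t)%R).
Proof. by move=> mf; exact: (cmeasurable_comp mf (measurable_affine c t)). Qed.

Lemma L2_affine (c t : R) (f : T -> R[i]) : 0 < c -> L2 (leb R) f ->
  L2 (leb R) (fun x => f (c * x + t)%R).
Proof.
move=> c0 [mf fi]; split; first exact: cmeasurable_affine.
apply: (lty_scale c0); rewrite -(ge0_integral_affine t c0 (emeasurable_sqmod mf))// => x.
by rewrite lee_fin sqmod_ge0.
Qed.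

Lemma nsq_affine (c t : R) (f : T -> R[i]) : 0 < c -> L2 (leb R) f ->
  nsq (leb R) f = c * nsq (leb R) (fun x => f (c * x + t)%R).
Proof. by move=> c0 lf; exact: (Rintegral_affine t c0 (L2_integrable lf)). Qed.

Lemma ae_affine (c t : R) (P : T -> Prop) : 0 < c ->
  {ae leb R, forall x, P x} -> {ae leb R, forall x, P (c * x + t)}.
Proof.
move=> c0 [N [mN N0 PN]]; exists (affine c t @^-1` N); split.
- by rewrite -[X in measurable X]setTI; exact: measurable_affine.
- have := lebesgue_affine t c0 mN; rewrite N0 => /esym/eqP.
  by rewrite mule_eq0 eqe gt_eqF//= => /eqP.
- by move=> x /= h; apply: PN.
Qed.

End affine_change_of_variable.

(** * Sums over the integers and unfolding of integrals over the line *)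

Section integer_sums.
Context {R : realType}.

(** An enumeration of the integers, used to turn unordered sums into series, for which monotone
    convergence is stated. *)
Definition zint (n : nat) : int := if odd n then Negz n./2 else n./2%:Z.

Lemma zint_bij : set_bij [set: nat] [set: int] zint.
Proof.
split => //.
- move=> m n _ _; rewrite /zint; have := odd_double_half m; have := odd_double_half n.
  by case: (odd m); case: (odd n) => /= h1 h2 // -[e]; rewrite -h1 -h2 e.
- move=> [n|n] _.
    by exists n.*2 => //; rewrite /zint odd_double doubleK.
  by exists n.*2.+1 => //; rewrite /zint /= odd_double /= uphalf_double.
Qed.

Lemma esum_zint (a : int -> \bar R) : (forall k, 0 <= a k)%E ->
  ((\esum_(k in [set: int]) a k) = \sum_(n <oo) a (zint n))%E.
Proof.
by move=> a0; rewrite (reindex_esum _ _ zint _ zint_bij) nneseries_esumT.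
Qed.

Lemma integral_esum_int d (T : measurableType d) (mu : {measure set T -> \bar R})
  (D : set T) (f : int -> T -> \bar R) : measurable D ->
  (forall k, measurable_fun D (f k)) -> (forall k x, 0 <= f k x)%E ->
  (\int[mu]_(x in D) (\esum_(k in [set: int]) f k x) =
   \esum_(k in [set: int]) (\int[mu]_(x in D) f k x))%E.
Proof.
move=> mD mf f0; rewrite esum_zint; last by move=> k; exact: integral_ge0.
rewrite -integral_nneseries//; apply: eq_integral => x _.
by rewrite esum_zint.
Qed.

Lemma measurable_esum_int d (T : measurableType d) (f : int -> T -> \bar R) :
  (forall k, measurable_fun setT (f k)) -> (forall k x, 0 <= f k x)%E ->
  measurable_fun setT (fun x => \esum_(k in [set: int]) f k x).
Proof.
move=> mf f0; under eq_fun do rewrite esum_zint//.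
exact: ge0_emeasurable_sum.
Qed.

(** The line is the disjoint union of the integer translates of [0, 1); each piece is moved back to
    [0, 1) and the sum is exchanged with the integral. *)
Lemma ge0_integral_unfold (g : measurableTypeR R -> \bar R) :
  measurable_fun setT g -> (forall x, 0 <= g x)%E ->
  (\int[leb R]_x g x =
   \int[leb R]_(t in `[0%R, 1%R[) (\esum_(k in [set: int]) g (t + k%:~R)%R))%E.
Proof.
move=> mg g0.
pose F (n : nat) : set (measurableTypeR R) := `[(zint n)%:~R, (zint n)%:~R + 1[%classic.
have mF n : measurable (F n) by exact: measurable_itv.
have FT : \bigcup_n F n = setT.
  apply/seteqP; split => // x _.
  have [_ _ zs] := zint_bij; have [n _ nE] := zs (Num.floor x) I.
  by exists n => //; rewrite /F/= in_itv/= nE floor_le// -[1]/(1%:~R) -intrD floorD1_gt.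
have tF : trivIset setT F.
  apply/trivIsetP => m n _ _ mn; rewrite -subset0 => x []; rewrite /F /= !in_itv/=.
  move=> /andP[m1 m2] /andP[n1 n2].
  have h1 : ((zint m)%:~R : R) < (zint n + 1)%:~R by rewrite intrD; exact: le_lt_trans m1 n2.
  have h2 : ((zint n)%:~R : R) < (zint m + 1)%:~R by rewrite intrD; exact: le_lt_trans n1 m2.
  move: h1 h2; rewrite !ltr_int !ltzD1 => h1 h2.
  have e : zint m = zint n by apply/eqP; rewrite eq_le h1 h2.
  have [_ zi _] := zint_bij; move/eqP: mn; apply; apply: zi e; exact: in_setT.
rewrite -FT (ge0_integral_bigcup _ mF)//; last by rewrite FT.
rewrite integral_esum_int//; last first.
  move=> k; apply: measurable_funTS; apply: measurableT_comp => //.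
  exact: measurable_funD.
rewrite esum_zint; last by move=> k; exact: integral_ge0.
apply: eq_eseriesr => n _; rewrite integral_mkcond [RHS]integral_mkcond.
rewrite (ge0_integral_affine (zint n)%:~R ltr01)/=; last 2 first.
- by apply/(measurable_restrictT _ _).1 => //; exact: measurable_funTS.
- by move=> x; exact: erestrict_ge0.
rewrite mul1e; apply: eq_integral => x _; rewrite /patch /F mul1r.
by congr (if _ then _ else _); apply/idP/idP => /set_mem/=; rewrite in_itv/= => /andP[? ?];
  apply/mem_set; rewrite /= in_itv/=; apply/andP; split; lra.
Qed.

End integer_sums.

(** * Iterated integrals on the plane *)

Section plane_integrals.
Context {R : realType}.
Local Notation T := (measurableTypeR R).
Implicit Types (f g : T * T -> R[i]) (h k : T -> R[i]).

Lemma measurable_section1 d (U : measurableType d) (f : T * T -> U) (x : T) :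
  measurable_fun setT f -> measurable_fun setT (fun y => f (x, y)).
Proof. by move=> mf; apply: (measurableT_comp mf); exact: measurable_pair1. Qed.

Lemma measurable_section2 d (U : measurableType d) (f : T * T -> U) (y : T) :
  measurable_fun setT f -> measurable_fun setT (fun x => f (x, y)).
Proof. by move=> mf; apply: (measurableT_comp mf); exact: measurable_pair2. Qed.

Lemma cmeasurable_section1 f (x : T) : cmeasurable f -> cmeasurable (fun y => f (x, y)).
Proof.
move=> [rf jf]; split; first exact: (measurable_section1 x rf).
exact: (measurable_section1 x jf).
Qed.

Lemma cmeasurable_section2 f (y : T) : cmeasurable f -> cmeasurable (fun x => f (x, y)).
Proof.
move=> [rf jf]; split; first exact: (measurable_section2 y rf).
exact: (measurable_section2 y jf).
Qed.

Lemma measurable_flip : measurable_fun setT (fun z : T * T => (z.2, z.1) : T * T).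
Proof. by apply: measurable_fun_pair; [exact: measurable_snd|exact: measurable_fst]. Qed.

Lemma cmeasurable_swap f : cmeasurable f -> cmeasurable (fun z : T * T => f (z.2, z.1)).
Proof. by move=> mf; exact: (cmeasurable_comp mf measurable_flip). Qed.

(** The integral is [fine] of a difference of two integrals of nonnegative functions, each
    measurable by Tonelli. Sections that are not integrable merely receive a default value. *)
Lemma measurable_Rintegral1 (u : T * T -> R) : measurable_fun setT u ->
  measurable_fun setT (fun x => \int[leb R]_y u (x, y)).
Proof.
move=> mu; have mE : measurable_fun setT (EFin \o u) by exact/measurable_EFinP.
apply: (measurableT_comp (fine_measurable measurableT)).
under eq_fun do rewrite integralE.
apply: emeasurable_funB.
  have := @measurable_fun_fubini_tonelli_F _ _ T T R lebesgue_measure (EFin \o u)^\+%E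
    (measurable_funepos mE) (fun x => funepos_ge0 _ x).
  by congr measurable_fun; apply/funext => x; apply: eq_integral => y _; rewrite !funeposE.
have := @measurable_fun_fubini_tonelli_F _ _ T T R lebesgue_measure (EFin \o u)^\-%E
  (measurable_funeneg mE) (fun x => funeneg_ge0 _ x).
by congr measurable_fun; apply/funext => x; apply: eq_integral => y _; rewrite !funenegE.
Qed.

Lemma cmeasurable_cint1 f : cmeasurable f ->
  cmeasurable (fun x : T => cint (leb R) setT (fun y => f (x, y))).
Proof.
move=> [rf jf]; split.
  by under eq_fun do rewrite cintE/=; exact: (measurable_Rintegral1 rf).
by under eq_fun do rewrite cintE/=; exact: (measurable_Rintegral1 jf).
Qed.

Lemma cmeasurable_cint2 f : cmeasurable f ->
  cmeasurable (fun y : T => cint (leb R) setT (fun x => f (x, y))).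
Proof. by move=> mf; exact: (cmeasurable_cint1 (cmeasurable_swap mf)). Qed.

(** The real-valued inner integral agrees with the extended one wherever the latter is finite, hence
    almost everywhere. *)
Lemma Rintegral_fubini1 (u : T * T -> R) : (leb2 R).-integrable setT (EFin \o u) ->
  \int[leb2 R]_z u z = \int[leb R]_x \int[leb R]_y u (x, y).
Proof.
move=> iu; congr fine.
have iu' : ((@lebesgue_measure R) \x (@lebesgue_measure R))%E.-integrable setT (EFin \o u).
  exact: iu.
have <- := integral12_prod_meas1 iu'.
have iF := integrable_fubini_F iu'.
have mu : measurable_fun setT u by apply/measurable_EFinP; exact: (measurable_int _ iu).
apply: ae_eq_integral => //.
- exact: (measurable_int _ iF).
- by apply/measurable_EFinP; exact: (measurable_Rintegral1 mu).
- apply: (aeS (integrable_ae measurableT iF)) => x /= /(_ I) fx _.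
  by rewrite /Rintegral fineK.
Qed.

Lemma Rintegral_fubini2 (u : T * T -> R) : (leb2 R).-integrable setT (EFin \o u) ->
  \int[leb2 R]_z u z = \int[leb R]_y \int[leb R]_x u (x, y).
Proof.
move=> iu; congr fine.
have iu' : ((@lebesgue_measure R) \x (@lebesgue_measure R))%E.-integrable setT (EFin \o u).
  exact: iu.
have <- := integral21_prod_meas1 iu'.
have mu : measurable_fun setT u by apply/measurable_EFinP; exact: (measurable_int _ iu).
apply: ae_eq_integral => //.
- exact: (measurable_fubini_G iu').
- apply/measurable_EFinP; apply: (@measurable_Rintegral1 (fun z => u (z.2, z.1))).
  exact: (measurableT_comp mu measurable_flip).
- apply: (aeS (ae_integrable2 iu')) => y iy _.
  by rewrite /Rintegral fineK//; exact: integrable_fin_num iy.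
Qed.

Lemma cint_fubini1 f : cintble (leb2 R) f ->
  cint (leb2 R) setT f = cint (leb R) setT (fun x => cint (leb R) setT (fun y => f (x, y))).
Proof.
move=> [rf jf]; rewrite !cintE; congr Complex.
  rewrite (Rintegral_fubini1 rf).
  by apply: eq_Rintegral => x _; rewrite cintE.
rewrite (Rintegral_fubini1 jf).
by apply: eq_Rintegral => x _; rewrite cintE.
Qed.

Lemma cint_fubini2 f : cintble (leb2 R) f ->
  cint (leb2 R) setT f = cint (leb R) setT (fun y => cint (leb R) setT (fun x => f (x, y))).
Proof.
move=> [rf jf]; rewrite !cintE; congr Complex.
  rewrite (Rintegral_fubini2 rf).
  by apply: eq_Rintegral => x _; rewrite cintE.
rewrite (Rintegral_fubini2 jf).
by apply: eq_Rintegral => x _; rewrite cintE.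
Qed.

Lemma tonelli1 (u : T * T -> R) : measurable_fun setT u -> (forall z, 0 <= u z) ->
  (\int[leb2 R]_z (u z)%:E = \int[leb R]_x \int[leb R]_y (u (x, y))%:E)%E.
Proof.
move=> mu u0; have mE : measurable_fun setT (EFin \o u) by exact/measurable_EFinP.
exact: (@fubini_tonelli1 _ _ T T R lebesgue_measure lebesgue_measure (EFin \o u) mE
  (fun z => u0 z)).
Qed.

Lemma tonelli2 (u : T * T -> R) : measurable_fun setT u -> (forall z, 0 <= u z) ->
  (\int[leb2 R]_z (u z)%:E = \int[leb R]_y \int[leb R]_x (u (x, y))%:E)%E.
Proof.
move=> mu u0; have mE : measurable_fun setT (EFin \o u) by exact/measurable_EFinP.
exact: (@fubini_tonelli2 _ _ T T R lebesgue_measure lebesgue_measure (EFin \o u) mE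
  (fun z => u0 z)).
Qed.

Lemma measurable_tonelli1 (u : T * T -> R) : measurable_fun setT u -> (forall z, 0 <= u z) ->
  measurable_fun setT (fun x => \int[leb R]_y (u (x, y))%:E)%E.
Proof.
move=> mu u0; have mE : measurable_fun setT (EFin \o u) by exact/measurable_EFinP.
exact: (@measurable_fun_fubini_tonelli_F _ _ T T R lebesgue_measure (EFin \o u) mE
  (fun z => u0 z)).
Qed.

Lemma ae_L2_section1 f : L2 (leb2 R) f -> {ae leb R, forall x, L2 (leb R) (fun y => f (x, y))}.
Proof.
move=> [mf fi]; have ms := measurable_sqmod mf.
have s0 z : 0 <= sqmod (f z) by exact: sqmod_ge0.
rewrite (tonelli1 ms s0) in fi.
have iF : (leb R).-integrable setT (fun x => \int[leb R]_y (sqmod (f (x, y)))%:E)%E.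
  apply/integrableP; split; first exact: (measurable_tonelli1 ms s0).
  apply: le_lt_trans fi; rewrite le_eqVlt; apply/orP; left; apply/eqP.
  apply: eq_integral => x _; rewrite gee0_abs//; apply: integral_ge0 => y _.
  by rewrite lee_fin.
apply: (aeS (integrable_ae measurableT iF)) => x /= /(_ I) fx.
split; first exact: cmeasurable_section1.
by rewrite ltey_eq fx.
Qed.

Definition tensor h k : T * T -> R[i] := fun z => h z.1 * k z.2.

Lemma cmeasurable_tensor h k : cmeasurable h -> cmeasurable k -> cmeasurable (tensor h k).
Proof.
move=> mh mk; apply: cmeasurableM.
  exact: (cmeasurable_comp mh measurable_fst).
exact: (cmeasurable_comp mk measurable_snd).
Qed.

Lemma L2_tensor h k : L2 (leb R) h -> L2 (leb R) k -> L2 (leb2 R) (tensor h k).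
Proof.
move=> lh lk; have mt := cmeasurable_tensor (L2_meas lh) (L2_meas lk).
split => //; rewrite (tonelli1 (measurable_sqmod mt) (fun z => sqmod_ge0 _)).
have E (x : T) : (\int[leb R]_y (sqmod (tensor h k (x, y)))%:E = (sqmod (h x) * nsq (leb R) k)%:E)%E.
  rewrite EFinM (nsqE lk) -integralZl//; last exact: L2_integrable.
  by apply: eq_integral => y _; rewrite /tensor/= sqmodM EFinM.
under eq_integral do rewrite E EFinM.
rewrite integralZr//; last exact: L2_integrable.
by rewrite -(nsqE lh) -EFinM ltry.
Qed.

Lemma inner_tensor h k (u v : T -> R[i]) : L2 (leb R) h -> L2 (leb R) k ->
  L2 (leb R) u -> L2 (leb R) v ->
  inner (leb2 R) (tensor h k) (tensor u v) = inner (leb R) h u * inner (leb R) k v.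
Proof.
move=> lh lk lu lv; rewrite /inner cint_fubini1; last exact: cintble_L2 (L2_tensor lh lk) (L2_tensor lu lv).
rewrite [RHS]mulrC -cintZ; last exact: cintble_L2.
apply: eq_cint => x _; rewrite mulrC -cintZ; last exact: cintble_L2.
by apply: eq_cint => y _; rewrite /tensor/= conjcM; ring.
Qed.

End plane_integrals.

(** * Plancherel's theorem *)

Section compactly_supported.
Context {R : realType}.
Local Notation T := (measurableTypeR R).
Implicit Types (a b h u : T -> R[i]) (N : nat).

Definition sym_itv (r : R) : set T := `[- r, r].

Definition csupp a := exists N, forall x, ~ sym_itv N%:R x -> a x = 0.

(** The admissible frequency profiles: absolutely and square integrable, stable under conjugation,
    modulation and dilation, and bounded multipliers of L^2. *)
Record cbounded a : Prop := Cbounded {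
  cb_meas : cmeasurable a ;
  cb_bound : exists M : R, forall x, sqmod (a x) <= M ;
  cb_supp : csupp a }.

Lemma sym_itv_measurable (r : R) : measurable (sym_itv r).
Proof. exact: measurable_itv. Qed.

Lemma sym_itv_fin (r : R) : (leb R (sym_itv r) < +oo)%E.
Proof.
change (is_true (lebesgue_measure (`[(- r)%R, r]%classic : set R) < +oo)%E).
by rewrite lebesgue_measure_itv/=; case: ifP => _; rewrite -?EFinB ltry.
Qed.

Lemma L2_sym_itv (r : R) : L2 (leb R) (fun x => (\1_(sym_itv r) x)%:C).
Proof. apply: L2_indicator; [exact: sym_itv_measurable|exact: sym_itv_fin]. Qed.

Lemma csupp_indic a N : (forall x, ~ sym_itv N%:R x -> a x = 0) ->
  a = fun x => (\1_(sym_itv N%:R) x)%:C * a x.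
Proof.
move=> aN; apply/funext => x; have [xN|xN] := pselect (sym_itv N%:R x).
  by rewrite indicE mem_set//= mul1r.
by rewrite aN// mulr0.
Qed.

Lemma cbounded_L2 a : cbounded a -> L2 (leb R) a.
Proof.
move=> [ma [M aM] [N aN]]; apply: (L2_le (c := M) (L2_sym_itv N%:R)) => // x.
rewrite sqmod_real indicE; have [xN|xN] := pselect (sym_itv N%:R x).
  by rewrite mem_set//= expr1n mulr1.
by rewrite aN// sqmod0 memNset//= expr0n/= mulr0.
Qed.

Lemma csupp_cintble a : csupp a -> L2 (leb R) a -> cintble (leb R) a.
Proof.
move=> [N aN] la; rewrite (csupp_indic aN).
have := cintble_L2 (L2_sym_itv N%:R) (L2_conj la).
by congr cintble; apply/funext => x; rewrite conjcK.
Qed.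

Lemma csuppM b a : csupp a -> csupp (fun x => b x * a x).
Proof. by move=> [N aN]; exists N => x xN; rewrite aN// mulr0. Qed.

Lemma csuppD a b : csupp a -> csupp b -> csupp (fun x => a x + b x).
Proof.
move=> [N aN] [N' bN]; exists (maxn N N') => x xN.
rewrite aN ?bN ?addr0// => xi; apply: xN; move: xi; rewrite /sym_itv/= !in_itv/=.
  have : (N'%:R : R) <= (maxn N N')%:R by rewrite ler_nat leq_maxr.
  by lra.
have : (N%:R : R) <= (maxn N N')%:R by rewrite ler_nat leq_maxl.
by lra.
Qed.

Lemma cboundedM a b : cmeasurable b -> (exists M : R, forall x, sqmod (b x) <= M) ->
  cbounded a -> cbounded (fun x => b x * a x).
Proof.
move=> mb [K bK] [ma [M aM] sa]; split; [exact: cmeasurableM| |exact: csuppM].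
exists (K * M) => x; rewrite sqmodM ler_pM ?sqmod_ge0//.
Qed.

Lemma cbounded_lin c a b : cbounded a -> cbounded b -> cbounded (fun x => c * a x + b x).
Proof.
move=> [ma [M aM] sa] [mb [K bK] sb]; split.
- by apply: cmeasurableD => //; apply: cmeasurableM => //; exact: cmeasurable_cst.
- exists (2 * (sqmod c * M + K)) => x; apply: le_trans (sqmodD_le _ _) _.
  by rewrite ler_pM2l// lerD// sqmodM ler_wpM2l// sqmod_ge0.
- exact: (csuppD (csuppM (fun=> c) sa) sb).
Qed.

Lemma cbounded_conj a : cbounded a -> cbounded (fun x => conjc (a x)).
Proof.
move=> [ma [M aM] [N aN]]; split; first exact: cmeasurable_conj.
  by exists M => x; rewrite sqmodC.
by exists N => x xN; rewrite aN// conjc0.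
Qed.

Lemma cbounded_expi (c : R) a : cbounded a -> cbounded (fun x => expi (c * x) * a x).
Proof.
apply: cboundedM; first exact: cmeasurable_expi_lin.
by exists 1 => x; rewrite sqmod_expi.
Qed.

Lemma cbounded_dilate (c : R) a : 0 < c -> cbounded a -> cbounded (fun x => a (c * x + 0)).
Proof.
move=> c0 [ma [M aM] [N aN]]; split; first exact: cmeasurable_affine.
  by exists M.
have [K cK] : exists K : nat, N%:R / c <= K%:R.
  exists (Num.truncn (N%:R / c)).+1; apply: ltW; exact: truncnS_gt.
exists K => x xK; apply: aN => xN; apply: xK; move: xN.
rewrite /sym_itv/= !in_itv/= addr0 => /andP[h1 h2]; rewrite ler_pdivrMr// in cK.
by apply/andP; split; nra.
Qed.

Lemma cbounded_indic (A : set T) N : measurable A ->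
  cbounded (fun x => (\1_(A `&` sym_itv N%:R) x)%:C).
Proof.
move=> mA; split.
- by apply/cmeasurable_real/measurable_indic; apply: measurableI => //; exact: sym_itv_measurable.
- by exists 1 => x; rewrite sqmod_real indicE; case: (_ \in _); rewrite ?expr1n ?expr0n.
- by exists N => x xN; rewrite indicE memNset// => -[].
Qed.

(** The inverse transform as a plain integral, meant for compactly supported square-integrable
    functions, where it converges absolutely; [dirF] is its direct counterpart. *)
Definition invF a (x : R) : R[i] := cint (leb R) setT (fun xi => a xi * expi (2 * pi * xi * x)).

Definition dirF u (xi : R) : R[i] := cint (leb R) setT (fun x => u x * expi (- (2 * pi * x * xi))).

Lemma cmeasurable_character : cmeasurable (fun z : T * T => expi (2 * pi * z.1 * z.2)).
Proof.
have m : measurable_fun setT (fun z : T * T => 2 * pi * z.1 * z.2).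
  apply: measurable_funM; last exact: measurable_snd.
  by apply: measurable_funM => //; exact: measurable_fst.
split => /=.
  by apply: (measurableT_comp _ m); apply: continuous_measurable_fun; exact: continuous_cos.
by apply: (measurableT_comp _ m); apply: continuous_measurable_fun; exact: continuous_sin.
Qed.

Lemma cmeasurable_invF a : cmeasurable a -> cmeasurable (invF a : T -> R[i]).
Proof.
move=> ma; apply: (@cmeasurable_cint2 _ (fun z => a z.1 * expi (2 * pi * z.1 * z.2))).
apply: cmeasurableM; last exact: cmeasurable_character.
exact: (cmeasurable_comp ma measurable_fst).
Qed.

Lemma cintble_invF a x : csupp a -> L2 (leb R) a ->
  cintble (leb R) (fun xi => a xi * expi (2 * pi * xi * x)).
Proof.
move=> sa la; rewrite (_ : (fun xi => _) = fun xi => expi (2 * pi * x * xi) * a xi); last first.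
  by apply/funext => xi; rewrite mulrC; congr (expi _ * _); ring.
apply: csupp_cintble; first exact: csuppM.
apply: (L2_le (c := 1) la).
  by apply: cmeasurableM; [exact: cmeasurable_expi_lin|exact: L2_meas la].
by move=> xi; rewrite sqmodM sqmod_expi.
Qed.

Lemma invF_lin c a b : cbounded a -> cbounded b ->
  invF (fun xi => c * a xi + b xi) = fun x => c * invF a x + invF b x.
Proof.
move=> ca cb; apply/funext => x.
have ia := cintble_invF x (cb_supp ca) (cbounded_L2 ca).
have ib := cintble_invF x (cb_supp cb) (cbounded_L2 cb).
rewrite /invF -cintZ// -cintD//; last exact: cintbleZ.
by apply: eq_cint => xi _; ring.
Qed.

(** The value of [invF b] at t + m is the Fourier coefficient of index -m of b modulated by the
    frequency t, and modulation preserves the norm. *)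
Lemma parseval_invF_unit b (t : R) : cbounded b -> (forall x, ~ unit_itv x -> b x = 0) ->
  \esum_(m in [set: int]) (sqmod (invF b (t + m%:~R)))%:E = (nsq (leb R) b)%:E.
Proof.
move=> cb bU; pose g x := expi (2 * pi * t * x) * b x.
have lg : L2 (leb R) g by apply: cbounded_L2; exact: cbounded_expi.
have g0 (x : R) : ~ unit_itv x -> g x = 0 by move=> xU; rewrite /g bU// mulr0.
have <- : nsq (leb R) g = nsq (leb R) b.
  by apply: eq_Rintegral => x _; rewrite /g sqmodM sqmod_expi mul1r.
have := fourier_parseval lg g0; rewrite /parseval.
rewrite (@reindex_esum _ _ _ setT setT (fun m : int => - m)); last first.
  split; [by []|by move=> i j _ _ /oppr_inj|].
  by move=> i _; exists (- i); rewrite ?opprK.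
move=> <-.
apply: eq_esum => m _; congr (sqmod _)%:E; apply: eq_cint => x _.
rewrite /fexp EfunN conjcM conjcK conjc_real /g.
have [xU|xU] := pselect (unit_itv x); last by rewrite bU// mulr0 !mul0r.
rewrite indicE mem_set//= mul1r [RHS]mulrAC /Efun -expiD [RHS]mulrC.
by congr (_ * expi _); ring.
Qed.

(* Parseval for the Fourier coefficients of b shifted by t, integrated over t in [0, 1). *)
Lemma plancherel_unit b : cbounded b -> (forall x, ~ unit_itv x -> b x = 0) ->
  (\int[leb R]_x (sqmod (invF b x))%:E = (nsq (leb R) b)%:E)%E.
Proof.
move=> cb bU; rewrite ge0_integral_unfold; last 2 first.
- exact: emeasurable_sqmod (cmeasurable_invF (cb_meas cb)).
- by move=> x; rewrite lee_fin sqmod_ge0.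
under eq_integral do rewrite parseval_invF_unit//.
rewrite integral_cst; last exact: measurable_itv.
rewrite (_ : leb R `[0%R, 1%R[%classic = 1%E) ?mule1//.
change (lebesgue_measure (`[0%R, 1%R[%classic : set R) = 1%E).
by rewrite lebesgue_measure_itv/= lte_fin ltr01 -EFinB subr0.
Qed.

Lemma plancherel a : cbounded a -> L2 (leb R) (invF a) /\ nsq (leb R) (invF a) = nsq (leb R) a.
Proof.
move=> ca; have [N aN] := cb_supp ca.
(* If |c x| is at most N then |x| is at most N / (2 N + 1) < 1/2, so the dilate lives on the unit
   interval; the added 1 keeps c positive when N = 0. *)
pose c : R := 2 * N%:R + 1; have c0 : 0 < c by rewrite /c ltr_wpDl// mulr_ge0.
pose b x := a (c * x + 0); have cb : cbounded b by exact: cbounded_dilate.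
have bU x : ~ unit_itv x -> b x = 0.
  move=> xU; apply: aN => xN; apply: xU; move: xN.
  rewrite /sym_itv /unit_itv /= !in_itv/= addr0 => /andP[h1 h2].
  have : 0 <= (N%:R : R) by []. 
  rewrite /c in h1 h2 c0 *; move=> N0; apply/andP; split; nra.
have lb : L2 (leb R) (invF b).
  split; first exact: cmeasurable_invF (cb_meas cb).
  by rewrite plancherel_unit// ltry.
have nb : nsq (leb R) (invF b) = nsq (leb R) b.
  by rewrite /nsq /Rintegral plancherel_unit.
have E : invF a = fun x => c%:C * invF b (c * x + 0).
  apply/funext => x; rewrite /invF.
  rewrite (cint_affine 0 c0 (cintble_invF x (cb_supp ca) (cbounded_L2 ca))).
  congr (_ * _); apply: eq_cint => xi _; rewrite /b; congr (_ * expi _); ring.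
have lc := L2_affine 0 c0 lb.
rewrite E; split; first exact: L2Z.
rewrite nsqZ// sqmod_real (nsq_affine 0 c0 (cbounded_L2 ca)) -/b -nb.
by rewrite (nsq_affine 0 c0 lb); ring.
Qed.

Lemma plancherel_inner a b : cbounded a -> cbounded b ->
  inner (leb R) (invF a) (invF b) = inner (leb R) a b.
Proof.
move=> ca cb; have [la _] := plancherel ca; have [lb _] := plancherel cb.
rewrite (inner_polarization la lb) (inner_polarization (cbounded_L2 ca) (cbounded_L2 cb)).
congr polar; apply/funext => c.
have -> : (fun x => a x + c * b x) = fun x => c * b x + a x.
  by apply/funext => x; rewrite addrC.
rewrite -(plancherel (cbounded_lin c cb ca)).2 invF_lin//.
by congr nsq; apply/funext => x; rewrite addrC.
Qed.

End compactly_supported.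

Lemma nsq_exhaust d (T : measurableType d) (R : realType) (mu : {measure set T -> \bar R})
  (D : nat -> set T) (f : T -> R[i]) : L2 mu f -> (forall N, measurable (D N)) ->
  (forall x, exists N0, forall N, (N0 <= N)%N -> D N x) ->
  (fun N => nsq mu (fun x => f x - (\1_(D N) x)%:C * f x)) @ \oo --> (0 : R).
Proof.
move=> lf mD Dx; apply: (nsq_dominated (h := fun x => sqmod (f x))).
- move=> N; apply: cmeasurableB; first exact: L2_meas lf.
  exact: cmeasurable_indic (mD N) (L2_meas lf).
- exact: L2_integrable.
- apply: aeW => x; have [N0 hN] := Dx x; apply: cvg_near_cst; exists N0 => // N /= /hN xN.
  by rewrite indicE mem_set//= mul1r subrr sqmod0.
- move=> N x; rewrite indicE; case: (_ \in _) => /=.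
    by rewrite mul1r subrr sqmod0 sqmod_ge0.
  by rewrite mul0r subr0.
Qed.

(** * Duality and density for the Fourier transform on L^2 *)

Section fourier_duality.
Context {R : realType}.
Local Notation T := (measurableTypeR R).
Implicit Types (a b h u : T -> R[i]) (N : nat).

Lemma sym_itv_exhaust (x : R) : exists N0 : nat, forall N, (N0 <= N)%N -> sym_itv N%:R x.
Proof.
exists (Num.truncn `|x|).+1 => N xN; rewrite /sym_itv/= in_itv/= -ler_norml.
by apply/ltW/(lt_le_trans (truncnS_gt _)); rewrite ler_nat.
Qed.

Lemma nsq_trunc u : L2 (leb R) u ->
  (fun N => nsq (leb R) (fun x => u x - (\1_(sym_itv N%:R) x)%:C * u x)) @ \oo --> (0 : R).
Proof.
move=> lu; apply: nsq_exhaust => // N; first exact: sym_itv_measurable.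
exact: sym_itv_exhaust.
Qed.

Lemma cmeasurable_dirF u : cmeasurable u -> cmeasurable (dirF u : T -> R[i]).
Proof.
move=> mu; have -> : dirF u = fun xi => cint (leb R) setT
    (fun x => (u x * conjc (expi (2 * pi * x * xi)))).
  by apply/funext => xi; apply: eq_cint => x _; rewrite expiN.
apply: (@cmeasurable_cint2 _ (fun z => u z.1 * conjc (expi (2 * pi * z.1 * z.2)))).
apply: cmeasurableM; last exact: cmeasurable_conj (cmeasurable_character (R := R)).
exact: (cmeasurable_comp mu measurable_fst).
Qed.

(** Fubini's theorem for a(xi) e^(2 pi i x xi) conj(u(x)); compact supports make this kernel
    integrable on the plane. *)
Lemma invF_dirF a u : cbounded a -> csupp u -> L2 (leb R) u ->
  inner (leb R) (invF a) u = inner (leb R) a (dirF u).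
Proof.
move=> ca [N uN] lu; have [K aK] := cb_supp ca; have la := cbounded_L2 ca.
pose f (z : T * T) := a z.1 * expi (2 * pi * z.1 * z.2) * conjc (u z.2).
(* The kernel is a product of two square-integrable functions: a and the character with the
   indicator of the support of u, against u with the indicator of the support of a. *)
have lp : L2 (leb2 R) (fun z => expi (2 * pi * z.1 * z.2) *
    tensor a (fun x => (\1_(sym_itv N%:R) x)%:C) z).
  have lt := L2_tensor la (L2_sym_itv N%:R); apply: (L2_le (c := 1) lt).
    by apply: cmeasurableM; [exact: cmeasurable_character|exact: L2_meas lt].
  by move=> z; rewrite sqmodM sqmod_expi.
have lq := L2_tensor (L2_sym_itv K%:R) lu.
have fi : cintble (leb2 R) f.
  have := cintble_L2 lp lq; congr cintble; apply/funext => z.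
  rewrite /f /tensor conjcM conjc_real {2}(csupp_indic aK) {2}(csupp_indic uN) conjcM conjc_real.
  rewrite !indicE; case: (z.1 \in _); case: (z.2 \in _) => /=; ring.
rewrite /inner; transitivity (cint (leb2 R) setT f).
  rewrite (cint_fubini2 fi); apply: eq_cint => x _; rewrite /f/= mulrC -cintZ.
    by apply: eq_cint => xi _; rewrite mulrC.
  exact: cintble_invF (cb_supp ca) la.
rewrite (cint_fubini1 fi); apply: eq_cint => xi _; rewrite /f/=.
have iu : cintble (leb R) (fun x => u x * expi (- (2 * pi * x * xi))).
  rewrite (_ : (fun x => _) = fun x => expi (- (2 * pi * xi) * x) * u x).
    apply: csupp_cintble; first by apply: csuppM; exists N.
    apply: (L2_le (c := 1) lu).
      by apply: cmeasurableM; [exact: cmeasurable_expi_lin|exact: L2_meas lu].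
    by move=> x; rewrite sqmodM sqmod_expi.
  by apply/funext => x; rewrite mulrC; congr (expi _ * _); ring.
transitivity (a xi * cint (leb R) setT
    (fun x => conjc (u x * expi (- (2 * pi * x * xi))))); last first.
  by congr (_ * _); exact: (cint_conj iu).
rewrite -cintZ; last exact: cintble_conj.
apply: eq_cint => x _; rewrite conjcM -expiN opprK.
by rewrite (_ : 2 * pi * x * xi = 2 * pi * xi * x); ring.
Qed.

Lemma le0_of_le_eps (x K : R) : 0 <= K -> (forall t, 0 < t -> x <= K * t) -> x <= 0.
Proof.
move=> K0 h; rewrite leNgt; apply/negP => x0.
have K1 : 0 < 2 * (K + 1) by lra.
have := h (x / (2 * (K + 1))) (divr_gt0 x0 K1).
rewrite mulrA ler_pdivlMr// => h2; nra.
Qed.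

Lemma fourier_trunc_dirF u N :
  fourier_trunc u N%:R = dirF (fun x => (\1_(sym_itv N%:R) x)%:C * u x).
Proof.
apply/funext => xi; rewrite /fourier_trunc cint_mkcond.
by apply: eq_cint => x _; rewrite mulrA.
Qed.

(** For truncations of u this is [invF_dirF]. The truncations converge to u and their transforms to
    U in norm, and by Cauchy-Schwarz both pairings are continuous. *)
Lemma invF_fourier_L2 a u (U : R -> R[i]) : cbounded a -> is_fourier_L2 u U ->
  inner (leb R) (invF a) u = inner (leb R) a U.
Proof.
move=> ca [lu [lU cU]]; have [li ni] := plancherel ca; have la := cbounded_L2 ca.
pose uN N x := (\1_(sym_itv N%:R) x)%:C * u x.
pose z := inner (leb R) (invF a) u - inner (leb R) a U.
suff z0 : sqmod z <= 0.
  by apply/eqP; rewrite -subr_eq0; apply/eqP/sqmod_eq0/eqP; rewrite eq_le z0 sqmod_ge0.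
have na0 := nsq_ge0 (leb R) a.
apply: (le0_of_le_eps (K := 2 * (nsq (leb R) a + nsq (leb R) a))); first by lra.
move=> t t0; have /fine_cvgP[fin cU0] := cU.
have /cvgrPdist_lt/(_ t t0) h1 := cU0.
have /cvgrPdist_lt/(_ t t0) h2 := nsq_trunc lu.
(* Convergence in the extended reals makes the error finite only eventually, so finiteness is
   imposed on N as well; it makes the truncated transform square integrable. *)
have [N [[fN h1N] h2N]] := filter_ex (filterI (filterI fin h1) h2).
have luN : L2 (leb R) (uN N) by apply: L2_indic => //; exact: sym_itv_measurable.
have cuN : csupp (uN N).
  by exists N => x xN; rewrite /uN indicE memNset//= mul0r.
have mt : cmeasurable (fourier_trunc u N%:R : T -> R[i]).
  by rewrite fourier_trunc_dirF; apply: cmeasurable_dirF; exact: L2_meas luN.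
have lUN : L2 (leb R) (fun xi => U xi - fourier_trunc u N%:R xi).
  split; first by apply: cmeasurableB => //; exact: L2_meas lU.
  by move: fN => /=; rewrite ge0_fin_numE//; apply: integral_ge0 => x _; rewrite lee_fin sqmod_ge0.
have lt : L2 (leb R) (fourier_trunc u N%:R).
  have := L2B lU lUN; congr L2; apply/funext => xi; ring.
have zE : z = inner (leb R) (invF a) (fun x => u x - uN N x) -
    inner (leb R) a (fun xi => U xi - fourier_trunc u N%:R xi).
  rewrite innerBr// innerBr// (invF_dirF ca cuN luN) -fourier_trunc_dirF /z; ring.
rewrite zE; apply: le_trans (sqmodD_le _ _) _; rewrite sqmodN -[X in _ <= X]mulrA ler_pM2l// mulrDl.
apply: lerD.
  apply: le_trans (cauchy_schwarz li (L2B lu luN)) _; rewrite ni ler_wpM2l//.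
  by apply: ltW; move: h2N; rewrite sub0r normrN; apply: le_lt_trans; exact: ler_norm.
apply: le_trans (cauchy_schwarz la lUN) _; rewrite ler_wpM2l//.
by apply: ltW; move: h1N; rewrite sub0r normrN; apply: le_lt_trans; exact: ler_norm.
Qed.

(** Let H be the direct transform of h and a its truncation. Duality gives <invF a, h> = <a, H> =
    |a|^2, and Plancherel gives |invF a| = |a| and |H| = |h|. Hence |h - invF a|^2 = |H - a|^2,
    which tends to 0 as the truncation grows. *)
Lemma invF_dense h (t : R) : cbounded h -> 0 < t ->
  exists2 a, cbounded a & nsq (leb R) (fun x => h x - invF a x) < t.
Proof.
move=> ch t0; have lh := cbounded_L2 ch; have [K hK] := cb_supp ch.
have cj := cbounded_conj ch; have [lj nj] := plancherel cj.
pose H : T -> R[i] := fun xi => conjc (invF (fun x => conjc (h x)) xi).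
have lH : L2 (leb R) H by exact: L2_conj.
have nH : nsq (leb R) H = nsq (leb R) h.
  transitivity (nsq (leb R) (invF (fun x => conjc (h x)))).
    by apply: eq_Rintegral => x _; rewrite sqmodC.
  by rewrite nj; apply: eq_Rintegral => x _; rewrite sqmodC.
have HE : H = dirF h.
  apply/funext => xi; rewrite /H /invF -cint_conj; last first.
    exact: cintble_invF (cb_supp cj) (cbounded_L2 cj).
  by apply: eq_cint => x _; rewrite conjcM conjcK -expiN; congr (_ * expi (- _)); ring.
pose a N xi := (\1_(sym_itv N%:R) xi)%:C * H xi.
have ca N : cbounded (a N).
  split.
  - by apply: cmeasurable_indic; [exact: sym_itv_measurable|exact: L2_meas lH].
  (* H(xi) is the pairing of h with a character restricted to the support of h, and the norm of that
     restriction does not depend on xi. *)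
  - exists (nsq (leb R) h * nsq (leb R) (fun x => (\1_(sym_itv K%:R) x)%:C)) => xi.
    have -> : nsq (leb R) (fun x => (\1_(sym_itv K%:R) x)%:C) =
        nsq (leb R) (fun x => (\1_(sym_itv K%:R) x)%:C * expi (2 * pi * xi * x)).
      by apply: eq_Rintegral => x _; rewrite sqmodM sqmod_expi mulr1.
    have le1 : L2 (leb R) (fun x => (\1_(sym_itv K%:R) x)%:C * expi (2 * pi * xi * x)).
      apply: (L2_le (c := 1) (L2_sym_itv K%:R)).
        by apply: cmeasurable_indic; [exact: sym_itv_measurable|exact: cmeasurable_expi_lin].
      by move=> x; rewrite sqmodM sqmod_expi mulr1 mul1r.
    apply: (@le_trans _ _ (sqmod (H xi))).
      rewrite /a sqmodM sqmod_real indicE; case: (_ \in _).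
        by rewrite expr1n mul1r.
      by rewrite expr0n mul0r sqmod_ge0.
    apply: le_trans (cauchy_schwarz lh le1); rewrite HE /dirF /inner.
    rewrite le_eqVlt; apply/orP; left; apply/eqP; congr sqmod; apply: eq_cint => x _.
    rewrite {1}(csupp_indic hK) conjcM conjc_real -expiN [X in expi (- X)](_ : _ = 2 * pi * xi * x).
      by ring.
    by ring.
  - by exists N => x xN; rewrite /a indicE memNset//= mul0r.
have aH N : inner (leb R) (a N) H = (nsq (leb R) (a N))%:C.
  rewrite -inner_nsq; apply: eq_cint => xi _.
  rewrite /a conjcM conjc_real indicE; case: (_ \in _) => /=; ring.
have [N hN] := cvg0_small (nsq_trunc lH) t0.
exists (a N) => //; apply: le_lt_trans hN.
have la := cbounded_L2 (ca N); have [li ni] := plancherel (ca N).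
have e1 : inner (leb R) (invF (a N)) h = (nsq (leb R) (a N))%:C.
  by rewrite (invF_dirF (ca N) (cb_supp ch) lh) -HE aH.
rewrite nsqB// (innerC li lh) e1 ni conjc_real.
rewrite -/(a N) (nsqB lH la) (innerC la lH) aH nH conjc_real.
exact: lexx.
Qed.

End fourier_duality.

(** * The fibre equations *)

Section plane_dilations.
Context {R : realType}.
Local Notation T := (measurableTypeR R).
Implicit Types (f g : T * T -> R[i]).

Definition dilate1 (c t : R) f : T * T -> R[i] := fun z => f (c * z.1 + t, z.2).

Lemma cmeasurable_dilate1 (c t : R) f : cmeasurable f -> cmeasurable (dilate1 c t f).
Proof.
move=> mf; apply: (cmeasurable_comp mf); apply: measurable_fun_pair; last exact: measurable_snd.
exact: (measurableT_comp (measurable_affine c t) measurable_fst).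
Qed.

Lemma integral_dilate1 (c t : R) f : 0 < c -> cmeasurable f ->
  (\int[leb2 R]_z (sqmod (f z))%:E = c%:E * \int[leb2 R]_z (sqmod (dilate1 c t f z))%:E)%E.
Proof.
move=> c0 mf; have md := cmeasurable_dilate1 c t mf.
rewrite (tonelli2 (measurable_sqmod mf) (fun z => sqmod_ge0 _)).
rewrite (tonelli2 (measurable_sqmod md) (fun z => sqmod_ge0 _)).
rewrite -ge0_integralZl//; last 3 first.
- apply: (@measurable_tonelli1 _ (fun z => sqmod (dilate1 c t f (z.2, z.1)))) => [|z].
    exact: measurable_sqmod (cmeasurable_swap md).
  exact: sqmod_ge0.
- by move=> y _; apply: integral_ge0 => x _; rewrite lee_fin sqmod_ge0.
- by rewrite lee_fin ltW.
apply: eq_integral => y _.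
have m1 := emeasurable_sqmod (cmeasurable_section2 y mf).
by rewrite (ge0_integral_affine t c0 m1)// => x; rewrite lee_fin sqmod_ge0.
Qed.

Lemma L2_dilate1 (c t : R) f : 0 < c -> L2 (leb2 R) f -> L2 (leb2 R) (dilate1 c t f).
Proof.
move=> c0 [mf fi]; split; first exact: cmeasurable_dilate1.
by apply: (lty_scale c0); rewrite -integral_dilate1.
Qed.

Lemma nsq_dilate1 (c t : R) f : 0 < c -> L2 (leb2 R) f ->
  nsq (leb2 R) f = c * nsq (leb2 R) (dilate1 c t f).
Proof.
move=> c0 lf; apply: EFin_inj; rewrite EFinM (nsqE lf) (nsqE (L2_dilate1 t c0 lf)).
by rewrite -integral_dilate1//; exact: L2_meas lf.
Qed.

Lemma inner_dilate1 (c t : R) f g : 0 < c -> L2 (leb2 R) f -> L2 (leb2 R) g ->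
  inner (leb2 R) f g = c%:C * inner (leb2 R) (dilate1 c t f) (dilate1 c t g).
Proof.
move=> c0 lf lg; rewrite (inner_polarization lf lg).
rewrite (inner_polarization (L2_dilate1 t c0 lf) (L2_dilate1 t c0 lg)).
rewrite -polar_scale; congr polar; apply/funext => w.
exact: (nsq_dilate1 t c0 (L2D lf (L2Z w lg))).
Qed.

Lemma inner_sections f g : L2 (leb2 R) f -> L2 (leb2 R) g ->
  inner (leb2 R) f g =
  cint (leb R) setT (fun x => inner (leb R) (fun y => f (x, y)) (fun y => g (x, y))).
Proof. by move=> lf lg; rewrite /inner cint_fubini1//; exact: cintble_L2. Qed.

Lemma cmeasurable_inner1 f g : cmeasurable f -> cmeasurable g ->
  cmeasurable (fun x : T => inner (leb R) (fun y => f (x, y)) (fun y => g (x, y))).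
Proof.
move=> mf mg; apply: (@cmeasurable_cint1 _ (fun z => f z * conjc (g z))).
by apply: cmeasurableM => //; exact: cmeasurable_conj.
Qed.

End plane_dilations.

(** * Equivalence of the reproducing property and the fibre equations, for a regular version P *)

Section core.
Context {R : realType}.
Local Notation T := (measurableTypeR R).
Implicit Types (f g F G : T * T -> R[i]) (a b h : T -> R[i]) (k m : int).
Context (psi P : T * T -> R[i]).
Hypotheses (lpsi : L2 (leb2 R) psi) (lP : L2 (leb2 R) P).
Hypothesis lPs : forall x, L2 (leb R) (fun y => P (x, y)).
Hypothesis P0 : forall x y, ~ unit_itv x -> P (x, y) = 0.
(** The link between psi and P: a weak form of P being the partial Fourier transform of psi, tested
    on tensors. *)
Hypothesis duality : forall a h, cbounded a -> L2 (leb R) h ->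
  inner (leb2 R) (tensor (invF a) h) psi = inner (leb2 R) (tensor a h) P.

Definition dyadic k : R := (2 : R) `^ k%:~R.
Definition dyadic_scale k : R := (2 : R) `^ (- (k%:~R) / 2).

Lemma dyadic_gt0 k : 0 < dyadic k. Proof. exact: powR_gt0. Qed.

Lemma dyadic_scale_gt0 k : 0 < dyadic_scale k. Proof. exact: powR_gt0. Qed.

Lemma dyadic_scale_sqr k : dyadic k * dyadic_scale k ^+ 2 = 1.
Proof.
rewrite /dyadic /dyadic_scale expr2 -!powRD; try by rewrite pnatr_eq0 implybT.
by rewrite (_ : k%:~R + _ = 0) ?powRr0//; field.
Qed.

Definition Pk k (x : R) : T -> R[i] := fun y => P (dyadic k * x, y).

Lemma L2_Pk k x : L2 (leb R) (Pk k x). Proof. exact: lPs. Qed.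

(* The pairs (f, F) with F the partial Fourier transform of f, for f in the span
   of the tensors whose first factor has a bounded compactly supported transform. *)
Inductive tens : (T * T -> R[i]) -> (T * T -> R[i]) -> Prop :=
| tens_0 : tens (fun=> 0) (fun=> 0)
| tens_gen a h : cbounded a -> L2 (leb R) h -> tens (tensor (invF a) h) (tensor a h)
| tens_lin c f F g G : tens f F -> tens g G ->
    tens (fun z => c * f z + g z) (fun z => c * F z + G z).

Lemma tens_L2 f F : tens f F -> [/\ L2 (leb2 R) f, L2 (leb2 R) F &
  forall x, L2 (leb R) (fun y => F (x, y))].
Proof.
elim=> [|a h ca lh|c f1 F1 g1 G1 _ [lf lF sF] _ [lg lG sG]].
- by split; [exact: L2_0|exact: L2_0|move=> x; exact: L2_0].
- have [li _] := plancherel ca; split; [exact: L2_tensor| |].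
    by apply: L2_tensor => //; exact: cbounded_L2.
  by move=> x; exact: (L2Z (a x) lh).
- by split => [||x]; (apply: L2D; first exact: L2Z).
Qed.

Lemma tens_isometry f F g G : tens f F -> tens g G ->
  inner (leb2 R) f g = inner (leb2 R) F G.
Proof.
move=> tf; elim=> [|b h cb lh|c g1 G1 g2 G2 tg1 ih1 tg2 ih2].
- have [lf lF _] := tens_L2 tf.
  by rewrite (innerC (L2_0 _) lf) (innerC (L2_0 _) lF) !inner0l.
- elim: tf => [|a k ca lk|c f1 F1 f2 F2 tf1 ih1 tf2 ih2].
  + by rewrite !inner0l.
  + have [la _] := plancherel ca; have [lb _] := plancherel cb.
    rewrite inner_tensor// plancherel_inner// inner_tensor//; exact: cbounded_L2.
  + have [lf1 lF1 _] := tens_L2 tf1; have [lf2 lF2 _] := tens_L2 tf2.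
    have [lg lG _] := tens_L2 (tens_gen cb lh).
    rewrite (innerDl (L2Z c lf1) lf2 lg) (innerDl (L2Z c lF1) lF2 lG).
    by rewrite (innerZl c lf1 lg) (innerZl c lF1 lG) ih1 ih2.
- have [lf lF _] := tens_L2 tf.
  have [lf1 lF1 _] := tens_L2 tg1; have [lf2 lF2 _] := tens_L2 tg2.
  rewrite (innerDr (L2Z c lf1) lf2 lf) (innerDr (L2Z c lF1) lF2 lF).
  by rewrite (innerZr c lf1 lf) (innerZr c lF1 lF) ih1 ih2.
Qed.

Definition Rk F k (x : R) : R[i] := inner (leb R) (fun y => F (x, y)) (Pk k x).

(* Rescaling frequencies by 2^k turns the coefficients of f on psi_(k, m), m in Z,
   into the Fourier coefficients of one function on the unit interval. *)
Definition fibre F k (eta : R) : R[i] :=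
  (dyadic_scale k)%:C * inner (leb R) (fun y => F ((dyadic k)^-1 * eta + 0, y)) (fun y => P (eta, y)).

(** By Cauchy-Schwarz the square is at most |h|^2 |P(eta, .)|^2, which is integrable. The constant
    norm of h is what helps here: for a general F in place of h the pairing would be bounded by a
    product of two L^2 functions, giving only integrability. *)
Lemma L2_pairing h : L2 (leb R) h ->
  L2 (leb R) (fun eta => inner (leb R) h (fun y => P (eta, y))).
Proof.
move=> lh; have mp : cmeasurable (fun eta : T => inner (leb R) h (fun y => P (eta, y))).
  apply: (@cmeasurable_inner1 _ (fun z => h z.2) P); last exact: L2_meas lP.
  exact: (cmeasurable_comp (L2_meas lh) measurable_snd).
split => //; have [mP iP] := lP.
apply: (@le_lt_trans _ _ (\int[leb R]_eta ((nsq (leb R) h)%:E *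
    \int[leb R]_y (sqmod (P (eta, y)))%:E))%E).
  apply: ge0_le_integral => //.
  - by move=> x _; rewrite lee_fin sqmod_ge0.
  - exact: emeasurable_sqmod.
  - apply: emeasurable_funM => //.
    exact: (measurable_tonelli1 (measurable_sqmod mP) (fun z => sqmod_ge0 _)).
  - move=> x _; rewrite -(nsqE (lPs x)) -EFinM lee_fin.
    exact: cauchy_schwarz.
rewrite ge0_integralZl//; last 3 first.
- exact: (measurable_tonelli1 (measurable_sqmod mP) (fun z => sqmod_ge0 _)).
- by move=> x _; apply: integral_ge0 => y _; rewrite lee_fin sqmod_ge0.
- by rewrite lee_fin nsq_ge0.
rewrite -(tonelli1 (measurable_sqmod mP) (fun z => sqmod_ge0 _)).
by rewrite -(nsqE lP) -EFinM ltry.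
Qed.

Lemma fibre_lin c f F g G k eta : tens f F -> tens g G ->
  fibre (fun z => c * F z + G z) k eta = c * fibre F k eta + fibre G k eta.
Proof.
move=> tf tg; have [_ _ sF] := tens_L2 tf; have [_ _ sG] := tens_L2 tg.
rewrite /fibre innerDl ?innerZl//; first by ring.
exact: L2Z.
Qed.

Lemma fibre_tensor a h k eta : L2 (leb R) h -> fibre (tensor a h) k eta =
  (dyadic_scale k)%:C * (a ((dyadic k)^-1 * eta + 0) * inner (leb R) h (fun y => P (eta, y))).
Proof. by move=> lh; rewrite /fibre -(innerZl _ lh (lPs eta)). Qed.

Lemma L2_fibre f F k : tens f F -> L2 (leb R) (fibre F k).
Proof.
elim=> [|a h ca lh|c f1 F1 g1 G1 tf ih1 tg ih2].
- have -> : fibre (fun=> 0) k = fun=> 0.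
    by apply/funext => eta; rewrite /fibre inner0l mulr0.
  exact: L2_0.
- have -> : fibre (tensor a h) k = fun eta =>
    (dyadic_scale k)%:C * (a ((dyadic k)^-1 * eta + 0) * inner (leb R) h (fun y => P (eta, y))).
    by apply/funext => eta; rewrite fibre_tensor.
  apply: L2Z; have ic0 : 0 < (dyadic k)^-1 by rewrite invr_gt0 dyadic_gt0.
  have cd := cbounded_dilate ic0 ca; have [M aM] := cb_bound cd.
  apply: (L2_le (c := M) (L2_pairing lh)).
    by apply: cmeasurableM; [exact: cb_meas cd|exact: L2_meas (L2_pairing lh)].
  by move=> x; rewrite sqmodM ler_wpM2r// sqmod_ge0.
- have -> : fibre (fun z => c * F1 z + G1 z) k = fun eta =>
      c * fibre F1 k eta + fibre G1 k eta.
    by apply/funext => eta; exact: fibre_lin tf tg.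
  by apply: L2D => //; exact: L2Z.
Qed.

Lemma L2_psi_km k m : L2 (leb2 R) (psi_km psi k m).
Proof.
have ic0 : 0 < (dyadic k)^-1 by rewrite invr_gt0 dyadic_gt0.
have := L2Z (dyadic_scale k)%:C (L2_dilate1 (- m%:~R) ic0 lpsi); congr L2; apply/funext => z.
rewrite /dilate1 /psi_km; congr (_ * psi (_, _)); rewrite -/(dyadic k).
by field; rewrite gt_eqF ?dyadic_gt0.
Qed.

Lemma invF_dilate a (c : R) m x : 0 < c -> cbounded a ->
  invF a (c * x + c * m%:~R) =
  invF (fun eta => (c^-1)%:C * (expi (2 * pi * m%:~R * eta) * a (c^-1 * eta + 0))) x.
Proof.
move=> c0 ca; have ic0 : 0 < c^-1 by rewrite invr_gt0.
rewrite /invF (cint_affine 0 ic0 (cintble_invF _ (cb_supp ca) (cbounded_L2 ca))).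
have cd := cbounded_expi (2 * pi * m%:~R) (cbounded_dilate ic0 ca).
rewrite -cintZ; last first.
  have := cintble_invF x (cb_supp cd) (cbounded_L2 cd).
  congr cintble; apply/funext => xi; rewrite mulrAC -expiD mulrC; congr (_ * expi _).
  by field; rewrite gt_eqF.
apply: eq_cint => xi _; rewrite -[in RHS]mulrA; congr (_ * _).
rewrite [RHS]mulrAC -expiD [RHS]mulrC; congr (_ * expi _).
by field; rewrite gt_eqF.
Qed.

(** The substitution x -> 2^k x + 2^k m sends psi_(k, m) to 2^(-k/2) psi, and turns the inverse
    transform of a into that of a dilate of a modulated by e^(2 pi i m eta). Duality moves the
    pairing to frequencies, where P restricts it to the unit interval. The modulation sits in the
    first argument, hence the index -m. *)
Lemma coef_tens f F k m : tens f F ->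
  inner (leb2 R) f (psi_km psi k m) = inner (leb R) (fibre F k) (fexp (- m)).
Proof.
have c0 := dyadic_gt0 k; have ic0 : 0 < (dyadic k)^-1 by rewrite invr_gt0.
have lk := L2_psi_km k m.
elim=> [|a h ca lh|c f1 F1 g1 G1 tf ih1 tg ih2]; last first.
- have [lf _ _] := tens_L2 tf; have [lg _ _] := tens_L2 tg.
  have -> : fibre (fun z => c * F1 z + G1 z) k = fun eta =>
      c * fibre F1 k eta + fibre G1 k eta.
    by apply/funext => eta; exact: fibre_lin tf tg.
  have l1 := L2_fibre k tf; have l2 := L2_fibre k tg.
  have le := L2_fexp (R := R) (- m).
  rewrite (innerDl (L2Z c lf) lg lk) (innerZl c lf lk) ih1 ih2.
  by rewrite (innerDl (L2Z c l1) l2 le) (innerZl c l1 le).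
- have [li _] := plancherel ca; have lt := L2_tensor li lh.
  pose b eta := ((dyadic k)^-1)%:C * (expi (2 * pi * m%:~R * eta) * a ((dyadic k)^-1 * eta + 0)).
  have cb : cbounded b.
    apply: (cboundedM _ _ (cbounded_expi (2 * pi * m%:~R) (cbounded_dilate ic0 ca))).
      exact: cmeasurable_cst.
    by exists (sqmod ((dyadic k)^-1)%:C).
  have Ef : dilate1 (dyadic k) (dyadic k * m%:~R) (tensor (invF a) h) = tensor (invF b) h.
    by apply/funext => z; rewrite /dilate1 /tensor/= invF_dilate.
  have Ep : dilate1 (dyadic k) (dyadic k * m%:~R) (psi_km psi k m) = fun z => (dyadic_scale k)%:C * psi z.
    apply/funext => -[x y]; rewrite /dilate1 /psi_km /=; congr (_ * psi (_, _)).
    by rewrite -/(dyadic k); field; rewrite gt_eqF.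
  rewrite (inner_dilate1 (dyadic k * m%:~R) c0 lt lk) Ef Ep.
  have [lib _] := plancherel cb; have ltb := L2_tensor lib lh.
  rewrite innerZr// conjc_real duality//.
  have lbh := L2_tensor (cbounded_L2 cb) lh.
  rewrite (inner_sections lbh lP).
  have lb := cbounded_L2 cb; have lp := L2_pairing lh.
  have E eta : inner (leb R) (fun y => tensor b h (eta, y)) (fun y => P (eta, y)) =
      b eta * inner (leb R) h (fun y => P (eta, y)) by rewrite -(innerZl _ lh (lPs eta)).
  have ib : cintble (leb R) (fun eta => inner (leb R) (fun y => tensor b h (eta, y))
      (fun y => P (eta, y))).
    have := cintble_L2 lb (L2_conj lp); congr cintble; apply/funext => eta.
    by rewrite conjcK E.
  rewrite mulrA -cintZ//; apply: eq_cint => eta _; rewrite E fibre_tensor//.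
  rewrite /fexp EfunN conjcM conjcK conjc_real /b.
  have [etaU|etaU] := pselect (unit_itv eta).
    rewrite indicE mem_set//= mul1r /Efun -rmorphM/=.
    have -> : expi (2 * pi * m%:~R * eta) = Efun m eta by [].
    set X := inner _ _ _; set Y := a _; set Z := Efun _ _.
    have -> : (dyadic k * dyadic_scale k)%:C * ((dyadic k)^-1%:C * (Z * Y) * X) =
      ((dyadic k * dyadic_scale k) * (dyadic k)^-1)%:C * (Z * Y * X) by rewrite rmorphM/=; ring.
    rewrite (_ : dyadic k * dyadic_scale k * (dyadic k)^-1 = dyadic_scale k); first by ring.
    by field; rewrite gt_eqF.
  have -> : inner (leb R) h (fun y => P (eta, y)) = 0.
    rewrite (_ : (fun y => P (eta, y)) = fun=> 0).
      by rewrite (innerC (L2_0 _) lh) inner0l conjc0.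
    by apply/funext => y; exact: P0.
  by rewrite !(mulr0, mul0r).
- have -> : fibre (fun=> 0) k = fun=> 0.
    by apply/funext => eta; rewrite /fibre inner0l mulr0.
  by rewrite !inner0l.
Qed.

Lemma fibre_off f F k eta : tens f F -> ~ unit_itv eta -> fibre F k eta = 0.
Proof.
move=> tf eU; have [_ _ sF] := tens_L2 tf; rewrite /fibre.
rewrite (_ : (fun y => P (eta, y)) = fun=> 0); last by apply/funext => y; exact: P0.
by rewrite (innerC (L2_0 _) (sF _)) inner0l conjc0 mulr0.
Qed.

(** Substituting eta = 2^k x produces the Jacobian 2^k, which cancels the square of the normalizing
    factor 2^(-k/2). *)
Lemma nsq_fibre f F k : tens f F ->
  (nsq (leb R) (fibre F k))%:E = (\int[leb R]_x (sqmod (Rk F k x))%:E)%E.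
Proof.
move=> tf; have c0 := dyadic_gt0 k; have lf := L2_fibre k tf.
have E x : fibre F k (dyadic k * x + 0) = (dyadic_scale k)%:C * Rk F k x.
  rewrite /fibre /Rk /Pk !addr0.
  by rewrite (_ : (dyadic k)^-1 * (dyadic k * x) = x)// mulKf// gt_eqF.
have lR : L2 (leb R) (Rk F k).
  have := L2Z ((dyadic_scale k)^-1%:C) (L2_affine 0 c0 lf); congr L2; apply/funext => x.
  rewrite E mulrA -rmorphM/= mulVf ?mul1r// gt_eqF//; exact: dyadic_scale_gt0.
rewrite -(nsqE lR) (nsq_affine 0 c0 lf).
rewrite (_ : (fun x => fibre F k (dyadic k * x + 0)) = fun x => (dyadic_scale k)%:C * Rk F k x); last first.
  by apply/funext => x; exact: E.
by rewrite nsqZ// sqmod_real mulrA dyadic_scale_sqr mul1r.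
Qed.

Lemma cmeasurable_Rk F k : cmeasurable F -> cmeasurable (Rk F k : T -> R[i]).
Proof.
move=> mF; apply: (@cmeasurable_inner1 _ F (fun z => P (dyadic k * z.1, z.2))) => //.
have := cmeasurable_dilate1 (dyadic k) 0 (L2_meas lP); congr cmeasurable; apply/funext => z.
by rewrite /dilate1 addr0.
Qed.

Lemma coef_square_sum f F : tens f F ->
  \esum_(km in [set: int * int]) (sqmod (inner (leb2 R) f (psi_km psi km.1 km.2)))%:E =
  (\int[leb R]_x (\esum_(k in [set: int]) (sqmod (Rk F k x))%:E))%E.
Proof.
move=> tf; have [_ lF _] := tens_L2 tf.
transitivity (\esum_(k in [set: int]) \esum_(m in [set: int])
    (sqmod (inner (leb2 R) f (psi_km psi k m)))%:E).
  rewrite (@esum_esum _ _ _ setT (fun=> setT)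
    (fun k m => (sqmod (inner (leb2 R) f (psi_km psi k m)))%:E)).
    by congr esum; apply/seteqP; split.
  by move=> i j _ _; rewrite lee_fin sqmod_ge0.
rewrite integral_esum_int//; last 2 first.
- by move=> k; exact: emeasurable_sqmod (cmeasurable_Rk k (L2_meas lF)).
- by move=> k x; rewrite lee_fin sqmod_ge0.
apply: eq_esum => k _; rewrite -(nsq_fibre k tf).
have f0 (x : R) : ~ unit_itv x -> fibre F k x = 0 by exact: fibre_off tf.
have := fourier_parseval (L2_fibre k tf) f0; rewrite /parseval => <-.
rewrite [RHS](@reindex_esum _ _ _ setT setT (fun m : int => - m)); last first.
  split; [by []|by move=> i j _ _ /oppr_inj|].
  by move=> i _; exists (- i); rewrite ?opprK.
by apply: eq_esum => m _; rewrite (coef_tens k m tf).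
Qed.

(** The exceptional null set may depend on h and h'. *)
Definition fibre_frame := forall h h', L2 (leb R) h -> L2 (leb R) h' ->
  {ae leb R, forall x, gsum_is ibox
    (fun k => inner (leb R) h (Pk k x) * inner (leb R) (Pk k x) h') (inner (leb R) h h')}.

Lemma Rk_lin c f F g G k x : tens f F -> tens g G ->
  Rk (fun z => c * F z + G z) k x = c * Rk F k x + Rk G k x.
Proof.
move=> tf tg; have [_ _ sF] := tens_L2 tf; have [_ _ sG] := tens_L2 tg.
have lp := L2_Pk k x.
by rewrite /Rk (innerDl (L2Z c (sF x)) (sG x) lp) (innerZl c (sF x) lp).
Qed.

Lemma Rk_tensor a h k x : L2 (leb R) h -> Rk (tensor a h) k x = a x * inner (leb R) h (Pk k x).
Proof. by move=> lh; rewrite /Rk -(innerZl _ lh (L2_Pk k x)). Qed.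

(** Each induction step meets finitely many null sets, and on a generator the scalar a(x) conj(b(x))
    factors out of the equation for the pair h, h'. A general F would call for uncountably many
    pairs at once. *)
Lemma fibre_frame_tens f F g G : fibre_frame -> tens f F -> tens g G ->
  {ae leb R, forall x, gsum_is ibox (fun k => Rk F k x * conjc (Rk G k x))
    (inner (leb R) (fun y => F (x, y)) (fun y => G (x, y)))}.
Proof.
have exh := exhausting_ibox => fr tf; elim=> [|b h' cb lh'|c g1 G1 g2 G2 tg1 ih1 tg2 ih2].
- have [_ _ sF] := tens_L2 tf; apply: aeW => x.
  rewrite (innerC (L2_0 _) (sF x)) inner0l conjc0.
  apply: (gsum_ext (gsum0 _)) => // k.
  by rewrite [X in _ * conjc X]/Rk inner0l conjc0 mulr0.
- elim: tf => [|a h ca lh|c f1 F1 f2 F2 tf1 ih1 tf2 ih2].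
  + apply: aeW => x; rewrite inner0l; apply: (gsum_ext (gsum0 _)) => // k.
    by rewrite [X in X * _]/Rk inner0l mul0r.
  + apply: (aeS (fr h h' lh lh')) => x hx.
    apply: (gsum_ext (gsum_lin (a x * conjc (b x)) hx (gsum0 _))) => [k|].
      by rewrite !Rk_tensor// conjcM (innerC lh' (L2_Pk k x)); ring.
    rewrite /tensor (innerZl (a x) lh (L2Z (b x) lh')) (innerZr (b x) lh' lh); ring.
  + have [_ _ s1] := tens_L2 tf1; have [_ _ s4] := tens_L2 tf2.
    have [_ _ s3] := tens_L2 (tens_gen cb lh').
    apply: (aeS (aeI ih1 ih2)) => x [h1 h2].
    apply: (gsum_ext (gsum_lin c h1 h2)) => [k|].
      by rewrite (Rk_lin c k x tf1 tf2); ring.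
    by rewrite (innerDl (L2Z c (s1 x)) (s4 x) (s3 x)) (innerZl c (s1 x) (s3 x)).
- have [_ _ s1] := tens_L2 tg1; have [_ _ s4] := tens_L2 tg2.
  have [_ _ s3] := tens_L2 tf.
  apply: (aeS (aeI ih1 ih2)) => x [h1 h2].
  apply: (gsum_ext (gsum_lin (conjc c) h1 h2)) => [k|].
    by rewrite (Rk_lin c k x tg1 tg2) (conjcD (c * Rk G1 k x)) (conjcM c (Rk G1 k x)); ring.
  by rewrite (innerDr (L2Z c (s1 x)) (s4 x) (s3 x)) (innerZr c (s1 x) (s3 x)).
Qed.

Lemma parseval_tens f F : fibre_frame -> tens f F ->
  parseval (leb2 R) (fun km => psi_km psi km.1 km.2) f.
Proof.
move=> fr tf; have [lf lF sF] := tens_L2 tf; rewrite /parseval (coef_square_sum tf).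
have nfF : nsq (leb2 R) f = nsq (leb2 R) F.
  by apply: (@complexI R); rewrite -!inner_nsq; exact: tens_isometry.
rewrite nfF (nsqE lF) (tonelli1 (measurable_sqmod (L2_meas lF)) (fun z => sqmod_ge0 _)).
apply: ae_eq_integral => //.
- apply: measurable_esum_int => [k|k x].
    exact: emeasurable_sqmod (cmeasurable_Rk k (L2_meas lF)).
  by rewrite lee_fin sqmod_ge0.
- exact: (measurable_tonelli1 (measurable_sqmod (L2_meas lF)) (fun z => sqmod_ge0 _)).
- apply: (aeS (fibre_frame_tens fr tf tf)) => x hx _ /=.
  rewrite -(nsqE (sF x)); apply: (gsum_esum exhausting_ibox (u := fun k => Rk F k x)).
  rewrite -inner_nsq; move: hx; congr gsum_is.
  by apply/funext => k; rewrite mulc_conj.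
Qed.

Definition in_tens f := exists F, tens f F.

Lemma closed_subspace_tens : closed_subspace (leb2 R) (closure_L2 (leb2 R) in_tens).
Proof.
apply: closure_L2_closed.
- by move=> f [F /tens_L2[]].
- by exists (fun=> 0); exact: tens_0.
- move=> c v w [F tF] [G tG]; exists (fun z => c * F z + G z); exact: tens_lin.
Qed.

Lemma closure_tensor a h : cbounded a -> L2 (leb R) h ->
  closure_L2 (leb2 R) in_tens (tensor a h).
Proof.
move=> ca lh; have la := cbounded_L2 ca; split; first exact: L2_tensor.
move=> t t0; have n0 := nsq_ge0 (leb R) h.
(* The error is |a - invF b|^2 |h|^2; adding 1 to the divisor covers h of norm 0. *)
have k0 : 0 < nsq (leb R) h + 1 by lra.
have [b cb ab] := invF_dense ca (divr_gt0 t0 k0).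
exists (tensor (invF b) h); first by exists (tensor b h); exact: tens_gen.
have [lb _] := plancherel cb; have lab := L2B la lb.
have -> : (fun z => tensor a h z - tensor (invF b) h z) =
    tensor (fun x => a x - invF b x) h by apply/funext => z; rewrite /tensor mulrBl.
have E : nsq (leb2 R) (tensor (fun x => a x - invF b x) h) =
    nsq (leb R) (fun x => a x - invF b x) * nsq (leb R) h.
  by apply: (@complexI R); rewrite rmorphM/= -!inner_nsq inner_tensor.
rewrite E; have nab := nsq_ge0 (leb R) (fun x => a x - invF b x).
rewrite ltr_pdivlMr// in ab; nra.
Qed.

Definition square (r : R) : set (T * T) := sym_itv r `*` sym_itv r.

Lemma square_measurable (r : R) : measurable (square r).
Proof. by apply: measurableX; exact: sym_itv_measurable. Qed.

Lemma tensor_indic (A B : set T) (z : T * T) :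
  (\1_(A `*` B) z)%:C = tensor (fun x => (\1_A x)%:C) (fun y => (\1_B y)%:C) z :> R[i].
Proof.
by case: z => x y; rewrite /tensor/= -rmorphM/= !indicE in_setX/= -natrM mulnb.
Qed.

Lemma square_fin (r : R) : (leb2 R (square r) < +oo)%E.
Proof.
have [_ h] := L2_tensor (L2_sym_itv r) (L2_sym_itv r).
move: h; under eq_integral => z _.
  rewrite -tensor_indic sqmod_real (_ : _ ^+ 2 = \1_(square r) z); first over.
  by rewrite indicE; case: (_ \in _); rewrite ?expr1n ?expr0n.
by rewrite integral_indic ?setIT//; exact: square_measurable.
Qed.

(** Truncation to large squares reduces to finite measure. There the measurable rectangles generate
    the product sigma-algebra and are stable under intersection, and the indicator of a truncated
    rectangle is a tensor of two [cbounded] indicators. *)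
Lemma tens_dense f : L2 (leb2 R) f -> closure_L2 (leb2 R) in_tens f.
Proof.
move=> lf; have cs := closed_subspace_tens.
apply: (cs_closed cs) => // t t0.
have exhD (z : T * T) : exists N0 : nat, forall N, (N0 <= N)%N -> square N%:R z.
  have [N1 h1] := sym_itv_exhaust z.1; have [N2 h2] := sym_itv_exhaust z.2.
  exists (maxn N1 N2) => N; rewrite geq_max => /andP[n1 n2].
  by split; [exact: h1|exact: h2].
have [N hN] := cvg0_small (nsq_exhaust lf (fun N => square_measurable N%:R) exhD) t0.
exists (fun z => (\1_(square N%:R) z)%:C * f z) => //.
apply: (cs_restrict cs) => //; first exact: square_measurable.
have CR (A B : set T) : measurable A -> measurable B ->
    closure_L2 (leb2 R) in_tens (fun z => (\1_((A `*` B) `&` square N%:R) z)%:C).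
  move=> mA mB; have cA := cbounded_indic N mA; have cB := cbounded_indic N mB.
  have := closure_tensor cA (cbounded_L2 cB); congr closure_L2; apply/funext => z.
  rewrite -tensor_indic; congr (\1_ _ _)%:C.
  by rewrite /square setXI.
apply: (cs_indicator cs (square_measurable N%:R) (square_fin N%:R)
  (G := [set A `*` B | A in measurable & B in measurable])).
- exact: measurable_prod_measurableType.
- move=> _ _ [A mA [B mB <-]] [A' mA' [B' mB' <-]].
  exists (A `&` A'); first exact: measurableI.
  by exists (B `&` B'); [exact: measurableI|rewrite setXI].
- have := CR setT setT measurableT measurableT; congr closure_L2; apply/funext => z.
  by rewrite setXTT setTI.
- by move=> _ [A mA [B mB <-]]; exact: CR.
Qed.

Lemma reproducing_gsum : reproducing psi <->
  forall f g, L2 (leb2 R) f -> L2 (leb2 R) g ->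
    gsum_is ibox2 (fun km => inner (leb2 R) f (psi_km psi km.1 km.2)
       * inner (leb2 R) (psi_km psi km.1 km.2) g) (inner (leb2 R) f g).
Proof. by split=> H f g lf lg; apply/zsum2_gsum; exact: H. Qed.

Lemma reproducing_of_frame : fibre_frame -> reproducing psi.
Proof.
move=> fr; apply/reproducing_gsum => f g lf lg.
have le (km : int * int) : L2 (leb2 R) (psi_km psi km.1 km.2) by exact: L2_psi_km.
apply: (parseval_gsum le exhausting_ibox2) => // c _.
apply: (parseval_dense le (X := L2 (leb2 R)) (V := in_tens)) => //.
- by move=> v [F /tens_L2[]].
- by move=> u v lu lv; exact: L2B.
- by move=> v [F tF]; exact: parseval_tens tF.
- by move=> u t lu t0; have [_ /(_ t t0)] := tens_dense lu.
- by apply: L2D => //; exact: L2Z.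
Qed.

Lemma parseval_of_reproducing f : reproducing psi -> L2 (leb2 R) f ->
  parseval (leb2 R) (fun km => psi_km psi km.1 km.2) f.
Proof.
move=> /reproducing_gsum rep lf; apply: (gsum_esum exhausting_ibox2).
have := rep f f lf lf; rewrite inner_nsq; congr gsum_is; apply/funext => km.
by rewrite [X in _ * X](innerC lf (L2_psi_km _ _)) mulc_conj.
Qed.

Lemma frame_diagonal h : reproducing psi -> L2 (leb R) h ->
  {ae leb R, forall x, parseval (leb R) (fun k => Pk k x) h}.
Proof.
move=> rep lh.
pose S (x : T) : \bar R := \esum_(k in [set: int]) (sqmod (inner (leb R) h (Pk k x)))%:E.
have S0 x : (0 <= S x)%E by apply: esum_ge0 => k _; rewrite lee_fin sqmod_ge0.
have mS : measurable_fun setT S.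
  apply: measurable_esum_int => [k|k x]; last by rewrite lee_fin sqmod_ge0.
  apply: emeasurable_sqmod; apply: (@cmeasurable_Rk (fun z => h z.2)).
  exact: (cmeasurable_comp (L2_meas lh) measurable_snd).
have key (A : set T) N : measurable A ->
    (\int[leb R]_(x in A `&` sym_itv N%:R) S x =
     \int[leb R]_(x in A `&` sym_itv N%:R) (nsq (leb R) h)%:E)%E.
  move=> mA; have ca := cbounded_indic N mA; have la := cbounded_L2 ca.
  have mAN : measurable (A `&` sym_itv N%:R).
    by apply: measurableI => //; exact: sym_itv_measurable.
  have tf := tens_gen ca lh; have [lf lF _] := tens_L2 tf.
  have := parseval_of_reproducing rep lf; rewrite /parseval (coef_square_sum tf).
  have -> : nsq (leb2 R) (tensor (invF (fun x => (\1_(A `&` sym_itv N%:R) x)%:C)) h) =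
     nsq (leb R) (fun x => (\1_(A `&` sym_itv N%:R) x)%:C) * nsq (leb R) h.
    apply: (@complexI R); rewrite rmorphM/= -!inner_nsq (tens_isometry tf tf).
    by rewrite inner_tensor.
  rewrite EFinM (nsqE la) => E; transitivity (leb R (A `&` sym_itv N%:R) * (nsq (leb R) h)%:E)%E.
    rewrite (_ : leb R (A `&` sym_itv N%:R) =
        (\int[leb R]_x (sqmod ((\1_(A `&` sym_itv N%:R) x)%:C : R[i]))%:E)%E); last first.
      transitivity (\int[leb R]_x (\1_(A `&` sym_itv N%:R) x)%:E)%E.
        by rewrite integral_indic// setIT.
      apply: eq_integral => x _.
      by rewrite sqmod_real indicE; case: (_ \in _); rewrite ?expr1n ?expr0n.
    rewrite -E integral_mkcond; apply: eq_integral => x _; rewrite /patch.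
    case: ifP => xA.
      by apply: eq_esum => k _; rewrite Rk_tensor// indicE xA mul1r.
    by rewrite esum1// => k _; rewrite Rk_tensor// indicE xA mul0r sqmod0.
  by rewrite integral_cst// muleC.
have onN N : {ae leb R, forall x, sym_itv N%:R x -> S x = (nsq (leb R) h)%:E}.
  have mN := sym_itv_measurable (R := R) N%:R; have fN := sym_itv_fin (R := R) N%:R.
  (* S could take infinite values; the identity for the whole interval shows that it is integrable
     there, after which equal integrals over all measurable subsets force equality almost
     everywhere. *)
  have iS : (leb R).-integrable (sym_itv N%:R) S.
    apply/integrableP; split; first exact: measurable_funTS.
    rewrite (eq_integral S); last by move=> x _; rewrite gee0_abs.
    have := key setT N measurableT; rewrite setTI => ->.
    by rewrite integral_cst//; apply: lte_mul_pinfty => //; rewrite lee_fin nsq_ge0.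
  apply: (integral_ae_eq mN iS) => [|A AN mA]; first exact: measurable_cst.
  by have := key A N mA; rewrite (_ : A `&` sym_itv N%:R = A)//; apply/setIidl.
apply: (aeS (ae_foralln onN)) => x hx; rewrite /parseval.
have [N hN] := sym_itv_exhaust x; exact: hx N (hN N (leqnn N)).
Qed.

Lemma frame_of_reproducing : reproducing psi -> fibre_frame.
Proof.
move=> rep h h' lh lh'.
have H c := frame_diagonal rep (L2D lh (L2Z c lh')).
(* Polarization in the fibre calls for four combinations of h and h', hence for the union of four
   null sets. *)
apply: (aeS (aeI (H 1) (aeI (H (-1)) (aeI (H 'i) (H (- 'i)))))) => x [h1 [h2 [h3 h4]]].
apply: (parseval_gsum (fun k => L2_Pk k x) exhausting_ibox) => // c.
by rewrite !inE => /or4P[] /eqP ->.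
Qed.


End core.

(** * From the given partial transform to a regular version *)

Section reduction.
Context {R : realType}.
Local Notation T := (measurableTypeR R).

(* The complement of the essential support is a countable union of rational
   intervals on which h vanishes almost everywhere. *)
Lemma ess_supp_vanish (h : R -> R[i]) :
  ess_supp (leb R) h `<=` unit_itv -> {ae leb R, forall x, ~ unit_itv x -> h x = 0}.
Proof.
move=> hU.
pose good (pq : rat * rat) := {ae leb R, forall x, ratr pq.1 < x < ratr pq.2 -> h x = 0}.
(* Pairs of rationals are enumerated by [unpickle]. For a pair that is not good the implication is
   void, so every index contributes one null set. *)
have all_good : {ae leb R, forall x, forall n : nat, match @choice.unpickle (rat * rat)%type n with
    | Some pq => good pq -> ratr pq.1 < x < ratr pq.2 -> h x = 0 | None => True end}.
  apply: ae_foralln => n; case: (choice.unpickle n) => [pq|]; last exact: aeW.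
  have [g|ng] := pselect (good pq); last by apply: aeW => x /ng.
  by apply: (aeS g) => x hx _.
apply: (aeS all_good) => x hx xU.
have [F [cF aeF] nFx] : exists2 F, closed F /\ {ae leb R, forall x, ~ F x -> h x = 0} & ~ F x.
  apply: contrapT => H; apply: xU; apply: hU => F [cF aeF].
  by apply: contrapT => nFx; apply: H; exists F.
have oF : open (~` F) by exact: closed_openC.
have /nbhs_ballP[e /= e0 be] : nbhs x (~` F) by apply: open_nbhs_nbhs.
have [p] := @rat_in_itvoo R (x - e) x ltac:(lra).
have [q] := @rat_in_itvoo R x (x + e) ltac:(lra).
rewrite !in_itv/= => /andP[q1 q2] /andP[p1 p2].
have gpq : good (p, q).
  apply: (aeS aeF) => y hy /= /andP[y1 y2]; apply: hy; apply: be.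
  by rewrite /ball/= ltr_norml; apply/andP; split; lra.
by have := hx (choice.pickle (p, q)); rewrite choice.pickleK; apply => //=; apply/andP.
Qed.

Lemma ge0_integral_eq0P (v : T -> \bar R) : measurable_fun setT v ->
  (forall x, 0 <= v x)%E -> (\int[leb R]_x v x = 0)%E <-> {ae leb R, forall x, v x = 0%E}.
Proof.
move=> mv v0; have := @ae_eq_integral_abs _ _ _ (leb R) setT measurableT v mv.
have -> : (\int[leb R]_x `|v x| = \int[leb R]_x v x)%E.
  by apply: eq_integral => x _; rewrite gee0_abs.
move=> [h1 h2]; split.
  by move=> /h1 h; apply: (aeS h) => x /(_ I).
by move=> h; apply: h2; apply: (aeS h) => x.
Qed.

(** By Tonelli either iterated statement says that the integral of u over the plane vanishes. *)
Lemma ae_swap (u : T * T -> R) : measurable_fun setT u -> (forall z, 0 <= u z) ->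
  {ae leb R, forall y, {ae leb R, forall x, u (x, y) = 0}} ->
  {ae leb R, forall x, {ae leb R, forall y, u (x, y) = 0}}.
Proof.
move=> mu u0 H.
have mu' : measurable_fun setT (fun z => u (z.2, z.1)) by exact: (measurableT_comp mu measurable_flip).
have E1 (v : T -> R) : measurable_fun setT v -> (forall x, 0 <= v x) ->
    (\int[leb R]_x (v x)%:E = 0)%E <-> {ae leb R, forall x, v x = 0}.
  move=> mv v0; have [h1 h2] := ge0_integral_eq0P (v := EFin \o v) ltac:(exact/measurable_EFinP)
    (fun x => v0 x : (0 <= (v x)%:E)%E).
  split => [/h1 h|h]; first by apply: (aeS h) => x /= [].
  by apply: h2; apply: (aeS h) => x /= ->.
have i0 : (\int[leb2 R]_z (u z)%:E = 0)%E.
  rewrite (tonelli2 mu u0); apply/ge0_integral_eq0P.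
  - exact: (measurable_tonelli1 mu' (fun z => u0 _)).
  - by move=> y; apply: integral_ge0 => x _; rewrite lee_fin.
  - by apply: (aeS H) => y hy; apply/E1 => //; exact: measurable_section2.
rewrite (tonelli1 mu u0) in i0.
have /ge0_integral_eq0P h := i0.
apply: (aeS (h (measurable_tonelli1 mu u0) _)).
  by move=> x; apply: integral_ge0 => y _; rewrite lee_fin.
by move=> x hx; apply/E1 => //; exact: measurable_section1.
Qed.

Context (psi Psi : T * T -> R[i]).
Hypotheses (lpsi : L2 (leb2 R) psi) (lPsi : L2 (leb2 R) Psi).
Hypothesis psiFT : {ae leb R, forall y,
  is_fourier_L2 (fun x => psi (x, y)) (fun s => Psi (s, y))}.
Hypothesis supp : {ae leb R, forall y,
  ess_supp (leb R) (fun s => Psi (s, y)) `<=` unit_itv}.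

(* Psi is changed on a null set, so that the identities for the fibres hold for
   every frequency and not only almost everywhere. *)
Definition good_fibres : set T :=
  [set x | (\int[leb R]_y (sqmod (Psi (x, y)))%:E < +oo)%E] `&` unit_itv.

Definition regular_version : T * T -> R[i] := fun z => (\1_good_fibres z.1)%:C * Psi z.

Lemma good_fibres_measurable : measurable good_fibres.
Proof.
apply: measurableI; last exact: unit_itv_measurable.
have m := measurable_tonelli1 (measurable_sqmod (L2_meas lPsi)) (fun z => sqmod_ge0 _).
by have := emeasurable_fun_infty_o measurableT m +oo%E; rewrite setTI.
Qed.

Lemma L2_regular_version : L2 (leb2 R) regular_version.
Proof.
apply: (L2_le (c := 1) lPsi).
  apply: cmeasurableM; last exact: L2_meas lPsi.
  have mi : cmeasurable (fun x : T => (\1_good_fibres x)%:C : R[i]).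
    exact: cmeasurable_real (measurable_indic good_fibres_measurable).
  exact: (cmeasurable_comp mi measurable_fst).
move=> z; rewrite /regular_version sqmodM sqmod_real mul1r indicE; case: (_ \in _).
  by rewrite expr1n mul1r.
by rewrite expr0n mul0r sqmod_ge0.
Qed.

Lemma regular_version_section (x : R) : L2 (leb R) (fun y => regular_version (x, y)).
Proof.
have [xB|xB] := pselect (good_fibres x).
  rewrite (_ : (fun y => _) = fun y => Psi (x, y)).
    have [xA _] := xB; split; last exact: xA.
    exact: (cmeasurable_section1 x (L2_meas lPsi)).
  by apply/funext => y; rewrite /regular_version indicE mem_set//= mul1r.
rewrite (_ : (fun y => _) = fun=> 0); first exact: L2_0.
by apply/funext => y; rewrite /regular_version indicE memNset//= mul0r.
Qed.

Lemma regular_version_off (x y : R) : ~ unit_itv x -> regular_version (x, y) = 0.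
Proof. by move=> xU; rewrite /regular_version indicE memNset ?mul0r// => -[]. Qed.

(** The support condition speaks of almost every y and then of almost every frequency; [ae_swap],
    applied to |Psi|^2 off the unit interval, reverses the order. Inside the interval the two
    functions differ only at frequencies whose fibre is not square integrable, a null set. *)
Lemma ae_regular_version :
  {ae leb R, forall x, {ae leb R, forall y, Psi (x, y) = regular_version (x, y)}}.
Proof.
pose u (z : T * T) := \1_(~` unit_itv) z.1 * sqmod (Psi z).
have mu : measurable_fun setT u.
  apply: measurable_funM; last exact: measurable_sqmod (L2_meas lPsi).
  have mC : measurable (~` (unit_itv : set T)) by apply: measurableC; exact: unit_itv_measurable.
  have mi : measurable_fun setT (\1_(~` unit_itv) : T -> R) by exact: measurable_indic.
  exact: (measurableT_comp mi measurable_fst).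
have u0 z : 0 <= u z by rewrite mulr_ge0 ?sqmod_ge0// indicE.
have H : {ae leb R, forall y, {ae leb R, forall x, u (x, y) = 0}}.
  apply: (aeS supp) => y /ess_supp_vanish hy; apply: (aeS hy) => x hx.
  rewrite /u/=; have [xU|xU] := pselect (unit_itv x).
    by rewrite indicE memNset ?mul0r//; apply.
  by rewrite hx// sqmod0 mulr0.
apply: (aeS (aeI (ae_swap mu u0 H) (ae_L2_section1 lPsi))) => x [hx [_ xA]].
have [xU|xU] := pselect (unit_itv x).
  by apply: aeW => y; rewrite /regular_version indicE mem_set//= mul1r.
apply: (aeS hx) => y; rewrite regular_version_off// /u/= indicE mem_set//= mul1r.
exact: sqmod_eq0.
Qed.

(** Fubini is used in both orders: with y outside, the one-variable duality applies for almost every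
    y; with the frequency outside, Psi is replaced by its regular version. *)
Lemma duality_regular_version a h : cbounded a -> L2 (leb R) h ->
  inner (leb2 R) (tensor (invF a) h) psi = inner (leb2 R) (tensor a h) regular_version.
Proof.
move=> ca lh; have [li _] := plancherel ca; have la := cbounded_L2 ca.
have lt := L2_tensor li lh; have lta := L2_tensor la lh; have lr := L2_regular_version.
have m1 := cmeasurableM (L2_meas lt) (cmeasurable_conj (L2_meas lpsi)).
have m2 := cmeasurableM (L2_meas lta) (cmeasurable_conj (L2_meas lPsi)).
have m3 := cmeasurableM (L2_meas lta) (cmeasurable_conj (L2_meas lr)).
transitivity (inner (leb2 R) (tensor a h) Psi); rewrite /inner.
  rewrite (cint_fubini2 (cintble_L2 lt lpsi)) (cint_fubini2 (cintble_L2 lta lPsi)).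
  apply: ae_eq_cint; [exact: (cmeasurable_cint2 m1)|exact: (cmeasurable_cint2 m2)|].
  apply: (aeS psiFT) => y hy; have [lp [lP _]] := hy.
  transitivity (h y * inner (leb R) (invF a) (fun x => psi (x, y))).
    rewrite /inner -cintZ; last exact: cintble_L2.
    by apply: eq_cint => x _; rewrite /tensor/=; ring.
  rewrite (invF_fourier_L2 ca hy) /inner -cintZ; last exact: cintble_L2.
  by apply: eq_cint => x _; rewrite /tensor/=; ring.
rewrite (cint_fubini1 (cintble_L2 lta lPsi)) (cint_fubini1 (cintble_L2 lta lr)).
apply: ae_eq_cint; [exact: (cmeasurable_cint1 m2)|exact: (cmeasurable_cint1 m3)|].
apply: (aeS ae_regular_version) => x hx.
apply: ae_eq_cint; [exact: (cmeasurable_section1 x m2)|exact: (cmeasurable_section1 x m3)|].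
by apply: (aeS hx) => y ->.
Qed.

(** The dilation by 2^k pulls null sets back to null sets, and there are countably many k, so one
    null set of frequencies serves all of them. *)
Lemma ae_pairings f g : L2 (leb R) f -> L2 (leb R) g ->
  {ae leb R, forall xi, forall k : int,
    cint (leb R) setT (fun y => conjc (Psi ((2 : R) `^ (k%:~R) * xi, y)) * f y)
    * cint (leb R) setT (fun y => Psi ((2 : R) `^ (k%:~R) * xi, y) * conjc (g y))
    = inner (leb R) f (Pk regular_version k xi) * inner (leb R) (Pk regular_version k xi) g}.
Proof.
move=> lf lg; apply: ae_all_int => k.
apply: (aeS (ae_affine 0 (powR_gt0 k%:~R (ltr0n R 2)) ae_regular_version)) => xi.
rewrite addr0 => hx.
have mP := cmeasurable_section1 ((2 : R) `^ (k%:~R) * xi) (L2_meas lPsi).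
have mr := L2_meas (regular_version_section ((2 : R) `^ (k%:~R) * xi)).
congr (_ * _); apply: ae_eq_cint.
- by apply: cmeasurableM; [exact: cmeasurable_conj mP|exact: L2_meas lf].
- by apply: cmeasurableM; [exact: L2_meas lf|exact: cmeasurable_conj mr].
- by apply: (aeS hx) => y ->; rewrite mulrC.
- by apply: cmeasurableM => //; apply: cmeasurable_conj; exact: L2_meas lg.
- by apply: cmeasurableM => //; apply: cmeasurable_conj; exact: L2_meas lg.
- by apply: (aeS hx) => y ->.
Qed.

End reduction.

(* Psi (s, y) stands for psi(\hat s, y): a (jointly measurable, L^2) version
   of the Fourier transform of psi in the first variable. *)
Theorem theorem1p3 (R : realType) (psi Psi : R * R -> R[i])
  (hpsi : L2 (leb2 R) psi)
  (hPsi : L2 (leb2 R) Psi)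
  (hPsiFT : {ae leb R, forall y,
              is_fourier_L2 (fun x => psi (x, y)) (fun s => Psi (s, y))})
  (hsupp : {ae leb R, forall y,
              ess_supp (leb R) (fun s => Psi (s, y)) `<=` `[- (1/2), 1/2]}) :
  reproducing psi <->
  (forall f g : R -> R[i], L2 (leb R) f -> L2 (leb R) g ->
     {ae leb R, forall xi,
        zsum_is (fun k : int =>
            cint (leb R) setT
              (fun y => conjc (Psi ((2 : R) `^ (k%:~R) * xi, y)) * f y)
          * cint (leb R) setT
              (fun y => Psi ((2 : R) `^ (k%:~R) * xi, y) * conjc (g y)))
          (inner (leb R) f g)}).
Proof.
have lr := L2_regular_version hPsi.
have rs := regular_version_section hPsi.
have dual := duality_regular_version hpsi hPsi hPsiFT hsupp.
have off := @regular_version_off R Psi.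
split=> [rep f g lf lg|H].
  have fr := frame_of_reproducing hpsi lr rs off dual rep.
  apply: (aeS (aeI (fr f g lf lg) (ae_pairings hPsi hsupp lf lg))) => xi [h1 h2].
  by apply/zsum_gsum; apply: (gsum_ext h1) => // k; rewrite h2.
apply: (reproducing_of_frame hpsi lr rs off dual) => f g lf lg.
have h := aeI (H f g lf lg) (ae_pairings hPsi hsupp lf lg).
apply: (aeS h) => xi [/zsum_gsum h1 h2].
by apply: (gsum_ext h1) => // k; rewrite h2.
Qed.
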